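(* In the setting and notation of the context, for every $t\in[0,1]$ and every $k_1\in\{1,2,\dots,r\}$, $$\frac{d\psi(t)}{d\mathbf p_{k_1}}=\frac{\mathrm{sign}(s)\,s\,\beta^2}{2\sqrt n}\,\phi^{(k_1,\mathbf p)},\qquad \frac{d\psi(t)}{d\mathbf q_{k_1}}=\frac{\mathrm{sign}(s)\,s\,\beta^2}{2\sqrt n}\,\phi^{(k_1,\mathbf q)},$$ where, with $N=\|\mathbf x^{(i_1)}\|_2\|\mathbf x^{(p_1)}\|_2\|\mathbf y^{(i_2)}\|_2\|\mathbf y^{(p_2)}\|_2$, $\;V=\|\mathbf x^{(i_1)}\|_2\|\mathbf x^{(p_1)}\|_2(\mathbf y^{(p_2)})^T\mathbf y^{(i_2)}$, $\;W=\|\mathbf y^{(i_2)}\|_2\|\mathbf y^{(p_2)}\|_2(\mathbf x^{(i_1)})^T\mathbf x^{(p_1)}$ (functions of the indices $i_1,i_2,p_1,p_2$) and $\mathbb E=\mathbb E_{G,\mathcal U_{r+1}}$: for $k_1=1$, $$\phi^{(1,\mathbf p)}=-(1-t)(\mathbf m_1-\mathbf m_2)p\,\mathbb E\langle V\rangle_{\gamma_{21}^{(r)}}-t\,\mathbf q_1(\mathbf m_1-\mathbf m_2)p\,\mathbb E\langle N\rangle_{\gamma_{21}^{(r)}}+(1-t)\mathbf m_1(p-1)\,\mathbb E\langle V\rangle_{\gamma_{22}^{(r)}}+t\,\mathbf q_1\mathbf m_1(p-1)\,\mathbb E\langle N\rangle_{\gamma_{22}^{(r)}},$$ $$\phi^{(1,\mathbf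 q)}=-(1-t)(\mathbf m_1-\mathbf m_2)p\,\mathbb E\langle W\rangle_{\gamma_{21}^{(r)}}-t\,\mathbf p_1(\mathbf m_1-\mathbf m_2)p\,\mathbb E\langle N\rangle_{\gamma_{21}^{(r)}}+(1-t)\mathbf m_1(p-1)\,\mathbb E\langle W\rangle_{\gamma_{22}^{(r)}}+t\,\mathbf p_1\mathbf m_1(p-1)\,\mathbb E\langle N\rangle_{\gamma_{22}^{(r)}};$$ for $k_1\ge 2$, $$\phi^{(k_1,\mathbf p)}=-(1-t)(\mathbf m_{k_1}-\mathbf m_{k_1+1})p\,\mathbb E\langle V\rangle_{\gamma_{k_1+1}^{(r)}}-t\,\mathbf q_{k_1}(\mathbf m_{k_1}-\mathbf m_{k_1+1})p\,\mathbb E\langle N\rangle_{\gamma_{k_1+1}^{(r)}},$$ $$\phi^{(k_1,\mathbf q)}=-(1-t)(\mathbf m_{k_1}-\mathbf m_{k_1+1})p\,\mathbb E\langle W\rangle_{\gamma_{k_1+1}^{(r)}}-t\,\mathbf p_{k_1}(\mathbf m_{k_1}-\mathbf m_{k_1+1})p\,\mathbb E\langle N\rangle_{\gamma_{k_1+1}^{(r)}}.$$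
   Context: **Data.** $r,m,n,l$ are positive integers and $t\in[0,1]$. $\mathcal X=\{\mathbf x^{(1)},\dots,\mathbf x^{(l)}\}\subset\mathbb R^n$, $\bar{\mathcal X}=\{\bar{\mathbf x}^{(1)},\dots,\bar{\mathbf x}^{(l)}\}\subset\mathbb R^n$, $\mathcal Y=\{\mathbf y^{(1)},\dots,\mathbf y^{(l)}\}\subset\mathbb R^m$ are given; for each $i_3$ a function $f_{\bar{\mathbf x}^{(i_3)}}:\mathbb R^n\to\mathbb R$ is given; $\beta,p>0$ and $s\ne0$ are real. The vectors $\mathbf m=[\mathbf m_0,\dots,\mathbf m_{r+1}]$, $\mathbf p=[\mathbf p_0,\dots,\mathbf p_{r+1}]$, $\mathbf q=[\mathbf q_0,\dots,\mathbf q_{r+1}]$ are real with $\mathbf m_0=1$, $\mathbf m_{r+1}=0$, $\mathbf m_1,\dots,\mathbf m_r\neq0$, $1\ge\mathbf p_0\ge\mathbf p_1\ge\dots\ge\mathbf p_r\ge\mathbf p_{r+1}=0$, $1\ge\mathbf q_0\ge\mathbf q_1\ge\dots\ge\mathbf q_r\ge\mathbf q_{r+1}=0$. **Randomness.** $G\in\mathbb R^{m\times n}$ and, for $k=1,\dots,r+1$, $u^{(4,k)}\in\mathbb R$, $\mathbf u^{(2,k)}\in\mathbb R^m$, $\mathbf h^{(k)}\in\mathbb R^n$ have independent standard normal entries, all mutually independent; $\mathcal U_k=[u^{(4,k)},\mathbf u^{(2,k)},\mathbf h^{(k)}]$. A subscript of $\mathbb E$ indicates the random variables integrated out (all others held fixed).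 Put $a_k=\sqrt{\mathbf p_{k-1}\mathbf q_{k-1}-\mathbf p_k\mathbf q_k}$, $b_k=\sqrt{\mathbf p_{k-1}-\mathbf p_k}$, $c_k=\sqrt{\mathbf q_{k-1}-\mathbf q_k}$. **The function $\psi$.** $$D_0^{(i_1,i_2,i_3)}=\sqrt t(\mathbf y^{(i_2)})^TG\mathbf x^{(i_1)}+\sqrt{1-t}\,\|\mathbf x^{(i_1)}\|_2(\mathbf y^{(i_2)})^T\sum_{k=1}^{r+1}b_k\mathbf u^{(2,k)}+\sqrt t\,\|\mathbf x^{(i_1)}\|_2\|\mathbf y^{(i_2)}\|_2\sum_{k=1}^{r+1}a_ku^{(4,k)}+\sqrt{1-t}\,\|\mathbf y^{(i_2)}\|_2\Big(\sum_{k=1}^{r+1}c_k\mathbf h^{(k)}\Big)^T\mathbf x^{(i_1)}+f_{\bar{\mathbf x}^{(i_3)}}(\mathbf x^{(i_1)}),$$ $A_{i_3}^{(i_1,i_2)}=e^{\beta D_0^{(i_1,i_2,i_3)}}$, $C_{i_3}^{(i_1)}=\sum_{i_2=1}^lA_{i_3}^{(i_1,i_2)}$, $Z_{i_3}=\sum_{i_1=1}^l(C_{i_3}^{(i_1)})^s$, $$\zeta_1=\sum_{i_3=1}^l\big(\mathbb E_{\mathcal U_1}Z_{i_3}^{\mathbf m_1}\big)^p,\qquad \zeta_k=\mathbb E_{\mathcal U_k}\,\zeta_{k-1}^{\mathbf m_k/\mathbf m_{k-1}}\ (2\le k\le r),\qquad \psi(t)=\mathbb E_{G,\mathcal U_{r+1}}\frac{\log\zeta_r}{p|s|\sqrt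 n\,\mathbf m_r}.$$ $\psi(t)$ also depends on $\mathbf p,\mathbf q,\mathbf m$; $d\psi(t)/d\mathbf p_{k_1}$, $d\psi(t)/d\mathbf q_{k_1}$ are derivatives in that one coordinate with everything else (including $t$) fixed, the coordinate ranging over the interval allowed by the ordering constraints (assumed nondegenerate; one-sided derivatives at endpoints). **Averages.** Operators: $\Phi^{(i_3)}_{\mathcal U_1}(\cdot)=\mathbb E_{\mathcal U_1}\Big[\frac{Z_{i_3}^{\mathbf m_1}}{\mathbb E_{\mathcal U_1}Z_{i_3}^{\mathbf m_1}}(\cdot)\Big]$ and, for $k\ge2$, $\Phi_{\mathcal U_k}(\cdot)=\mathbb E_{\mathcal U_k}\Big[\frac{\zeta_{k-1}^{\mathbf m_k/\mathbf m_{k-1}}}{\zeta_k}(\cdot)\Big]$. Products $\prod_{k=r}^{j}\Phi_{\mathcal U_k}$ are compositions with decreasing index, $\Phi_{\mathcal U_r}$ outermost (identity if $r<j$). Weights: $$\gamma_{00}(i_3)=\frac{(\mathbb E_{\mathcal U_1}Z_{i_3}^{\mathbf m_1})^p}{\sum_{j=1}^l(\mathbb E_{\mathcal U_1}Z_j^{\mathbf m_1})^p},\qquad \gamma_0(i_1,i_2;i_3)=\frac{(C_{i_3}^{(i_1)})^s}{Z_{i_3}}\frac{A_{i_3}^{(i_1,i_2)}}{C_{i_3}^{(i_1)}},$$ $$\gamma_{21}^{(r)}=\prod_{k=r}^{2}\Phi_{\mathcal U_k}\Big(\gamma_{00}(i_3)\Phi^{(i_3)}_{\mathcal U_1}\gamma_0(i_1,i_2;i_3)\times\gamma_{00}(p_3)\Phi^{(p_3)}_{\mathcal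 U_1}\gamma_0(p_1,p_2;p_3)\Big),$$ $$\gamma_{22}^{(r)}=\prod_{k=r}^{2}\Phi_{\mathcal U_k}\Big(\gamma_{00}(i_3)\big(\Phi^{(i_3)}_{\mathcal U_1}\gamma_0(i_1,i_2;i_3)\times\Phi^{(i_3)}_{\mathcal U_1}\gamma_0(p_1,p_2;i_3)\big)\Big),$$ $$\gamma_{k_1+1}^{(r)}=\prod_{k=r}^{k_1+1}\Phi_{\mathcal U_k}\Big(\Big[\prod_{k=k_1}^{2}\Phi_{\mathcal U_k}\gamma_{00}(i_3)\Phi^{(i_3)}_{\mathcal U_1}\gamma_0(i_1,i_2;i_3)\Big]\times\Big[\prod_{k=k_1}^{2}\Phi_{\mathcal U_k}\gamma_{00}(p_3)\Phi^{(p_3)}_{\mathcal U_1}\gamma_0(p_1,p_2;p_3)\Big]\Big),\quad k_1\ge2.$$ In products each factor is integrated separately. For a function $h$ of $(i_1,i_2,p_1,p_2)$, $\langle h\rangle_\gamma$ is the sum of $h$ times the weight $\gamma$ over all indices appearing ($i_1,i_2,i_3,p_1,p_2,p_3\in\{1,\dots,l\}$, or $i_1,i_2,i_3,p_1,p_2$ for $\gamma_{22}^{(r)}$). All weights are evaluated at the given $t$. *)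

(* Defs.v *)
From HB Require Import structures.
From mathcomp Require Export all_boot all_order all_algebra.
From mathcomp Require Export all_classical all_reals all_analysis measurable_realfun.
Export Order.TTheory GRing.Theory Num.Theory numFieldNormedType.Exports.
Set Implicit Arguments.
Unset Strict Implicit.
Unset Printing Implicit Defensive.
Local Open Scope classical_set_scope.
Local Open Scope ring_scope.

Section iid.
Context d (T : measurableType d) (R : realType) (P : probability T R).

Definition tcons k (z : T * k.-tuple T) : k.+1.-tuple T := [tuple of z.1 :: z.2].

Lemma measurable_tcons k : measurable_fun [set: T * k.-tuple T] (@tcons k).
Proof. exact: measurable_cons. Qed.

HB.instance Definition _ k :=
  isMeasurableFun.Build _ _ (T * k.-tuple T)%type (k.+1.-tuple T)
    (@tcons k) (@measurable_tcons k).

(* The law of k independent draws from P. *)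
Fixpoint iid k : probability (k.-tuple T) R :=
  match k with
  | 0%N => \d_ ([tuple] : 0.-tuple T)
  | k'.+1 => distribution (P \x iid k')%E (@tcons k')
  end.

End iid.

Definition dot (R : realType) k (u v : 'cV[R]_k) : R := (u^T *m v) 0 0.

(* The norm that MathComp-Analysis puts on matrices is the sup norm. *)
Definition norm2 (R : realType) k (u : 'cV[R]_k) : R :=
  Num.sqrt (\sum_i u i 0 ^+ 2).

Definition cvec (R : realType) k (v : k.-tuple R) : 'cV[R]_k :=
  \col_i tnth v i.

Definition upd (A : Type) (v : nat -> A) (k : nat) (a : A) : nat -> A :=
  fun j => if j == k then a else v j.

(* f is differentiable at x relative to I, with derivative df.  At an endpoint
   of a nondegenerate interval I this is the one-sided derivative. *)
Definition is_derive_within (R : realType) (I : set R) (f : R -> R)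
    (x df : R) : Prop :=
  (f u - f x) / (u - x) @[u --> within I x^'] --> df.

(* fn is the map that sends xbar to the function f_xbar. *)
Record model (R : realType) (m n l : nat) := Model {
  xs : 'I_l -> 'cV[R]_n ;
  xbars : 'I_l -> 'cV[R]_n ;
  ys : 'I_l -> 'cV[R]_m ;
  fn : 'cV[R]_n -> 'cV[R]_n -> R ;
  beta : R ;
  expo_p : R ;
  expo_s : R }.

Section psi.
Context {R : realType} {m n l : nat} (D : model R m n l) (r : nat) (t : R).

(* mv, pv and qv are only read at the indices 0, ..., r+1. *)
Variables mv pv qv : nat -> R.

Local Notation RB := (measurableTypeR R).

Definition std_normal : probability RB R := normal_prob 0 1.

(* Values of G, row by row, and of one triple (u^(4,k), u^(2,k), h^(k)). *)
Definition gmx : measurableType _ := (m.-tuple (n.-tuple RB))%type.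
Definition layer : measurableType _ := (RB * (m.-tuple RB * n.-tuple RB))%type.

Definition gmx_law : probability gmx R := iid (iid std_normal n) m.
Definition layer_law : probability layer R :=
  (std_normal \x (iid std_normal m \x iid std_normal n))%E.

(* A realization of G and of all the layers; only the layers 1, ..., r+1 are
   ever read. *)
Definition env := (gmx * (nat -> layer))%type.

Definition Gmat (w : env) : 'M[R]_(m, n) := \matrix_(i, j) tnth (tnth w.1 i) j.
Definition u4 (w : env) (k : nat) : R := (w.2 k).1.
Definition u2 (w : env) (k : nat) : 'cV[R]_m := cvec (w.2 k).2.1.
Definition hv (w : env) (k : nat) : 'cV[R]_n := cvec (w.2 k).2.2.

(* Expectation over layer k alone, the rest of the realization being fixed. *)
Definition E_U (k : nat) (F : env -> R) (w : env) : R :=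
  \int[layer_law]_a F (w.1, upd w.2 k a).

(* Joint expectation over G and layer r+1.  It is only applied to functions
   that do not depend on the other layers, which are set to the origin. *)
Definition layer0 : layer := (0, ([tuple 0 | _ < m], [tuple 0 | _ < n])).
Definition E_GU (F : env -> R) : R :=
  \int[(gmx_law \x layer_law)%E]_z F (z.1, upd (fun=> layer0) r.+1 z.2).

Definition ak (k : nat) : R :=
  Num.sqrt (pv k.-1 * qv k.-1 - pv k * qv k).
Definition bk (k : nat) : R := Num.sqrt (pv k.-1 - pv k).
Definition ck (k : nat) : R := Num.sqrt (qv k.-1 - qv k).

Definition D0 (i1 i2 i3 : 'I_l) (w : env) : R :=
  let x := xs D i1 in
  let y := ys D i2 in
  Num.sqrt t * dot y (Gmat w *m x)
  + Num.sqrt (1 - t) * norm2 x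
      * dot y (\sum_(1 <= k < r.+2) bk k *: u2 w k)
  + Num.sqrt t * norm2 x * norm2 y * (\sum_(1 <= k < r.+2) ak k * u4 w k)
  + Num.sqrt (1 - t) * norm2 y
      * dot (\sum_(1 <= k < r.+2) ck k *: hv w k) x
  + fn D (xbars D i3) x.

Definition Aw (i1 i2 i3 : 'I_l) (w : env) : R :=
  expR (beta D * D0 i1 i2 i3 w).
Definition Cw (i1 i3 : 'I_l) (w : env) : R := \sum_i2 Aw i1 i2 i3 w.
Definition Zw (i3 : 'I_l) (w : env) : R := \sum_i1 Cw i1 i3 w `^ expo_s D.

Definition EZ (i3 : 'I_l) : env -> R :=
  E_U 1 (fun w => Zw i3 w `^ mv 1%N).

(* The value at index 0 is a dummy. *)
Fixpoint zeta (k : nat) (w : env) : R :=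
  match k with
  | 0%N => 0
  | 1%N => \sum_i3 EZ i3 w `^ expo_p D
  | k'.+1 => E_U k (fun w' => zeta k' w' `^ (mv k / mv k')) w
  end.

Definition psi : R :=
  E_GU (fun w => ln (zeta r w)
                 / (expo_p D * `|expo_s D| * Num.sqrt n%:R * mv r)).

Definition Phi1 (i3 : 'I_l) (F : env -> R) (w : env) : R :=
  E_U 1 (fun w' => Zw i3 w' `^ mv 1%N / EZ i3 w * F w') w.

Definition Phi (k : nat) (F : env -> R) (w : env) : R :=
  E_U k (fun w' => zeta k.-1 w' `^ (mv k / mv k.-1) / zeta k w * F w') w.

(* Phi b \o ... \o Phi a, with Phi b outermost; the identity if b < a. *)
Definition Phis (b a : nat) (F : env -> R) : env -> R :=
  foldl (fun H k => Phi k H) F (index_iota a b.+1).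

Definition gamma00 (i3 : 'I_l) (w : env) : R :=
  EZ i3 w `^ expo_p D / \sum_j EZ j w `^ expo_p D.

Definition gamma0 (i1 i2 i3 : 'I_l) (w : env) : R :=
  Cw i1 i3 w `^ expo_s D / Zw i3 w * (Aw i1 i2 i3 w / Cw i1 i3 w).

Definition g1 (i1 i2 i3 : 'I_l) (w : env) : R :=
  gamma00 i3 w * Phi1 i3 (gamma0 i1 i2 i3) w.

Definition gamma21 (i1 i2 i3 p1 p2 p3 : 'I_l) : env -> R :=
  Phis r 2 (fun w => g1 i1 i2 i3 w * g1 p1 p2 p3 w).

Definition gamma22 (i1 i2 i3 p1 p2 : 'I_l) : env -> R :=
  Phis r 2 (fun w => gamma00 i3 w
    * (Phi1 i3 (gamma0 i1 i2 i3) w * Phi1 i3 (gamma0 p1 p2 i3) w)).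

(* The weight gamma_(k1+1), for k1 >= 2. *)
Definition gammaS (k1 : nat) (i1 i2 i3 p1 p2 p3 : 'I_l) : env -> R :=
  Phis r k1.+1 (fun w =>
    Phis k1 2 (g1 i1 i2 i3) w * Phis k1 2 (g1 p1 p2 p3) w).

Definition avg6 (gam : 'I_l -> 'I_l -> 'I_l -> 'I_l -> 'I_l -> 'I_l -> env -> R)
    (h : 'I_l -> 'I_l -> 'I_l -> 'I_l -> R) (w : env) : R :=
  \sum_i1 \sum_i2 \sum_i3 \sum_p1 \sum_p2 \sum_p3
    h i1 i2 p1 p2 * gam i1 i2 i3 p1 p2 p3 w.

Definition avg5 (gam : 'I_l -> 'I_l -> 'I_l -> 'I_l -> 'I_l -> env -> R)
    (h : 'I_l -> 'I_l -> 'I_l -> 'I_l -> R) (w : env) : R :=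
  \sum_i1 \sum_i2 \sum_i3 \sum_p1 \sum_p2
    h i1 i2 p1 p2 * gam i1 i2 i3 p1 p2 w.

Definition E21 h : R := E_GU (avg6 gamma21 h).
Definition E22 h : R := E_GU (avg5 gamma22 h).
Definition ES (k1 : nat) h : R := E_GU (avg6 (gammaS k1) h).

Definition hN (i1 i2 p1 p2 : 'I_l) : R :=
  norm2 (xs D i1) * norm2 (xs D p1) * norm2 (ys D i2) * norm2 (ys D p2).
Definition hV (i1 i2 p1 p2 : 'I_l) : R :=
  norm2 (xs D i1) * norm2 (xs D p1) * dot (ys D p2) (ys D i2).
Definition hW (i1 i2 p1 p2 : 'I_l) : R :=
  norm2 (ys D i2) * norm2 (ys D p2) * dot (xs D i1) (xs D p1).

End psi.

(* Main.v *)
Require Import Defs.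
From mathcomp Require Import ring lra.
Set Implicit Arguments.
Unset Strict Implicit.
Unset Printing Implicit Defensive.
Local Open Scope classical_set_scope.
Local Open Scope ring_scope.

(** Why the formulas hold.

    Everything that is averaged depends on the Gaussian data only through the
    field x(i1,i2) = D0(i1,i2,i3) - f(x^(i1)), a point of the finite
    dimensional space V = R^I with I the set of pairs (i1,i2).  Integrating one
    layer out of a function F of the field is a composition of one-dimensional
    Gaussian convolutions F |-> E F(x + sigma z v), one for each scalar entry
    of the layer: the directions v do not depend on the vectors p and q, and
    sigma is one of a_k, b_k, c_k.  Fubini's theorem turns all the nested
    expectations into such functionals on V (zetaE, PhisE, E_GU_gconvs).

    Moving p_k1 by delta moves variance between two layers and does nothing
    else: in each direction e the variance lost by layer k1 is the variance
    d_e delta gained by layer k1+1, where d_e is q_k1, 1 or 0 (for q_k1 in place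
    of p_k1 it is p_k1, 0 or 1).  Gaussian
    convolutions along one direction form a semigroup in the variance, so this
    replaces h(E g(x + sqrt(d_e delta) z v)) by E h(g(x + sqrt(d_e delta) z v)),
    where h is the function that separates the two layers.  The quotient of
    this Jensen gap by delta tends to d_e h''(g) (D_v g)^2 / 2 (jensen_gap).
    Only first derivatives of nested averages are therefore needed, and neither
    Gaussian integration by parts nor second derivatives of psi enter.
    Here h is y |-> y^rho with rho = m_(k1+1) / m_k1, or the logarithm when
    k1 = r; the latter behaves as rho = 0, which is m_(r+1) / m_r.  Both have
    derivative k y^(rho-1), and they are treated together (powlike).  When
    k1 = 1 the two layers are separated by h(sum_j g_j^p), and the power p
    produces a second gap, hence the average over gamma_22 (multi_gap).

    The logarithmic derivative of zeta_k along v is m_k p s beta times the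
    average of v under the weights at level k (dder_zetaV).  Its square, summed
    over the directions with weights d_e, is the double average of the kernel
    (1-t) V + t q_k1 N (Cov_p), or (1-t) W + t p_k1 N (Cov_q).  The layers
    above k1+1 transport the difference quotient by the chain rule, and each
    contributes an operator Phi_k (zeta_quot, ln_zeta_quot).

    The passages to the limit under Gaussian integrals are all instances of
    one notion, continuous convergence F_n(x_n) --> f(x) of families with a
    common bound exp(K (1 + |x|)) (ccvg).  It is stable under the operations
    at hand, and sequences are enough to compute the derivative
    (within_seqP). *)

(** * Integration against the standard normal law *)

Section gauss.
Context {R : realType}.
Local Notation mu := lebesgue_measure.
Local Notation RB := (measurableTypeR R).
Local Notation N := (@std_normal R).
Local Notation phi := (@normal_pdf R 0 1).

Import HBNNSimple.

(** The normal law is given by its values on sets; simple functions are the first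
    step from there to its density. *)
Lemma integral_std_normal_nnsfun (f : {nnsfun RB >-> R}) :
  (\int[N]_x (f x)%:E = \int[mu]_x ((f x)%:E * (phi x)%:E))%E.
Proof.
have mphi : measurable_fun setT (fun x : RB => (phi x)%:E).
  by apply/measurable_EFinP; have := @measurable_normal_pdf R 0 1.
under [LHS]eq_integral do rewrite fimfunE -fsumEFin//.
rewrite [LHS]ge0_integral_fsum//; last 2 first.
  - by move=> r; apply/measurable_EFinP; exact: measurableT_comp.
  - by move=> n x _; rewrite EFinM nnfun_muleindic_ge0.
have fE x : ((f x)%:E * (phi x)%:E = \sum_(r \in range f)
    ((r * \1_(f @^-1` [set r]) x)%:E * (phi x)%:E))%E.
  rewrite {1}fimfunE -fsumEFin// ge0_mule_fsuml// => r.
  by rewrite EFinM nnfun_muleindic_ge0.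
rewrite [RHS](eq_integral _ _ (fun x _ => fE x)).
rewrite [RHS]ge0_integral_fsum//; last 2 first.
  - move=> r; apply: emeasurable_funM => //.
    by apply/measurable_EFinP; do 2 apply/measurableT_comp => //.
  - move=> n x _; apply: mule_ge0; last by rewrite lee_fin normal_pdf_ge0.
    by rewrite EFinM nnfun_muleindic_ge0.
apply: eq_fsbigr => r _.
have mE : measurable (f @^-1` [set r]) by [].
rewrite integralZl_indic_nnsfun//= integral_indic// setIT.
have [r0|r0] := ltP r 0.
  have -> : f @^-1` [set r] = set0.
    apply/seteqP; split => // x /= fx.
    by have : 0 <= f x by []; rewrite fx leNgt r0.
  rewrite measure0 mule0 integral0_eq// => x _.
  by rewrite indic0 mulr0 mul0e.
under eq_integral do rewrite EFinM -muleA.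
rewrite ge0_integralZl//; last first.
- by move=> x _; rewrite mule_ge0// lee_fin ?normal_pdf_ge0.
- by apply: emeasurable_funM => //; exact/measurable_EFinP.
congr *%E; rewrite /std_normal /= /normal_prob integral_mkcond.
apply: eq_integral => x _; rewrite patchE indicE.
by case: ifPn => xE; rewrite ?mul1e ?mul0e.
Qed.

Lemma ge0_integral_std_normal (f : RB -> \bar R) :
  measurable_fun setT f -> (forall x, 0 <= f x)%E ->
  (\int[N]_x f x = \int[mu]_x (f x * (phi x)%:E))%E.
Proof.
move=> mf f0.
have mphi : measurable_fun setT (fun x : RB => (phi x)%:E).
  by apply/measurable_EFinP; have := @measurable_normal_pdf R 0 1.
pose f_ := nnsfun_approx measurableT mf.
transitivity (lim (\int[N]_x (f_ n x)%:E @[n --> \oo])%E).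
  rewrite -monotone_convergence//=.
  - apply: eq_integral => ? /[!inE] xD; apply/esym/cvg_lim => //=.
    exact: cvg_nnsfun_approx.
  - by move=> n; exact/measurable_EFinP/measurable_funTS.
  - by move=> n ? _; rewrite lee_fin.
  - by move=> ? _ ? ? mn; rewrite lee_fin; exact/lefP/nd_nnsfun_approx.
transitivity (lim (\int[mu]_x ((f_ n x)%:E * (phi x)%:E) @[n --> \oo])%E).
  by apply: congr_lim; apply/funext => n /=; exact: integral_std_normal_nnsfun.
rewrite -monotone_convergence//=.
- apply: eq_integral => x /[!inE] xD; apply/cvg_lim => //=.
  by apply: cvgeZr => //; exact: cvg_nnsfun_approx.
- by move=> n; apply: emeasurable_funM => //; exact/measurable_EFinP.
- by move=> n x _; rewrite mule_ge0// lee_fin ?normal_pdf_ge0.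
- move=> x _ a b ab; rewrite lee_pmul// ?lee_fin ?normal_pdf_ge0//.
  exact/lefP/nd_nnsfun_approx.
Qed.

(** Completing the square turns the density into that of a shifted normal law. *)
Lemma std_normal_expR (k : R) :
  (\int[N]_x (expR (k * x))%:E = (expR (k ^+ 2 / 2))%:E)%E.
Proof.
rewrite ge0_integral_std_normal//; last first.
  by apply/measurable_EFinP; apply: measurableT_comp => //; exact: measurable_funM.
transitivity (\int[mu]_x ((expR (k ^+ 2 / 2))%:E * (normal_pdf k 1 x)%:E))%E.
  apply: eq_integral => x _; rewrite -!EFinM; congr EFin.
  rewrite !normal_pdfE ?oner_eq0// /normal_fun mulrCA [RHS]mulrCA; congr (_ * _).
  rewrite -!expRD; congr expR; by field.
rewrite integralZl//; last exact: integrable_normal_pdf.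
by rewrite integral_normal_pdf mule1.
Qed.

Lemma integrable_expR_abs (K : R) :
  N.-integrable setT (EFin \o (fun z : R => expR (K * (1 + `|z|)))).
Proof.
have h : measurable_fun setT (fun z : R => expR (K * (1 + `|z|))).
  apply: measurableT_comp; first exact: measurable_expR.
  apply: measurable_funM => //; apply: measurable_funD => //.
have me k : measurable_fun setT (EFin \o (fun z : RB => expR (k * z))).
  by apply/measurable_EFinP; apply: measurableT_comp => //; exact: measurable_funM.
have ie k : N.-integrable setT (EFin \o (fun z => expR (k * z))).
  apply/integrableP; split => //.
  under eq_integral do rewrite /= ger0_norm ?expR_ge0//.
  by rewrite std_normal_expR ltry.
have iS : N.-integrable setT
    (EFin \o (fun z => expR `|K| * (expR (`|K| * z) + expR (- `|K| * z)))).
  rewrite [X in _.-integrable _ X](_ : _ = (fun z => (expR `|K|)%:E *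
    ((EFin \o (fun z => expR (`|K| * z))) z + (EFin \o (fun z => expR (- `|K| * z))) z))%E)//.
  by apply: integrableZl => //; apply: integrableD.
apply: le_integrable iS => //.
  exact/measurable_EFinP.
move=> z _ /=; rewrite lee_fin [leLHS]ger0_norm ?expR_ge0//.
rewrite [leRHS]ger0_norm; last by rewrite mulr_ge0 ?addr_ge0 ?expR_ge0.
apply: (@le_trans _ _ (expR (`|K| + `|K| * `|z|))).
  rewrite ler_expR mulrDr mulr1; apply: lerD; first exact: ler_norm.
  by apply: ler_wpM2r => //; exact: ler_norm.
rewrite expRD ler_wpM2l ?expR_ge0//; have [z0|z0] := lerP 0 (z : R).
- by rewrite (ger0_norm z0) lerDl expR_ge0.
- by rewrite (ltr0_norm z0) mulrN mulNr lerDr expR_ge0.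
Qed.

(** At most exponential growth: unlike integrability, this is stable under
    products, affine changes of variable and Gaussian averages. *)
Definition expb (f : R -> R) :=
  measurable_fun setT f /\ exists K, forall z, `|f z| <= expR (K * (1 + `|z|)).

Lemma expb_integrable (f : R -> R) : expb f -> N.-integrable setT (EFin \o f).
Proof.
move=> [mf [K fK]].
apply: le_integrable (integrable_expR_abs K) => //.
  exact/measurable_EFinP.
move=> z _ /=; rewrite lee_fin [leRHS]ger0_norm ?expR_ge0//; exact: fK.
Qed.

Definition gint (f : R -> R) : R := \int[N]_z f z.

Lemma gint_EFin (f : R -> R) : expb f -> (gint f)%:E = (\int[N]_z (f z)%:E)%E.
Proof.
by move=> /expb_integrable fi; rewrite /gint /Rintegral fineK//; exact: integrable_fin_num.
Qed.

Lemma gintD f g : expb f -> expb g -> gint (fun z => f z + g z) = gint f + gint g.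
Proof. by move=> /expb_integrable fi /expb_integrable gi; exact: RintegralD. Qed.

Lemma gintB f g : expb f -> expb g -> gint (fun z => f z - g z) = gint f - gint g.
Proof. by move=> /expb_integrable fi /expb_integrable gi; exact: RintegralB. Qed.

Lemma gintZ c f : expb f -> gint (fun z => c * f z) = c * gint f.
Proof. by move=> /expb_integrable fi; exact: RintegralZl. Qed.

Lemma gint_cst c : gint (fun=> c) = c.
Proof.
by rewrite /gint Rintegral_cst// [X in fine X]probability_setT mulr1.
Qed.

Lemma gint_le f g : expb f -> expb g -> (forall z, f z <= g z) -> gint f <= gint g.
Proof.
by move=> /expb_integrable fi /expb_integrable gi fg; apply: le_Rintegral.
Qed.

Lemma gint_norm f : expb f -> `|gint f| <= gint (fun z => `|f z|).
Proof. by move=> /expb_integrable fi; exact: le_normr_Rintegral. Qed.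

Lemma gint_expR k : gint (fun z => expR (k * z)) = expR (k ^+ 2 / 2).
Proof. by rewrite /gint /Rintegral std_normal_expR. Qed.

(** The dominated convergence theorem behind every limit below. *)
Lemma gint_cvg (Q : nat -> R -> R) q K :
  (forall n, measurable_fun setT (Q n)) ->
  (forall n z, `|Q n z| <= expR (K * (1 + `|z|))) ->
  (forall z, Q n z @[n --> \oo] --> q z) ->
  gint (Q n) @[n --> \oo] --> gint q.
Proof.
move=> mQ QK Qq.
have mq : measurable_fun setT (q : RB -> R).
  by apply: (measurable_fun_cvg (h := Q)) => // z _; exact: Qq.
have eq : expb q.
  split => //; exists K => z.
  by apply: (cvgr_to_le (cvg_norm (Qq z))); exact: nearW.
rewrite /gint; apply: fine_cvg; rewrite -/(gint q) gint_EFin//.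
apply: (@dominated_cvg _ _ _ N setT measurableT
  (fun n z => (Q n z)%:E) (fun z => (q z)%:E)
  (fun z => (expR (K * (1 + `|z|)))%:E)) => //.
- by move=> n; apply/measurable_EFinP; exact: mQ.
- by move=> z _; apply: cvg_EFin; [exact: nearW|exact: Qq].
- exact: integrable_expR_abs.
- by move=> n z _; rewrite lee_fin QK.
Qed.

End gauss.

(** * Stability of the normal law *)

Section gauss2.
Context {R : realType}.
Local Notation mu := lebesgue_measure.
Local Notation RB := (measurableTypeR R).
Local Notation N := (@std_normal R).
Local Notation phi := (@normal_pdf R 0 1).

Lemma normal_pdf_scale (a d z : R) : 0 < a ->
  normal_pdf d a z = a^-1 * phi ((z - d) / a).
Proof.
move=> a0; have an0 : a != 0 by rewrite gt_eqF.
rewrite !normal_pdfE ?oner_eq0// mulrA; congr (_ * _).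
  rewrite /normal_peak expr1n mul1r -mulrnAr sqrtrM ?sqr_ge0// sqrtr_sqr.
  by rewrite gtr0_norm// invfM.
rewrite /normal_fun; congr expR; rewrite subr0 expr1n exprMn; field.
by rewrite an0.
Qed.

Lemma std_normal_affine (f : R -> R) (a d : R) : 0 < a ->
  continuous f -> (forall x, 0 <= f x) ->
  (\int[N]_x (f (a * x + d))%:E =
   \int[mu]_z (f z * normal_pdf d a z)%:E)%E.
Proof.
move=> a0 cf f0.
have an0 : a != 0 by rewrite gt_eqF.
pose F : R -> R := fun x => a * x + d.
have dF (x : R) : is_derive x (1 : R) F a.
  have -> : F = (a *: (id : R -> R)) + cst d by [].
  by apply: is_derive_eq; rewrite addr0 scaler1.
have F'E : F^`()%classic = cst a.
  by apply/funext => x; rewrite derive1E; apply: derive_val.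
have cF : continuous F.
  by move=> x; apply: differentiable_continuous; apply/derivable1_diffP; case: (dF x).
have mf : measurable_fun setT f by exact: continuous_measurable_fun.
have mF : measurable_fun setT F by exact: continuous_measurable_fun.
have mfF : measurable_fun setT (fun x : RB => (f (a * x + d))%:E).
  by apply/measurable_EFinP; exact: (measurableT_comp mf mF).
have fF0 (x : RB) : (0 <= (f (a * x + d))%:E)%E by rewrite lee_fin.
rewrite (ge0_integral_std_normal mfF fF0).
rewrite (@increasing_ge0_integration_by_substitutionT _ F
  (fun z => f z * normal_pdf d a z)) //.
- apply: eq_integral => x _; rewrite -EFinM; congr EFin; rewrite F'E.
  transitivity (f (F x) * normal_pdf d a (F x) * a); last by [].
  rewrite -mulrA (normal_pdf_scale _ _ a0) /F addrK mulrAC mulVf// mul1r.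
  by rewrite [a * x]mulrC mulfK.
- by move=> x y xy; rewrite /F ltrD2r ltr_pM2l.
- by rewrite F'E => x; exact: cvg_cst.
- by rewrite F'E; exact: is_cvg_cst.
- by rewrite F'E; exact: is_cvg_cst.
- apply: (cvg_comp (fun x => a * x) (fun y => y + d) _ (cvg_addrr_Ny d)).
  by apply: gt0_cvgMrNy => //; exact: cvg_id.
- apply: (cvg_comp (fun x => a * x) (fun y => y + d) _ (cvg_addrr d)).
  by apply: gt0_cvgMry => //; exact: cvg_id.
- move=> x; apply: cvgM; first exact: cf.
  exact: continuous_normal_pdf.
- by move=> x; rewrite mulr_ge0 // normal_pdf_ge0.
Qed.

(** Bayes' rule for a Gaussian pair: the density of y times that of a x + b y
    given y, refactored as the density of the sum times that of y given the
    sum. *)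
Lemma normal_pdf_convolve (a b c y z : R) : 0 < a -> 0 < c ->
  c ^+ 2 = a ^+ 2 + b ^+ 2 ->
  normal_pdf (b * y) a z * phi y =
  normal_pdf 0 c z * normal_pdf (b * z / c ^+ 2) (a / c) y.
Proof.
move=> a0 c0 cab; have an0 : a != 0 by rewrite gt_eqF.
have cn0 : c != 0 by rewrite gt_eqF.
have ac0 : 0 < a / c by rewrite divr_gt0.
rewrite (normal_pdf_scale _ _ a0) (normal_pdf_scale _ _ c0) (normal_pdf_scale _ _ ac0).
rewrite !normal_pdfE ?oner_eq0// /normal_fun.
have h (k l u v u' v' : R) : k = l -> u + v = u' + v' ->
  k * (normal_peak 1 * expR u * (normal_peak 1 * expR v)) =
  l * (normal_peak 1 * expR u' * (normal_peak 1 * expR v')).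
  move=> -> e; have : expR u * expR v = expR u' * expR v' by rewrite -!expRD e.
  by move=> e'; rewrite mulrACA e' [in RHS]mulrACA.
rewrite -[a^-1 * _ * _]mulrA [RHS]mulrACA; apply: h.
  by field; rewrite an0 cn0.
have e : b ^+ 2 = c ^+ 2 - a ^+ 2 by rewrite cab addrC addKr.
transitivity (- (z ^+ 2 - 2 * b * z * y + b ^+ 2 * y ^+ 2) / (2 * a ^+ 2) - y ^+ 2 / 2).
  by field; rewrite an0.
transitivity (- z ^+ 2 / (2 * c ^+ 2) - (y ^+ 2 - 2 * b * z * y / c ^+ 2
    + b ^+ 2 * z ^+ 2 / c ^+ 4) * c ^+ 2 / (2 * a ^+ 2)); rewrite ?e.
  by field; rewrite an0 cn0.
by rewrite -e; field; rewrite an0 cn0.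
Qed.

(** After exchanging the integrals, the conditional density of y integrates to 1
    and the law of the sum remains. *)
Lemma ge0_std_normal_stable (f : R -> R) (a b c : R) :
  0 < a -> 0 < c -> c ^+ 2 = a ^+ 2 + b ^+ 2 ->
  continuous f -> (forall x, 0 <= f x) ->
  (\int[N]_y \int[N]_x (f (a * x + b * y))%:E =
   \int[N]_z (f (c * z))%:E)%E.
Proof.
move=> a0 c0 cab cf f0.
have mf : measurable_fun setT (f : RB -> R) by exact: continuous_measurable_fun.
transitivity (\int[N]_y \int[mu]_z (f z * normal_pdf (b * y) a z)%:E)%E.
  by apply: eq_integral => y _; rewrite std_normal_affine.
have mpdf : measurable_fun setT (fun yz : RB * RB => normal_pdf (b * yz.1) a yz.2).
  have -> : (fun yz : RB * RB => normal_pdf (b * yz.1) a yz.2) =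
      (phi \o (fun yz : RB * RB => (yz.2 - b * yz.1) / a)) \* cst (a^-1).
    by apply/funext => yz; rewrite normal_pdf_scale//= mulrC.
  apply: measurable_funM => //; apply: measurableT_comp.
    exact: measurable_normal_pdf.
  by do ![apply: measurable_funM => //|apply: measurable_funB => //].
have mG : measurable_fun setT
    (fun yz : RB * RB => (f yz.2 * normal_pdf (b * yz.1) a yz.2)%:E).
  apply/measurable_EFinP; apply: measurable_funM => //.
  exact: (measurableT_comp mf).
have G0 (yz : RB * RB) : (0 <= (f yz.2 * normal_pdf (b * yz.1) a yz.2)%:E)%E.
  by rewrite lee_fin mulr_ge0// normal_pdf_ge0.
rewrite ge0_integral_std_normal; last 2 first.
  exact: (@measurable_fun_fubini_tonelli_F _ _ _ _ _ mu _ mG G0).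
  by move=> y; apply: integral_ge0 => z _; exact: (G0 (y, z)).
transitivity (\int[mu]_y \int[mu]_z (f z * (normal_pdf 0 c z * normal_pdf (b * z / c ^+ 2) (a / c) y))%:E)%E.
  apply: eq_integral => y _.
  rewrite -ge0_integralZr//; last 3 first.
  - apply/measurable_EFinP; apply: measurable_funM => //.
    exact: measurable_normal_pdf.
  - by move=> z _; exact: (G0 (y, z)).
  - by rewrite lee_fin normal_pdf_ge0.
  apply: eq_integral => z _; rewrite -EFinM -(mulrA (f z)).
  by rewrite (normal_pdf_convolve _ _ a0 c0 cab).
rewrite (fubini_tonelli (fun yz : RB * RB => (f yz.2 * (normal_pdf 0 c yz.2 * normal_pdf (b * yz.2 / c ^+ 2) (a / c) yz.1))%:E)) /=; last 2 first.
  apply/measurable_EFinP; apply: measurable_funM; first exact: (measurableT_comp mf).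
  apply: measurable_funM; first exact: (measurableT_comp (measurable_normal_pdf 0 c)).
  have -> : (fun yz : RB * RB => normal_pdf (b * yz.2 / c ^+ 2) (a / c) yz.1) =
      (phi \o (fun yz : RB * RB => (yz.1 - b * yz.2 / c ^+ 2) / (a / c)))
      \* cst ((a / c)^-1).
    by apply/funext => yz; rewrite normal_pdf_scale ?divr_gt0//= mulrC.
  apply: measurable_funM => //; apply: measurableT_comp.
    exact: measurable_normal_pdf.
  by do ![apply: measurable_funM => //|apply: measurable_funB => //].
  by move=> z; rewrite lee_fin !mulr_ge0// normal_pdf_ge0.
transitivity (\int[mu]_z (f z * normal_pdf 0 c z)%:E)%E.
  apply: eq_integral => z _.
  under eq_integral do rewrite mulrA EFinM.
  rewrite ge0_integralZl//; last 3 first.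
  - apply/measurable_EFinP; exact: measurable_normal_pdf.
  - by move=> y _; rewrite lee_fin normal_pdf_ge0.
  - by rewrite lee_fin mulr_ge0// normal_pdf_ge0.
  by rewrite integral_normal_pdf mule1.
rewrite -std_normal_affine//.
by apply: eq_integral => z _; rewrite addr0.
Qed.

End gauss2.

Section gauss3.
Context {R : realType}.
Local Notation RB := (measurableTypeR R).
Local Notation N := (@std_normal R).

Lemma measurable_gint d (T : measurableType d) (Q : T -> R -> R) :
  measurable_fun setT (fun p : T * RB => Q p.1 p.2) ->
  measurable_fun setT (fun y => gint (Q y)).
Proof.
move=> mQ; have mQE : measurable_fun setT (fun p : T * RB => (Q p.1 p.2)%:E).
  exact/measurable_EFinP.
apply: (measurableT_comp (f := @fine R)) => //.
rewrite [X in measurable_fun _ X](_ : _ = (fun y =>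
  (\int[N]_z ((fun p : T * RB => (Q p.1 p.2)%:E)^\+ (y, z)))
  - (\int[N]_z ((fun p : T * RB => (Q p.1 p.2)%:E)^\- (y, z))))%E); last first.
  by apply/funext => y; rewrite [LHS]integralE; congr (_ - _)%E;
    apply: eq_integral => z _; rewrite ?(funeposE, funenegE).
apply: emeasurable_funB.
- exact: (@measurable_fun_fubini_tonelli_F _ _ T RB R N _
    (measurable_funepos mQE) (fun=> funepos_ge0 _ _)).
- exact: (@measurable_fun_fubini_tonelli_F _ _ T RB R N _
    (measurable_funeneg mQE) (fun=> funeneg_ge0 _ _)).
Qed.

Definition exp_abs_moment (K : R) : R := gint (fun z => expR (K * (1 + `|z|))).

Lemma expb_expR K : expb (fun z : R => expR (K * (1 + `|z|))).
Proof.
split.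
  apply: measurableT_comp => //; apply: measurable_funM => //.
  exact: measurable_funD.
by exists K => z; rewrite ger0_norm ?expR_ge0.
Qed.

Lemma exp_abs_moment_ge0 K : 0 <= exp_abs_moment K.
Proof. by apply: Rintegral_ge0 => z _; exact: expR_ge0. Qed.

Lemma expb_le (f g : R -> R) : measurable_fun setT f -> expb g ->
  (forall z, `|f z| <= g z) -> expb f.
Proof.
move=> mf [_ [K gK]] fg; split => //; exists K => z.
by rewrite (le_trans (fg z))// (le_trans (ler_norm _)).
Qed.

Lemma le_expR_id (x : R) : x <= expR x.
Proof. by apply: le_trans (expR_ge1Dx x); rewrite lerDr. Qed.

Lemma expb_bound (f : R -> R) (A K : R) : measurable_fun setT f ->
  (forall z, `|f z| <= A * expR (K * (1 + `|z|))) -> expb f.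
Proof.
move=> mf fK; split => //; exists (`|A| + `|K|) => z.
apply: (le_trans (fK z)).
have A_le : A <= expR (`|A| * (1 + `|z|)).
  apply: (le_trans (ler_norm A)); apply: (le_trans (le_expR_id _)).
  by rewrite ler_expR ler_peMr// lerDl.
apply: (@le_trans _ _ (expR (`|A| * (1 + `|z|)) * expR (K * (1 + `|z|)))).
  by rewrite ler_pM2r// expR_gt0.
rewrite -expRD ler_expR [leRHS]mulrDl lerD2l ler_pM2r ?ler_norm//.
Qed.

Lemma gint_bound (f : R -> R) (A K : R) : measurable_fun setT f ->
  (forall z, `|f z| <= A * expR (K * (1 + `|z|))) -> `|gint f| <= A * exp_abs_moment K.
Proof.
move=> mf fK; have ef := expb_bound mf fK.
apply: (le_trans (gint_norm ef)); rewrite -gintZ; last exact: expb_expR.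
apply: gint_le => //.
  by apply: (expb_bound (A := A) (K := K)) => [|z]; [exact: measurableT_comp|rewrite normr_id].
apply: (expb_bound (A := `|A|) (K := K)) => [|z].
  by apply: measurable_funM => //; case: (expb_expR K).
by rewrite normrM (ger0_norm (expR_ge0 _)).
Qed.


Lemma expb_affine (f : R -> R) (a b : R) : expb f -> expb (fun x => f (a * x + b)).
Proof.
move=> [mf [K fK]].
have mg : measurable_fun setT (fun x : R => f (a * x + b)).
  by apply: (measurableT_comp mf); apply: measurable_funD => //; exact: measurable_funM.
apply: (expb_bound (A := expR (`|K| * `|b|)) (K := `|K| * (1 + `|a|))) => // z.
apply: (le_trans (fK _)); rewrite -expRD ler_expR.
apply: (@le_trans _ _ (`|K| * (1 + `|a * z + b|))).
  by rewrite ler_wpM2r ?ler_norm// addr_ge0.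
rewrite -mulrA -mulrDr ler_wpM2l//.
have := ler_normD (a * z) b; rewrite normrM => h.
have := normr_ge0 a; have := normr_ge0 z; nra.
Qed.

Lemma expbB f g : expb f -> expb g -> expb (fun z : R => f z - g z).
Proof.
move=> [mf [K fK]] [mg [L gL]].
apply: (expb_bound (A := 2) (K := `|K| + `|L|)) => [|z]; first exact: measurable_funB.
apply: (le_trans (ler_normB _ _)); rewrite mulr_natl mulr2n.
have h (k l : R) : k <= `|k| + `|l|.
  by rewrite (le_trans (ler_norm k))// lerDl.
apply: lerD.
- by rewrite (le_trans (fK z))// ler_expR ler_wpM2r ?addr_ge0.
- by rewrite (le_trans (gL z))// ler_expR ler_wpM2r ?addr_ge0// addrC.
Qed.

Lemma expb_gint (f : R -> R) (a b : R) : expb f ->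
  expb (fun y => gint (fun x => f (a * x + b * y))).
Proof.
move=> [mf [K fK]].
have mfab : measurable_fun setT (fun p : RB * RB => f (a * p.2 + b * p.1)).
  apply: (measurableT_comp mf).
  by apply: measurable_funD; exact: measurable_funM.
apply: (expb_bound (A := exp_abs_moment (`|K| * `|a|)) (K := `|K| * (1 + `|b|))).
  exact: (@measurable_gint _ RB (fun y x => f (a * x + b * y)) mfab).
move=> y; rewrite [leRHS]mulrC; apply: gint_bound => [|x].
  apply: (measurableT_comp mf).
  by apply: measurable_funD => //; exact: measurable_funM.
apply: (le_trans (fK _)); rewrite -expRD ler_expR.
apply: (@le_trans _ _ (`|K| * (1 + `|a * x + b * y|))).
  by rewrite ler_wpM2r ?ler_norm// addr_ge0.
rewrite -!mulrA -mulrDr ler_wpM2l//.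
have := ler_normD (a * x) (b * y); rewrite !normrM => h.
have := normr_ge0 a; have := normr_ge0 b; have := normr_ge0 x; have := normr_ge0 y; nra.
Qed.

Lemma gint_stable_pos (f : R -> R) (a b c : R) :
  0 < a -> 0 < c -> c ^+ 2 = a ^+ 2 + b ^+ 2 ->
  continuous f -> expb f -> (forall x, 0 <= f x) ->
  gint (fun y => gint (fun x => f (a * x + b * y))) = gint (fun z => f (c * z)).
Proof.
move=> a0 c0 cab cf ef f0; apply: EFin_inj.
rewrite gint_EFin; last exact: expb_gint.
rewrite gint_EFin; last first.
  by under eq_fun do rewrite -[c * _]addr0; exact: expb_affine.
rewrite -(ge0_std_normal_stable a0 c0 cab cf f0).
by apply: eq_integral => y _; rewrite gint_EFin//; exact: expb_affine.
Qed.

(** This is the semigroup property of Gaussian convolutions.  It lets a layer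
    of variance c^2 be split into two, which is how a part of the variance is
    handed over to the next layer. *)
Lemma gint_stable (f : R -> R) (a b c : R) :
  0 <= a -> 0 <= b -> 0 <= c -> c ^+ 2 = a ^+ 2 + b ^+ 2 ->
  continuous f -> expb f ->
  gint (fun y => gint (fun x => f (a * x + b * y))) = gint (fun z => f (c * z)).
Proof.
rewrite le_eqVlt => /predU1P[<- b0 c0|a0 b0 c0] cab cf ef.
  have -> : c = b.
    by apply/eqP; rewrite -(eqrXn2 (n := 2))// cab expr0n add0r.
  congr gint; apply/funext => y.
  by rewrite -[RHS]gint_cst; congr gint; apply/funext => x; rewrite mul0r add0r.
have {c0} : 0 < c.
  rewrite lt_neqAle c0 andbT; apply/negP => /eqP c00; move: cab; rewrite -c00 expr0n /=.
  move=> /esym/eqP; rewrite paddr_eq0 ?sqr_ge0// expf_eq0 /= => /andP[/eqP a00].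
  by move: a0; rewrite a00 ltxx.
move=> c0; case: (ef) => mf [K fK].
pose fp x := Num.max (f x) 0; pose fm x := Num.max (- f x) 0.
have fE x : f x = fp x - fm x.
  rewrite /fp /fm; have [h|h] := leP 0 (f x).
  - by rewrite max_r ?oppr_le0// subr0.
  - by rewrite max_l ?oppr_ge0 ?(ltW h)// opprK add0r.
have cm (g : R -> R) : continuous g -> continuous (fun x => Num.max (g x) 0).
  by move=> cg x; apply: continuous_max; [exact: cg|exact: cst_continuous].
have cfp : continuous fp by exact: cm.
have cfm : continuous fm by apply: cm => x; apply: cvgN; exact: cf.
have mabs : measurable_fun setT (fun x : R => `|f x|) by exact: measurableT_comp.
have eabs : expb (fun x => `|f x|).
  by split => //; exists K => z; rewrite normr_id.
have efp : expb fp.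
  apply: expb_le eabs _; first exact: continuous_measurable_fun.
  by move=> z; rewrite /fp; case: (lerP (f z) 0); rewrite ?normr0.
have efm : expb fm.
  apply: expb_le eabs _; first exact: continuous_measurable_fun.
  by move=> z; rewrite /fm; case: (lerP (- f z) 0); rewrite ?normr0// normrN.
transitivity (gint (fun y => gint (fun x => fp (a * x + b * y)) - gint (fun x => fm (a * x + b * y)))).
  congr gint; apply/funext => y; rewrite -gintB; try exact: expb_affine.
  by congr gint; apply/funext => x; rewrite -fE.
rewrite gintB; try exact: expb_gint.
rewrite (gint_stable_pos a0 c0 cab)//; last by move=> x; rewrite /fp le_max lexx orbT.
rewrite (gint_stable_pos a0 c0 cab)//; last by move=> x; rewrite /fm le_max lexx orbT.
rewrite -gintB; first by congr gint; apply/funext => x; rewrite -fE.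
- by under eq_fun do rewrite -[c * _]addr0; exact: expb_affine.
- by under eq_fun do rewrite -[c * _]addr0; exact: expb_affine.
Qed.

End gauss3.

(** * The first two moments *)

Section seqderiv.
Context {R : realType}.

Lemma is_derive_seq (f : R -> R) (x d : R) (u : nat -> R) :
  is_derive x 1 f d -> (forall n, u n != 0) -> u n @[n --> \oo] --> 0 ->
  (f (x + u n) - f x) / u n @[n --> \oo] --> d.
Proof.
move=> [+ <-] u0 uc; move=> /cvg_ex [l hl].
have -> : 'D_1 f x = l by exact: cvg_lim.
have := @cvgr_dnbhsP R (fun h => h^-1 *: ((f \o shift x) (h *: 1) - f x)) 0 l.
move=> [/(_ hl u (conj u0 uc)) h _]; move: h; apply: cvg_trans.
apply: near_eq_cvg; near=> n.
by rewrite /= /shift /= [u n *: 1]mulr1 [u n + x]addrC mulrC.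
Unshelve. all: by end_near. Qed.

Lemma expRB1_le (x : R) : `|expR x - 1| <= `|x| * expR `|x|.
Proof.
have [x0|x0] := leP 0 x.
- have h : 0 <= expR x - 1 by have := expR_ge1Dx x; lra.
  rewrite !ger0_norm//.
  have := expR_ge1Dx (- x); rewrite expRN => h2.
  have := expR_gt0 x => e0.
  have : expR x * (1 + - x) <= expR x * (expR x)^-1 by rewrite ler_pM2l.
  by rewrite divff ?gt_eqF//; lra.
- have h : expR x - 1 <= 0 by rewrite subr_le0 -expR0 ler_expR ltW.
  rewrite ler0_norm// ltr0_norm//.
  have := expR_ge1Dx x => h1.
  have h2 : 1 <= expR (- x) by rewrite -[leLHS]expR0 ler_expR oppr_ge0 ltW.
  nra.
Qed.

(* The moments come from the moment generating function: the quotients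
   (exp(e z) - 1) / e tend to z, and Gaussian averages of exponentials are
   explicit. *)
Let e (n : nat) : R := n.+1%:R^-1.
Let en0 n : e n != 0. Proof. by rewrite invr_eq0 pnatr_eq0. Qed.
Let ec : e n @[n --> \oo] --> (0 : R).
Proof. exact: cvg_harmonic. Qed.
Let e1 n : `|e n| <= 1.
Proof. by rewrite ger0_norm ?invr_ge0// invf_le1 ?ltr0n// ler1n. Qed.

Let expR_quot (c : R) : (expR (c * (e n) ^+ 2) - 1) / (e n) ^+ 2 @[n --> \oo] --> c.
Proof.
have [->|c0] := eqVneq c 0.
  by under eq_cvg do rewrite mul0r expR0 subrr mul0r; exact: cvg_cst.
have /is_derive_seq H : is_derive (0 : R) 1 expR 1 by rewrite -{2}expR0; exact: is_derive_expR.
have h2 : c * e n ^+ 2 @[n --> \oo] --> 0.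
  rewrite -[X in _ --> X](mulr0 c); apply: cvgM; first exact: cvg_cst.
  rewrite -[X in _ --> X](mulr0 0); rewrite (_ : (fun n => _) = (fun n => e n * e n)); last by apply/funext => n; rewrite expr2.
  exact: cvgM.
have h1 n : c * e n ^+ 2 != 0 by rewrite mulf_neq0// expf_neq0.
have := H _ h1 h2 => h.
rewrite -[X in _ --> X](mulr1 c).
rewrite (_ : (fun n => _) = (fun n => c * ((expR (0 + c * e n ^+ 2) - expR 0) / (c * e n ^+ 2)))).
  by apply: cvgM => //; exact: cvg_cst.
by apply/funext => n; rewrite expR0 add0r; field; rewrite c0 en0.
Qed.

Let mexp c : measurable_fun setT (fun z : R => expR (c * z)).
Proof. by apply: measurableT_comp => //; exact: measurable_funM. Qed.

Let expb_exp c : expb (fun z : R => expR (c * z)).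
Proof.
split; first exact: mexp.
exists `|c| => z; rewrite ger0_norm ?expR_ge0// ler_expR.
rewrite (le_trans (ler_norm _))// normrM ler_wpM2l//; by rewrite lerDr.
Qed.

Let Dn n (z : R) := (expR (e n * z) - 1) / e n.

Let mD n : measurable_fun setT (Dn n).
Proof. by apply: measurable_funM => //; apply: measurable_funB => //; exact: mexp. Qed.

Let Db n z : `|Dn n z| <= expR (2 * (1 + `|z|)).
Proof.
rewrite normrM normfV ler_pdivrMr ?normr_gt0//.
apply: (le_trans (expRB1_le _)); rewrite normrM mulrC mulrA mulrAC.
rewrite [leRHS]mulrC [leLHS]mulrC ler_wpM2l//.
have h : `|e n| * `|z| <= `|z| by rewrite ler_piMl.
have -> : expR (2 * (1 + `|z|)) = expR (1 + `|z|) * expR (1 + `|z|).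
  by rewrite -expRD; congr expR; ring.
rewrite ler_pM ?expR_ge0//.
- by rewrite ler_expR (le_trans h)// lerDr.
- by rewrite (le_trans (le_expR_id _))// ler_expR lerDr.
Qed.

Let Dc z : Dn n z @[n --> \oo] --> z.
Proof.
have h1 : is_derive (0 : R) 1 (fun x : R => expR (x * z)) z.
  have h0 : is_derive (0 : R) 1 (fun x : R => x * z) z.
    have -> : (fun x : R => x * z) = z *: (id : R -> R) by apply/funext => x; rewrite mulrC.
    by apply: is_derive_eq; rewrite scaler1.
  have : is_derive (0 * z : R) 1 expR 1 by rewrite mul0r -{2}expR0; exact: is_derive_expR.
  by move=> h; have := @is_derive1_comp _ expR (fun x => x * z) _ _ _ h h0; rewrite mul1r.
have := is_derive_seq h1 en0 ec.
by under eq_cvg do rewrite add0r mul0r expR0.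
Qed.

Lemma gint_id : gint (fun z : R => z) = 0.
Proof.
have h := gint_cvg mD Db Dc.
have E n : gint (Dn n) = e n * ((expR (2^-1 * e n ^+ 2) - 1) / e n ^+ 2).
  have -> : Dn n = (fun z => (e n)^-1 * (expR (e n * z) - 1)).
    by apply/funext => z; rewrite /Dn mulrC.
  rewrite gintZ; last first.
    apply: expbB; first exact: expb_exp.
    by split => //; exists 0 => z; rewrite mul0r expR0 normr1.
  rewrite gintB ?gint_cst ?gint_expR; last 2 first.
  - exact: expb_exp.
  - by split => //; exists 0 => z; rewrite mul0r expR0 normr1.
  rewrite [2^-1 * _]mulrC; field; exact: en0.
have h2 : gint (Dn n) @[n --> \oo] --> (0 * 2^-1 : R).
  under eq_cvg do rewrite E; apply: cvgM => //; exact: expR_quot.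
by have := cvg_unique _ h h2; rewrite mul0r; apply.
Qed.

Lemma gint_sqr : gint (fun z : R => z ^+ 2) = 1.
Proof.
have mD2 n : measurable_fun setT (fun z => Dn n z ^+ 2) by exact: measurable_funX.
have Db2 n z : `|Dn n z ^+ 2| <= expR (4 * (1 + `|z|)).
  rewrite normrX -[4]/(2 * 2)%:R natrM -mulrA mulr_natl mulr2n expRD -expr2.
  by rewrite lerXn2r ?nnegrE ?expR_ge0//; exact: Db.
have Dc2 z : Dn n z ^+ 2 @[n --> \oo] --> z ^+ 2.
  by rewrite expr2; under eq_cvg do rewrite expr2; exact: cvgM.
have h := gint_cvg mD2 Db2 Dc2.
have E n : gint (fun z => Dn n z ^+ 2) =
   (expR (2 * e n ^+ 2) - 1) / e n ^+ 2 - 2 * ((expR (2^-1 * e n ^+ 2) - 1) / e n ^+ 2).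
  have -> : (fun z => Dn n z ^+ 2) = (fun z => (e n)^-2 *
     ((expR ((2 * e n) * z) - 2 * expR (e n * z)) - - 1)).
    apply/funext => z; rewrite /Dn.
    have -> : expR ((2 * e n) * z) = expR (e n * z) ^+ 2.
      by rewrite expr2 -expRD; congr expR; ring.
    by field; exact: en0.
  have ec1 : expb (fun=> -1 : R).
    by split => //; exists 0 => z; rewrite mul0r expR0 normrN1.
  have e2 : expb (fun z => 2 * expR (e n * z)).
    apply: (expb_bound (A := 2) (K := 1)) => [|z].
      by apply: measurable_funM => //; exact: mexp.
    rewrite normrM (ger0_norm (expR_ge0 _)) normr_nat ler_pM2l// ler_expR mul1r.
    rewrite (le_trans (ler_norm _))// normrM (@le_trans _ _ `|z|)//.
      by rewrite ler_piMl.
    by rewrite lerDr.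
  rewrite gintZ; last by apply: expbB => //; apply: expbB.
  rewrite gintB//; last by apply: expbB.
  rewrite gintB// gintZ// gint_cst !gint_expR.
  have -> : (2 * e n) ^+ 2 / 2 = 2 * e n ^+ 2 by field.
  rewrite [2^-1 * _]mulrC; field; exact: en0.
have h2 : gint (fun z => Dn n z ^+ 2) @[n --> \oo] --> (2 - 2 * 2^-1 : R).
  under eq_cvg do rewrite E; apply: cvgB; first exact: expR_quot.
  by apply: cvgM; [exact: cvg_cst|exact: expR_quot].
have -> := cvg_unique (@Rhausdorff R) h h2; lra.
Qed.

End seqderiv.

(** * Powers and the logarithm on the positive half-line *)

Lemma powR_pred (R : realType) (a y : R) : 0 < y -> y `^ (a - 1) * y = y `^ a.
Proof.
move=> y0; have := @powRD R y (a - 1) 1; rewrite subrK (powRr1 (ltW y0)) => -> //.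
by apply/implyP => _; rewrite gt_eqF.
Qed.

Lemma powR_pred2 (R : realType) (a y : R) : 0 < y -> y `^ (a - 2) * y ^+ 2 = y `^ a.
Proof.
move=> y0; have -> : a - 2 = a - 1 - 1 by ring.
by rewrite expr2 mulrA !powR_pred.
Qed.

Section powlike.
Context {R : realType}.

(** A common form of the powers and of the logarithm, for which rho is the
    exponent and 0 respectively. *)
Definition powlike (h : R -> R) (k rho : R) :=
  measurable_fun setT h /\
  forall y : R, 0 < y -> is_derive y 1 h (k * y `^ (rho - 1)).

Lemma powlike_powR a : powlike (fun y => y `^ a) a a.
Proof.
split; first exact: measurable_powR.
by move=> y y0; exact: is_derive1_powR.
Qed.

Lemma powlike_ln : powlike (@ln R) 1 0.
Proof.
split; first exact: measurable_ln.
move=> y y0; rewrite mul1r sub0r powRN powRr1 ?ltW//.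
exact: is_derive1_ln.
Qed.

Lemma is_derive_cvg (h : R -> R) (y d : R) (u : nat -> R) :
  is_derive y 1 h d -> u n @[n --> \oo] --> y -> h (u n) @[n --> \oo] --> h y.
Proof.
move=> dh uy; have ch : {for y, continuous h}.
  by apply: differentiable_continuous; apply/derivable1_diffP; case: dh.
by apply: continuous_cvg.
Qed.

Lemma powR_cvg (a y : R) (u : nat -> R) : 0 < y ->
  u n @[n --> \oo] --> y -> u n `^ a @[n --> \oo] --> y `^ a.
Proof.
by move=> y0; apply: (is_derive_cvg (h := fun y => y `^ a)); exact: is_derive1_powR.
Qed.

Lemma powR_between (a x y c : R) : 0 < x -> x <= c -> c <= y ->
  c `^ a <= x `^ a + y `^ a.
Proof.
move=> x0 xc cy; have c0 := lt_le_trans x0 xc; have y0 := lt_le_trans c0 cy.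
have [a0|a0] := leP 0 a.
- rewrite (@le_trans _ _ (y `^ a))//; last by rewrite lerDr powR_ge0.
  by apply: ge0_ler_powR; rewrite ?nnegrE// ltW.
- rewrite (@le_trans _ _ (x `^ a))//; last by rewrite lerDl powR_ge0.
  rewrite -[a]opprK (powRN c) (powRN x) lef_pV2 ?posrE ?powR_gt0//.
  by apply: ge0_ler_powR; rewrite ?nnegrE ?oppr_ge0// ltW.
Qed.

Let dcont (h : R -> R) (d : R -> R) (x y : R) : (forall z : R, x <= z -> is_derive z 1 h (d z)) ->
  {within `[x, y], continuous h}.
Proof.
move=> dh; apply: derivable_within_continuous => z; rewrite in_itv /= => /andP[xz _].
by case: (dh z xz).
Qed.

(** The bound on c^a, valid for exponents of either sign, is what makes mean
    value estimates integrable: it only involves the values at the end points. *)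
Lemma mvt_pos (h d : R -> R) (y y' : R) : 0 < y -> 0 < y' -> y != y' ->
  (forall z : R, 0 < z -> is_derive z 1 h (d z)) ->
  exists c, [/\ 0 < c, c != y', `|c - y| <= `|y' - y|,
    (forall a, c `^ a <= y `^ a + y' `^ a) & h y' - h y = d c * (y' - y)].
Proof.
move=> y0 y'0 yy' dh.
have [lt|lt|eq] := ltgtP y y'; last by rewrite eq eqxx in yy'.
- have H1 (x : R) : x \in `]y, y'[%R -> is_derive x 1 h (d x).
    by rewrite in_itv /= => /andP[yx _]; apply: dh; exact: lt_trans yx.
  have H2 : {within `[y, y'], continuous h}.
    by apply: (@dcont h d) => z yz; apply: dh; exact: lt_le_trans yz.
  have [c +->] := MVT lt H1 H2.
  rewrite in_itv /= => /andP[yc cy']; exists c; split => //.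
  + exact: lt_trans yc.
  + by rewrite lt_eqF.
  + by rewrite !ger0_norm ?subr_ge0; lra.
  + by move=> a; apply: powR_between => //; exact: ltW.
- have H1 (x : R) : x \in `]y', y[%R -> is_derive x 1 h (d x).
    by rewrite in_itv /= => /andP[yx _]; apply: dh; exact: lt_trans yx.
  have H2 : {within `[y', y], continuous h}.
    by apply: (@dcont h d) => z yz; apply: dh; exact: lt_le_trans yz.
  have [c +e] := MVT lt H1 H2.
  rewrite in_itv /= => /andP[yc cy']; exists c; split => //.
  + exact: lt_trans yc.
  + by rewrite gt_eqF.
  + by rewrite !ler0_norm ?subr_le0; lra.
  + by move=> a; rewrite addrC; apply: powR_between => //; exact: ltW.
  + by rewrite -opprB e -mulrN opprB.
Qed.

Variables (h : R -> R) (k rho : R).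
Hypothesis hp : powlike h k rho.

Lemma powlike_mvt (y y' : R) : 0 < y -> 0 < y' ->
  exists c, [/\ 0 < c, `|c - y| <= `|y' - y|,
    (forall a, c `^ a <= y `^ a + y' `^ a) &
    h y' - h y = k * c `^ (rho - 1) * (y' - y)].
Proof.
move=> y0 y'0; have [->|yy'] := eqVneq y y'.
  exists y'; split => //; rewrite ?subrr ?mulr0//.
  by move=> a; rewrite lerDl powR_ge0.
by have [c []] := mvt_pos y0 y'0 yy' hp.2; exists c.
Qed.

(** Cauchy's form of the argument: G vanishes at both ends, and its derivative
    is (2 M - h'') times a factor that does not vanish. *)
Lemma powlike_taylor (y y' : R) : 0 < y -> 0 < y' ->
  exists c, [/\ 0 < c, `|c - y| <= `|y' - y|,
    (forall a, c `^ a <= y `^ a + y' `^ a) &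
    h y' - h y - k * y `^ (rho - 1) * (y' - y) =
    k * (rho - 1) / 2 * c `^ (rho - 2) * (y' - y) ^+ 2].
Proof.
move=> y0 y'0; have [->|yy'] := eqVneq y y'.
  exists y'; split => //; rewrite ?subrr ?expr0n ?mulr0 ?subrr//.
  by move=> a; rewrite lerDl powR_ge0.
pose h1 z := k * z `^ (rho - 1).
pose h2 z := k * ((rho - 1) * z `^ (rho - 2)).
pose M := (h y' - h y - h1 y * (y' - y)) / (y' - y) ^+ 2.
pose G z := h y' - h z - h1 z * (y' - z) - M * (y' - z) ^+ 2.
pose dG z := (2 * M - h2 z) * (y' - z).
have dG_ (z : R) : 0 < z -> is_derive z 1 G (dG z).
  move=> z0.
  have d1 : is_derive z 1 h (h1 z) by exact: hp.2.
  have d2 : is_derive z 1 h1 (h2 z).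
    have -> : h1 = k *: ((fun z => z `^ (rho - 1)) : R -> R) by [].
    have := @is_derive1_powR _ (rho - 1) z z0.
    move=> d; apply: is_derive_eq; rewrite /h2 /GRing.scale /=.
    by congr (_ * (_ * _ `^ _)); ring.
  have d3 : is_derive z 1 (fun z => y' - z) (-1).
    have -> : (fun z => y' - z) = cst y' - (id : R -> R) by [].
    by apply: is_derive_eq; rewrite sub0r.
  have -> : G = cst (h y') - h - h1 * (fun z => y' - z) - M *: ((fun z => y' - z) * (fun z => y' - z)).
    by apply/funext => w; rewrite /G expr2.
  apply: is_derive_eq; rewrite /GRing.scale /= /dG; ring.
have yn : y' - y != 0 by rewrite subr_eq0 eq_sym.
have Gy : G y = 0 by rewrite /G /M divfK ?expf_neq0// subrr.
have Gy' : G y' = 0 by rewrite /G !subrr expr0n !mulr0 !subrr.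
have [c [c0 cy' cy cp]] := mvt_pos y0 y'0 yy' dG_.
rewrite Gy Gy' subrr => /esym/eqP; rewrite mulf_eq0 (negbTE yn) orbF /dG.
rewrite mulf_eq0 [y' - c == 0]subr_eq0 [y' == c]eq_sym (negbTE cy') orbF subr_eq0 => /eqP e.
exists c; split => //.
have -> : k * (rho - 1) / 2 * c `^ (rho - 2) = M.
  by rewrite -[RHS](mulKf (_ : 2 != 0))// e /h2; field.
by rewrite /M divfK ?expf_neq0.
Qed.

End powlike.

(** * Continuous convergence of families of exponential growth *)

Section ccvg.
Context {R : realType} {I : finType}.
Local Notation V := (I -> R).
Local Notation RB := (measurableTypeR R).

Definition norm1 (x : V) : R := \sum_i `|x i|.
Definition transl (c : R) (v x : V) : V := fun i => x i + c * v i.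
Definition ptcvg (u : nat -> V) (x : V) := forall i, u n i @[n --> \oo] --> x i.

(** Measurability of F, expressed by composition with measurable maps into V,
    which avoids choosing a sigma-algebra on V. *)
Definition jmeas (F : V -> R) := forall d (T : measurableType d) (f : T -> V),
  (forall i, measurable_fun setT (fun t => f t i)) ->
  measurable_fun setT (fun t => F (f t)).

Definition jmeas2 (Q : V -> R -> R) :=
  forall d (T : measurableType d) (f : T -> V) (g : T -> R),
  (forall i, measurable_fun setT (fun t => f t i)) -> measurable_fun setT g ->
  measurable_fun setT (fun t => Q (f t) (g t)).

Definition tame (F : nat -> V -> R) := (forall n, jmeas (F n)) /\
  exists K, forall n x, `|F n x| <= expR (K * (1 + norm1 x)).

(** Continuous convergence.  Evaluating at moving points is what makes the
    notion stable under composition with convolutions of varying variance. *)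
Definition ccvg (F : nat -> V -> R) (f : V -> R) := tame F /\
  forall u x, ptcvg u x -> F n (u n) @[n --> \oo] --> f x.

Local Notation tame1 F := (tame (fun=> F)).
Local Notation ccont F := (ccvg (fun=> F) F).

Lemma norm1_ge0 x : 0 <= norm1 x. Proof. exact: sumr_ge0. Qed.

Lemma norm1_transl c v x : norm1 (transl c v x) <= norm1 x + `|c| * norm1 v.
Proof.
rewrite /norm1 mulr_sumr -big_split /=; apply: ler_sum => i _.
by rewrite (le_trans (ler_normD _ _))// normrM.
Qed.

Lemma ptcvg_cst x : ptcvg (fun=> x) x. Proof. by move=> i; exact: cvg_cst. Qed.

Lemma ptcvg_transl (u : nat -> V) x (c : nat -> R) (c' : R) v : ptcvg u x ->
  c n @[n --> \oo] --> c' -> ptcvg (fun n => transl (c n) v (u n)) (transl c' v x).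
Proof.
by move=> ux ccvg' i; apply: cvgD => //; apply: cvgM => //; exact: cvg_cst.
Qed.

Lemma seq_bounded (u : nat -> R) (l : R) : u n @[n --> \oo] --> l ->
  exists2 M, 0 <= M & forall n, `|u n| <= M.
Proof.
move=> ul; have /cvg_seq_bounded [M [Mr hM]] : cvgn u by apply/cvg_ex; exists l.
have h n : `|u n| <= `|M| + 1.
  by apply: hM => //; rewrite (le_lt_trans (ler_norm M))// ltrDl.
by exists (`|M| + 1) => //; rewrite addr_ge0.
Qed.

Lemma ptcvg_bounded (u : nat -> V) x : ptcvg u x ->
  exists2 M, 0 <= M & forall n, norm1 (u n) <= M.
Proof.
move=> ux; have h i : exists m, 0 <= m /\ forall n, `|u n i| <= m.
  by have [m m0 hm] := seq_bounded (ux i); exists m.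
pose M i := sval (cid (h i)).
have hM i : 0 <= M i /\ forall n, `|u n i| <= M i by rewrite /M; case: cid.
exists (\sum_i M i); first by apply: sumr_ge0 => i _; case: (hM i).
by move=> n; apply: ler_sum => i _; case: (hM i).
Qed.

Lemma expR_absorb (A K r : R) : 0 <= r ->
  A * expR (K * (1 + r)) <= expR ((`|A| + `|K|) * (1 + r)).
Proof.
move=> r0; apply: (@le_trans _ _ (expR (`|A| * (1 + r)) * expR (K * (1 + r)))).
  rewrite ler_pM2r ?expR_gt0//; apply: (le_trans (ler_norm A)).
  apply: (le_trans (le_expR_id _)); rewrite ler_expR ler_peMr// lerDl//.
rewrite -expRD ler_expR -mulrDl ler_wpM2r ?addr_ge0// lerD2l ler_norm//.
Qed.

Lemma tameI (F : nat -> V -> R) (A K : R) : (forall n, jmeas (F n)) ->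
  (forall n x, `|F n x| <= A * expR (K * (1 + norm1 x))) -> tame F.
Proof.
move=> mF FK; split => //; exists (`|A| + `|K|) => n x.
by rewrite (le_trans (FK n x))// expR_absorb// norm1_ge0.
Qed.

Lemma tameE (F : nat -> V -> R) : tame F ->
  exists2 K, 0 <= K & forall n x, `|F n x| <= expR (K * (1 + norm1 x)).
Proof.
move=> [_ [K FK]]; exists `|K| => // n x; rewrite (le_trans (FK n x))//.
by rewrite ler_expR ler_wpM2r ?ler_norm// addr_ge0// norm1_ge0.
Qed.

Lemma tame_le (F G : nat -> V -> R) : (forall n, jmeas (F n)) -> tame G ->
  (forall n x, `|F n x| <= G n x) -> tame F.
Proof.
move=> mF [_ [K GK]] FG; split => //; exists K => n x.
by rewrite (le_trans (FG n x))// (le_trans (ler_norm _)).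
Qed.

Lemma jmeas_cst c : jmeas (fun=> c).
Proof. by move=> d T f mf; exact: measurable_cst. Qed.
Lemma jmeasD F G : jmeas F -> jmeas G -> jmeas (fun x => F x + G x).
Proof. by move=> mF mG d T f mf; apply: measurable_funD; [exact: mF|exact: mG]. Qed.
Lemma jmeasM F G : jmeas F -> jmeas G -> jmeas (fun x => F x * G x).
Proof. by move=> mF mG d T f mf; apply: measurable_funM; [exact: mF|exact: mG]. Qed.
Lemma jmeasN F : jmeas F -> jmeas (fun x => - F x).
Proof. by move=> mF d T f mf; apply: measurableT_comp => //; exact: mF. Qed.
Lemma jmeasB f g : jmeas f -> jmeas g -> jmeas (fun x => f x - g x).
Proof. by move=> mf mg; apply: jmeasD => //; exact: jmeasN. Qed.
Lemma jmeas_comp (h : R -> R) F : measurable_fun setT h -> jmeas F -> jmeas (fun x => h (F x)).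
Proof. by move=> mh mF d T f mf; apply: (measurableT_comp mh); exact: mF. Qed.
Lemma tame_at F n : tame F -> tame1 (F n).
Proof. by move=> [mF [K FK]]; split => [_|]; [exact: mF|exists K]. Qed.

Lemma tame_cst c : tame1 (fun=> c).
Proof.
apply: (tameI (A := `|c|) (K := 0)) => [n|n x]; first exact: jmeas_cst.
by rewrite mul0r expR0 mulr1.
Qed.

Lemma tameD F G : tame F -> tame G -> tame (fun n x => F n x + G n x).
Proof.
move=> tF tG; have [K K0 FK] := tameE tF; have [L L0 GL] := tameE tG.
apply: (tameI (A := 2) (K := K + L)) => [n|n x].
  by apply: jmeasD; [case: tF|case: tG].
rewrite (le_trans (ler_normD _ _))// mulr_natl mulr2n; have := norm1_ge0 x => x0.
apply: lerD.
- by rewrite (le_trans (FK n x))// ler_expR ler_wpM2r ?addr_ge0// lerDl.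
- by rewrite (le_trans (GL n x))// ler_expR ler_wpM2r ?addr_ge0// lerDr.
Qed.

Lemma tameM F G : tame F -> tame G -> tame (fun n x => F n x * G n x).
Proof.
move=> tF tG; have [K K0 FK] := tameE tF; have [L L0 GL] := tameE tG.
split => [n|]; first by apply: jmeasM; [case: tF|case: tG].
by exists (K + L) => n x; rewrite normrM mulrDl expRD ler_pM.
Qed.

Lemma tameB F G : tame F -> tame G -> tame (fun n x => F n x - G n x).
Proof.
move=> tF tG; have := tameD tF (tameM (tame_cst (-1)) tG).
rewrite (_ : (fun n x => _) = (fun n x => F n x - G n x))//.
by apply/funext => n; apply/funext => x; rewrite mulN1r.
Qed.

Lemma ccvg_cst c : ccont (fun=> c).
Proof. by split; [exact: tame_cst|move=> u x _; exact: cvg_cst]. Qed.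

Lemma ccvgD F G f g : ccvg F f -> ccvg G g -> ccvg (fun n x => F n x + G n x) (fun x => f x + g x).
Proof.
move=> [tF Ff] [tG Gg]; split; first exact: tameD.
by move=> u x ux; apply: cvgD; [exact: Ff|exact: Gg].
Qed.

Lemma ccvgM F G f g : ccvg F f -> ccvg G g -> ccvg (fun n x => F n x * G n x) (fun x => f x * g x).
Proof.
move=> [tF Ff] [tG Gg]; split; first exact: tameM.
by move=> u x ux; apply: cvgM; [exact: Ff|exact: Gg].
Qed.

Lemma ccvg_ext F G f g : (forall n x, F n x = G n x) -> (forall x, f x = g x) ->
  ccvg F f -> ccvg G g.
Proof.
move=> FG fg; have -> : F = G by apply/funext => n; apply/funext => x.
by have -> : f = g by apply/funext.
Qed.

Lemma ccvgZ c F f : ccvg F f -> ccvg (fun n x => c * F n x) (fun x => c * f x).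
Proof. by move=> Ff; apply: ccvgM => //; exact: ccvg_cst. Qed.

Lemma ccvgN F f : ccvg F f -> ccvg (fun n x => - F n x) (fun x => - f x).
Proof.
by move=> /(ccvgZ (-1)); apply: ccvg_ext => [n x|x]; rewrite mulN1r.
Qed.

Lemma ccvgB F G f g : ccvg F f -> ccvg G g -> ccvg (fun n x => F n x - G n x) (fun x => f x - g x).
Proof. by move=> Ff Gg; apply: ccvgD => //; exact: ccvgN. Qed.

Lemma ccvg_sum (J : Type) (s : seq J) (F : J -> nat -> V -> R) (f : J -> V -> R) :
  (forall j, ccvg (F j) (f j)) ->
  ccvg (fun n x => \sum_(j <- s) F j n x) (fun x => \sum_(j <- s) f j x).
Proof.
move=> Ff; elim: s => [|j s IH].
  by apply: ccvg_ext (ccvg_cst 0) => [n x|x]; rewrite big_nil.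
by apply: ccvg_ext (ccvgD (Ff j) IH) => [n x|x]; rewrite big_cons.
Qed.

Lemma gint_tame (Q : nat -> V -> R -> R) :
  (forall n, jmeas2 (Q n)) ->
  (exists A K, forall n x z, `|Q n x z| <= A * expR (K * (1 + norm1 x + `|z|))) ->
  (forall n x, expb (Q n x)) /\ tame (fun n x => gint (Q n x)).
Proof.
move=> mQ [A [K QK]].
have mQs n x : measurable_fun setT (Q n x).
  by apply: (mQ n _ _ (fun=> x) id) => // i; exact: measurable_cst.
have Qb n x z : `|Q n x z| <= `|A| * expR (`|K| * (norm1 x)) * expR (`|K| * (1 + `|z|)).
  rewrite (le_trans (QK n x z))// -mulrA -expRD.
  apply: (@le_trans _ _ (`|A| * expR (K * (1 + norm1 x + `|z|)))).
    by rewrite ler_wpM2r ?expR_ge0// ler_norm.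
  rewrite ler_wpM2l// ler_expR -mulrDr addrA [norm1 x + 1]addrC.
  by rewrite ler_wpM2r ?ler_norm// !addr_ge0// norm1_ge0.
split=> [n x|].
  by apply: (expb_bound (A := `|A| * expR (`|K| * (norm1 x))) (K := `|K|)).
apply: (tameI (A := `|A| * exp_abs_moment `|K|) (K := `|K|)) => [n d T f mf|n x].
  apply: (@measurable_gint _ _ _ (fun t => Q n (f t))).
  apply: (mQ n _ _ (fun p : T * RB => f p.1) (fun p : T * RB => p.2)).
    by move=> i; exact: (measurableT_comp (mf i)).
  exact: measurable_snd.
have h := @gint_bound _ (Q n x) (`|A| * expR (`|K| * norm1 x)) `|K| (mQs n x) (Qb n x).
rewrite (le_trans h)// mulrAC ler_wpM2l ?mulr_ge0 ?exp_abs_moment_ge0//.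
by rewrite ler_expR ler_wpM2l// lerDr.
Qed.

(** Along a convergent sequence of parameters, norms are bounded, so one
    exponential dominates all the integrands. *)
Lemma ccvg_gint (Q : nat -> V -> R -> R) (q : V -> R -> R) :
  (forall n, jmeas2 (Q n)) ->
  (exists A K, forall n x z, `|Q n x z| <= A * expR (K * (1 + norm1 x + `|z|))) ->
  (forall u x, ptcvg u x -> forall z, Q n (u n) z @[n --> \oo] --> q x z) ->
  ccvg (fun n x => gint (Q n x)) (fun x => gint (q x)).
Proof.
move=> mQ QK Qq; have [eQ tQ] := gint_tame mQ QK; split => // u x ux.
have [M M0 uM] := ptcvg_bounded ux; have [A [K hK]] := QK.
apply: (@gint_cvg _ (fun n => Q n (u n)) (q x) (`|A| + `|K| * (1 + M))) => //.
- by move=> n; case: (eQ n (u n)).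
- move=> n z; rewrite (le_trans (hK _ _ _))//.
  apply: (@le_trans _ _ (`|A| * expR (`|K| * (1 + M) * (1 + `|z|)))).
    apply: (@le_trans _ _ (`|A| * expR (K * (1 + norm1 (u n) + `|z|)))).
      by rewrite ler_wpM2r ?expR_ge0// ler_norm.
    rewrite ler_wpM2l// ler_expR.
    apply: (@le_trans _ _ (`|K| * (1 + norm1 (u n) + `|z|))).
      by rewrite ler_wpM2r ?ler_norm// !addr_ge0// norm1_ge0.
    rewrite -mulrA ler_wpM2l//; have := uM n; have := normr_ge0 z; nra.
  rewrite (le_trans (expR_absorb _ _ _))// ler_expR normr_id.
  by rewrite (ger0_norm (_ : 0 <= `|K| * (1 + M)))// mulr_ge0// addr_ge0.
- by move=> z; exact: Qq.
Qed.

Definition gconv (s : R) (v : V) (F : V -> R) (x : V) : R :=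
  gint (fun z => F (transl (s * z) v x)).

Lemma jmeas2_transl F s v : jmeas F -> jmeas2 (fun x z => F (transl (s * z) v x)).
Proof.
move=> mF d T f g mf mg; apply: (mF _ _ (fun t => transl (s * g t) v (f t))) => i.
by apply: measurable_funD => //; apply: measurable_funM => //; exact: measurable_funM.
Qed.

Lemma tame_transl_bound (F : nat -> V -> R) (s : nat -> R) (S : R) v : tame F ->
  (forall n, `|s n| <= S) ->
  exists A K, forall n x z, `|F n (transl (s n * z) v x)| <= A * expR (K * (1 + norm1 x + `|z|)).
Proof.
move=> tF sS; have [K K0 FK] := tameE tF.
exists 1, (K * (1 + S * norm1 v)) => n x z; rewrite mul1r (le_trans (FK _ _))// ler_expR.
rewrite -mulrA ler_wpM2l//.
have := norm1_transl (s n * z) v x; rewrite normrM => h.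
have : `|s n| * `|z| * norm1 v <= S * `|z| * norm1 v.
  by rewrite ler_wpM2r ?norm1_ge0// ler_wpM2r.
have := norm1_ge0 x; have := norm1_ge0 v; have := normr_ge0 z; have := sS n; have := normr_ge0 (s n).
move=> a b c d e g.
have S0 : 0 <= S by lra.
have : 0 <= S * norm1 v by rewrite mulr_ge0.
nra.
Qed.

Lemma ccvg_gconv (F : nat -> V -> R) f (s : nat -> R) (s' : R) v : ccvg F f ->
  s n @[n --> \oo] --> s' -> ccvg (fun n => gconv (s n) v (F n)) (gconv s' v f).
Proof.
move=> [tF Ff] ss'; have [S S0 sS] := seq_bounded ss'.
apply: (ccvg_gint (Q := fun n x z => F n (transl (s n * z) v x))) => [n||].
- by apply: jmeas2_transl; case: tF.
- exact: tame_transl_bound tF sS.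
- move=> u x ux z; apply: Ff; apply: ptcvg_transl => //.
  by apply: cvgM => //; exact: cvg_cst.
Qed.

Lemma expb_transl F s v x : tame1 F -> expb (fun z => F (transl (s * z) v x)).
Proof.
move=> tF; have [|h _] := @gint_tame (fun n x z => F (transl (s * z) v x)) (fun=> jmeas2_transl _ _ (tF.1 0%N)).
  by apply: (@tame_transl_bound (fun=> F) (fun=> s) `|s|).
exact: (h 0%N).
Qed.

End ccvg.

Local Notation tame1 F := (tame (fun=> F)).
Local Notation ccont F := (ccvg (fun=> F) F).

(** * Positive families and their inverses *)

Section pccvg.
Context {R : realType} {I : finType}.
Local Notation V := (I -> R).
Local Notation RB := (measurableTypeR R).
Local Notation N := (@std_normal R).
Implicit Types (F G : nat -> V -> R) (f g : V -> R) (v w x : V).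

(** Bounding the inverses as well gives exponential bounds for every real power
    of the family, negative ones included. *)
Record pccvg F f : Prop := Pcc {
  pccvg_ccvg : ccvg F f;
  pccvg_inv : ccvg (fun n x => (F n x)^-1) (fun x => (f x)^-1);
  pccvg_gt0 : forall n x, 0 < F n x;
  pccvg_lim : forall x, 0 < f x }.

Lemma pccvg_ext F G f g : (forall n x, F n x = G n x) -> (forall x, f x = g x) ->
  pccvg F f -> pccvg G g.
Proof.
move=> FG fg; have -> : F = G by apply/funext => n; apply/funext => x.
by have -> : f = g by apply/funext.
Qed.

Lemma ccvg_lim_tame F f : ccvg F f -> tame1 f.
Proof.
move=> [[mF [K FK]] Ff]; split => [_ d T u mu|].
  apply: (measurable_fun_cvg (h := fun n t => F n (u t))) => [n|t _].
    exact: mF.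
  exact: (Ff (fun=> u t) _ (@ptcvg_cst _ _ (u t))).
exists K => _ x; apply: (cvgr_to_le (cvg_norm (Ff (fun=> x) _ (@ptcvg_cst _ _ x)))); exact: nearW.
Qed.

(** Both bounds together say |ln y| <= r. *)
Lemma powR_bound (y r a : R) : 0 < y -> y <= expR r -> y^-1 <= expR r ->
  y `^ a <= expR (`|a| * r).
Proof.
move=> y0 yr yVr; rewrite /powR gt_eqF// ler_expR.
have l1 : ln y <= r by rewrite -ler_expR lnK.
have l2 : - ln y <= r by rewrite -lnV// -ler_expR lnK// posrE invr_gt0.
rewrite (le_trans (ler_norm _))// normrM ler_wpM2l// ler_norml; lra.
Qed.

Lemma jmeas_powR a (f : V -> R) : jmeas f -> jmeas (fun x => f x `^ a).
Proof. by apply: (jmeas_comp (h := fun y => y `^ a)); exact: measurable_powR. Qed.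

Lemma ccvg_powR F f a : pccvg F f -> ccvg (fun n x => F n x `^ a) (fun x => f x `^ a).
Proof.
move=> [cF cFV F0 f0]; split; last first.
  by move=> u x ux; apply: powR_cvg => //; exact: cF.2.
have [K K0 FK] := tameE cF.1; have [L L0 GL] := tameE cFV.1.
split => [n|]; first by apply: jmeas_powR; case: cF => -[].
exists (`|a| * (K + L)) => n x; have := norm1_ge0 x => x0.
rewrite ger0_norm ?powR_ge0// -mulrA; apply: powR_bound => //.
- rewrite (le_trans (ler_norm _))// (le_trans (FK n x))// ler_expR.
  by rewrite ler_wpM2r ?addr_ge0// lerDl.
- rewrite (le_trans (ler_norm _))// (le_trans (GL n x))// ler_expR.
  by rewrite ler_wpM2r ?addr_ge0// lerDr.
Qed.

Lemma pccvg_powR F f a : pccvg F f -> pccvg (fun n x => F n x `^ a) (fun x => f x `^ a).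
Proof.
move=> pF; have [_ _ F0 f0] := pF; split.
- exact: ccvg_powR.
- by apply: ccvg_ext (ccvg_powR (- a) pF) => [n x|x]; rewrite powRN.
- by move=> n x; rewrite powR_gt0.
- by move=> x; rewrite powR_gt0.
Qed.

Lemma pccvg_le F G f : ccvg F f -> (forall n x, 0 < F n x) -> (forall x, 0 < f x) ->
  tame G -> (forall n x, (F n x)^-1 <= G n x) -> pccvg F f.
Proof.
move=> cF F0 f0 tG FG; split => //; split.
  apply: tame_le tG _ => [n|n x]; last first.
    by rewrite ger0_norm ?FG// invr_ge0 ltW.
  have -> : (fun x => (F n x)^-1) = (fun x => F n x `^ (-1)).
    by apply/funext => x; rewrite powR_inv1// ltW.
  by apply: jmeas_powR; case: cF => -[].
by move=> u x ux; apply: cvgV; [rewrite gt_eqF|exact: cF.2].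
Qed.

Lemma pccvg_sum (J : finType) (j0 : J) (F : J -> nat -> V -> R) (f : J -> V -> R) :
  (forall j, pccvg (F j) (f j)) ->
  pccvg (fun n x => \sum_j F j n x) (fun x => \sum_j f j x).
Proof.
move=> pF.
have ge n x : F j0 n x <= \sum_j F j n x.
  rewrite (bigD1 j0)//= lerDl; apply: sumr_ge0 => j _; exact: ltW (pccvg_gt0 (pF j) _ _).
apply: (pccvg_le (G := fun n x => (F j0 n x)^-1)).
- by apply: ccvg_sum => j; exact: pccvg_ccvg.
- by move=> n x; apply: lt_le_trans (ge n x); exact: (pccvg_gt0 (pF j0)).
- move=> x; rewrite (bigD1 j0)//= ltr_pwDl ?(pccvg_lim (pF j0))//.
  by apply: sumr_ge0 => j _; exact: ltW (pccvg_lim (pF j) _).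
- by case: (pccvg_inv (pF j0)).
- move=> n x; rewrite lef_pV2 ?posrE ?(pccvg_gt0 (pF j0))//.
  by apply: lt_le_trans (ge n x); exact: (pccvg_gt0 (pF j0)).
Qed.

(** By convexity of y |-> 1/y the inverse of an average is at most the average
    of the inverses.  The tangent inequality f >= 2 c - c^2 / f at
    c = 1 / (1 + E f^-1) gives this up to the term 1, and with it the
    positivity of the average. *)
Lemma gint_inv_bound (f : R -> R) : expb f -> expb (fun z => (f z)^-1) ->
  (forall z, 0 < f z) ->
  0 < gint f /\ (gint f)^-1 <= gint (fun z => (f z)^-1) + 1.
Proof.
move=> ef eV f0; set g := gint (fun z => (f z)^-1).
have g0 : 0 <= g by apply: Rintegral_ge0 => z _; rewrite invr_ge0 ltW.
pose c := (g + 1)^-1; have c0 : 0 < c by rewrite invr_gt0 ltr_wpDl.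
have ecst (k : R) : expb (fun=> k).
  by split => //; exists `|k| => z; rewrite (le_trans (le_expR_id _))// ler_expR ler_peMr// lerDl.
have eVc : expb (fun z => c ^+ 2 * (f z)^-1).
  case: eV => mV [K hK]; apply: (expb_bound (A := c ^+ 2) (K := K)) => [|z].
    exact: measurable_funM.
  by rewrite normrM ger0_norm ?sqr_ge0// ler_wpM2l ?sqr_ge0.
have h : 2 * c - c ^+ 2 * g <= gint f.
  rewrite -[2 * c]gint_cst /g -gintZ// -gintB//.
  apply: gint_le => // [|z]; first exact: expbB.
  have fz := f0 z; rewrite -subr_ge0.
  have -> : f z - (2 * c - c ^+ 2 * (f z)^-1) = (f z - c) ^+ 2 / f z.
    by field; rewrite gt_eqF.
  by rewrite divr_ge0 ?sqr_ge0// ltW.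
have h2 : c <= gint f.
  apply: le_trans h; have : c * (g + 1) = 1 by rewrite mulVf// gt_eqF// ltr_wpDl.
  have := c0; nra.
split; first exact: lt_le_trans h2.
by rewrite -[leRHS]invrK -/c lef_pV2 ?posrE// (lt_le_trans c0).
Qed.

Lemma pccvg_gconv F f (s : nat -> R) (s' : R) v : pccvg F f ->
  s n @[n --> \oo] --> s' -> pccvg (fun n => gconv (s n) v (F n)) (gconv s' v f).
Proof.
move=> [cF cFV F0 f0] ss'.
have tFn n : tame1 (F n) by case: cF.1 => mF [K FK]; split => [_|]; [exact: mF|exists K].
have tFVn n : tame1 (fun x => (F n x)^-1).
  by case: cFV.1 => mF [K FK]; split => [_|]; [exact: mF|exists K].
have hF n x := gint_inv_bound (expb_transl (s n) v x (tFn n)) (expb_transl (s n) v x (tFVn n)) (fun z => F0 n _).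
have hf x := gint_inv_bound (expb_transl s' v x (ccvg_lim_tame cF)) (expb_transl s' v x (ccvg_lim_tame cFV)) (fun z => f0 _).
have cFV' := ccvg_gconv v cFV ss'.
apply: (pccvg_le (G := fun n x => gconv (s n) v (fun x => (F n x)^-1) x + 1)).
- exact: ccvg_gconv.
- by move=> n x; case: (hF n x).
- by move=> x; case: (hf x).
- by apply: tameD; [case: cFV'|exact: tame_cst].
- by move=> n x; case: (hF n x).
Qed.

(** The mean value theorem from the base point 1 bounds h by powers. *)
Lemma ccvg_powlike h k rho F f : powlike h k rho -> pccvg F f ->
  ccvg (fun n x => h (F n x)) (fun x => h (f x)).
Proof.
move=> hp pF; have [cF cFV F0 f0] := pF; split; last first.
  move=> u x ux; apply: is_derive_cvg (cF.2 _ _ ux); exact: hp.2.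
have t1 := tame_cst (I := I) `|h 1|; have t2 := tame_cst (I := I) `|k|.
have t3 := tameD (tame_cst 1) (ccvg_powR (rho - 1) pF).1.
have t4 := tameD cF.1 (tame_cst 1).
apply: tame_le (tameD t1 (tameM t2 (tameM t3 t4))) _ => [n|n x].
  by apply: jmeas_comp hp.1 _; case: cF => -[].
have [c [c0 _ cp e]] := powlike_mvt hp (@ltr01 R) (F0 n x).
rewrite -[h (F n x)](subrK (h 1)) addrC (le_trans (ler_normD _ _))// lerD2l e.
rewrite !normrM -mulrA ler_wpM2l//.
have := cp (rho - 1); rewrite powR1 => cp1.
rewrite (ger0_norm (powR_ge0 _ _)) ler_pM ?powR_ge0//.
by rewrite (le_trans (ler_normB _ _))// normr1 gtr0_norm.
Qed.

End pccvg.

Local Notation pcont F := (pccvg (fun=> F) F).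

(** * Gaussian convolutions and directional derivatives *)

Section calculus.
Context {R : realType} {I : finType}.
Local Notation V := (I -> R).
Local Notation RB := (measurableTypeR R).
Local Notation N := (@std_normal R).
Implicit Types (F G : nat -> V -> R) (f g : V -> R) (v w x : V).

Lemma gint_swap (Q : R -> R -> R) (A K : R) :
  measurable_fun setT (fun p : RB * RB => Q p.1 p.2) ->
  (forall y z, `|Q y z| <= A * expR (K * (1 + `|y| + `|z|))) ->
  gint (fun y => gint (Q y)) = gint (fun z => gint (Q ^~ z)).
Proof.
move=> mQ QK.
have mQy y : measurable_fun setT (Q y).
  apply: (measurableT_comp (f := fun p : RB * RB => Q p.1 p.2) mQ (g := fun z => (y, z))).
  exact: pair1_measurable.
have mQz z : measurable_fun setT (Q ^~ z).
  apply: (measurableT_comp (f := fun p : RB * RB => Q p.1 p.2) mQ (g := fun y => (y, z))).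
  exact: pair2_measurable.
have QK2 y z : `|Q y z| <= `|A| * expR (`|K| * (1 + `|y|)) * expR (`|K| * (1 + `|z|)).
  rewrite (le_trans (QK y z))// -mulrA -expRD.
  apply: (@le_trans _ _ (`|A| * expR (K * (1 + `|y| + `|z|)))).
    by rewrite ler_wpM2r ?expR_ge0// ler_norm.
  rewrite ler_wpM2l// ler_expR -mulrDr.
  apply: (@le_trans _ _ (`|K| * (1 + `|y| + `|z|))).
    by rewrite ler_wpM2r ?ler_norm// !addr_ge0.
  by rewrite ler_wpM2l// addrA lerD2r lerDl.
have ey y : expb (Q y) by apply: expb_bound (mQy y) (QK2 y).
have ez z : expb (Q ^~ z).
  by apply: (expb_bound (A := `|A| * expR (`|K| * (1 + `|z|))) (K := `|K|)) => // y; rewrite mulrAC.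
have eg1 : expb (fun y => gint (Q y)).
  apply: (expb_bound (A := `|A| * exp_abs_moment `|K|) (K := `|K|)) => [|y].
    exact: (@measurable_gint _ _ RB Q).
  by rewrite mulrAC; exact: gint_bound.
have eg2 : expb (fun z => gint (Q ^~ z)).
  apply: (expb_bound (A := `|A| * exp_abs_moment `|K|) (K := `|K|)) => [|z].
    apply: (@measurable_gint _ _ RB (fun z y => Q y z)).
    apply: (measurableT_comp (f := fun p : RB * RB => Q p.1 p.2) mQ (g := fun p => (p.2, p.1))).
    exact: measurable_swap.
  by rewrite mulrAC; apply: gint_bound => // y; rewrite mulrAC.
apply: EFin_inj; rewrite (gint_EFin eg1) (gint_EFin eg2).
transitivity (\int[N]_y \int[N]_z (Q y z)%:E)%E.
  by apply: eq_integral => y _; rewrite gint_EFin.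
transitivity (\int[N]_z \int[N]_y (Q y z)%:E)%E; last first.
  by apply: eq_integral => y _; rewrite gint_EFin.
apply: (Fubini (f := fun p : RB * RB => (Q p.1 p.2)%:E)).
apply/integrable12ltyP; first exact/measurable_EFinP.
apply: (@le_lt_trans _ _ (\int[N]_y ((`|A| * exp_abs_moment `|K|) * expR (`|K| * (1 + `|y|)))%:E)%E); last first.
  rewrite -gint_EFin ?ltry//.
  apply: (expb_bound (A := `|A| * exp_abs_moment `|K|) (K := `|K|)) => [|z]; last first.
    by rewrite ger0_norm// !mulr_ge0 ?expR_ge0// exp_abs_moment_ge0.
  by apply: measurable_funM => //; case: (@expb_expR R `|K|).
have ea y : expb (fun z => `|Q y z|).
  apply: (expb_bound (A := `|A| * expR (`|K| * (1 + `|y|))) (K := `|K|)) => [|z].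
    exact: measurableT_comp.
  by rewrite normr_id.
have meas : measurable_fun setT (fun y => gint (fun z => `|Q y z|)).
  by apply: (@measurable_gint _ _ RB (fun y z => `|Q y z|)); exact: measurableT_comp.
under eq_integral => y _ do rewrite -(gint_EFin (ea y)).
apply: ge0_le_integral => //.
- by move=> y _; rewrite lee_fin; apply: Rintegral_ge0.
- exact/measurable_EFinP.
- apply/measurable_EFinP; apply: measurable_funM => //; case: (@expb_expR R `|K|) => //.
- move=> y _; rewrite lee_fin (le_trans (ler_norm _))// mulrAC; apply: gint_bound => [|z].
    exact: measurableT_comp.
  by rewrite normr_id.
Qed.

Lemma gconv_swap f a v b w x : tame1 f ->
  gconv a v (gconv b w f) x = gconv b w (gconv a v f) x.
Proof.
move=> tf; have [K K0 fK] := tameE tf.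
pose S := 1 + `|a| * norm1 v + `|b| * norm1 w.
rewrite /gconv.
have E y z : transl (b * z) w (transl (a * y) v x) = transl (a * y) v (transl (b * z) w x).
  by apply/funext => i; rewrite /transl addrAC.
rewrite (@gint_swap (fun y z => f (transl (b * z) w (transl (a * y) v x))) 1 (K * (S + norm1 x))).
- by congr gint; apply/funext => z; congr gint; apply/funext => y; rewrite E.
- apply: (tf.1 0%N _ _ (fun p : RB * RB => transl (b * p.2) w (transl (a * p.1) v x))) => i.
  by apply: measurable_funD; [apply: measurable_funD|] => //;
    apply: measurable_funM => //; exact: measurable_funM.
- move=> y z; rewrite mul1r (le_trans (fK 0%N _))// ler_expR -mulrA ler_wpM2l//.
  have h1 := norm1_transl (b * z) w (transl (a * y) v x); have h2 := norm1_transl (a * y) v x.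
  rewrite !normrM in h1 h2.
  have := norm1_ge0 v; have := norm1_ge0 w; have := norm1_ge0 x.
  have := normr_ge0 a; have := normr_ge0 b; have := normr_ge0 y; have := normr_ge0 z.
  move=> p1 p2 p3 p4 p5 p6 p7.
  have q1 : 0 <= `|a| * norm1 v by rewrite mulr_ge0.
  have q2 : 0 <= `|b| * norm1 w by rewrite mulr_ge0.
  rewrite /S; nra.
Qed.

Lemma ptcvg_transl_cst v x (u : nat -> R) (c : R) : u n @[n --> \oo] --> c ->
  ptcvg (fun n => transl (u n) v x) (transl c v x).
Proof. by move=> uc; apply: ptcvg_transl => //; exact: ptcvg_cst. Qed.

(** Convolving twice along the same direction adds the variances. *)
Lemma gconv_semigroup f a b c v x : ccont f ->
  0 <= a -> 0 <= b -> 0 <= c -> c ^+ 2 = a ^+ 2 + b ^+ 2 ->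
  gconv b v (gconv a v f) x = gconv c v f x.
Proof.
move=> cf a0 b0 c0 cab; pose p t := f (transl t v x).
transitivity (gint (fun y => gint (fun z => p (a * z + b * y)))).
  congr gint; apply/funext => y; congr gint; apply/funext => z.
  by congr f; apply/funext => i; rewrite /transl; ring.
rewrite (gint_stable a0 b0 c0 cab) //.
  move=> t; apply/(@cvg_nbhsP _ R^o) => u ut.
  by apply: (cf.2 (fun n => transl (u n) v x)); exact: ptcvg_transl_cst.
have := expb_transl 1 v x (F := f) cf.1.
by under eq_fun do rewrite mul1r.
Qed.

Definition dder v g dg := forall x, is_derive (0 : R) 1 (fun c => g (transl c v x)) (dg x).

Lemma transl0 v x : transl 0 v x = x.
Proof. by apply/funext => i; rewrite /transl mul0r addr0. Qed.

Lemma transl_transl a b v x : transl a v (transl b v x) = transl (a + b) v x.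
Proof. by apply/funext => i; rewrite /transl mulrDl -addrA [b * _ + _]addrC. Qed.

Lemma dder_at v g dg x (c : R) : dder v g dg ->
  is_derive c 1 (fun t => g (transl t v x)) (dg (transl c v x)).
Proof.
move=> dgg; have h1 : is_derive c 1 (fun t : R => t - c) 1.
  have -> : (fun t : R => t - c) = (id : R -> R) - cst c by [].
  by apply: is_derive_eq; rewrite subr0.
have h2 : is_derive (c - c) 1 (fun t => g (transl t v (transl c v x))) (dg (transl c v x)).
  by rewrite subrr; exact: dgg.
have := @is_derive1_comp _ (fun t => g (transl t v (transl c v x))) (fun t => t - c) _ _ _ h2 h1.
rewrite mulr1; congr (is_derive _ _ _ _); apply/funext => t /=.
by rewrite transl_transl subrK.
Qed.

(** The intermediate point lies on the segment, so an exponential bound on the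
    derivative bounds the difference quotients. *)
Lemma dder_mvt v g dg x (c : R) : dder v g dg ->
  exists2 th, `|th| <= `|c| & g (transl c v x) - g x = dg (transl th v x) * c.
Proof.
move=> dgg; pose p t := g (transl t v x); pose dp t := dg (transl t v x).
have dpp (t : R) : is_derive t 1 p (dp t) by exact: dder_at.
have cp (a b : R) : {within `[a, b], continuous p}.
  by apply: derivable_within_continuous => z _; case: (dpp z).
have -> : g x = p 0 by rewrite /p transl0.
rewrite -/(p c).
have [c0|c0] := leP 0 c.
- have [th] := MVT_segment c0 (fun t _ => dpp t) (cp _ _).
  rewrite in_itv /= subr0 => /andP[t0 tc] ->; exists th => //.
  by rewrite !ger0_norm.
- have [th] := MVT_segment (ltW c0) (fun t _ => dpp t) (cp _ _).
  rewrite in_itv /= sub0r => /andP[t0 tc] e; exists th => //.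
    by rewrite ler0_norm// ltr0_norm// lerN2.
  by rewrite -opprB e mulrN opprK.
Qed.

Lemma is_derive_seqW (f : R -> R) (x d : R) :
  (forall u : nat -> R, (forall n, u n != 0) -> u n @[n --> \oo] --> 0 ->
    (f (x + u n) - f x) / u n @[n --> \oo] --> d) -> is_derive x 1 f d.
Proof.
move=> H.
have h : h^-1 *: ((f \o shift x) (h *: 1) - f x) @[h --> 0^'] --> d.
  apply/cvgr_dnbhsP => u [u0 uc]; have := H u u0 uc; apply: cvg_trans.
  apply: near_eq_cvg; near=> n.
  by rewrite /= /shift /= [u n *: 1]mulr1 [u n + x]addrC mulrC.
split; first by apply/cvg_ex; exists d.
by apply: cvg_lim => //; exact: h.
Unshelve. all: by end_near. Qed.

Lemma dder_gconv s w v g dg : tame1 g -> tame1 dg -> dder v g dg ->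
  dder v (gconv s w g) (gconv s w dg).
Proof.
move=> tg tdg dgg x; apply: is_derive_seqW => u u0 uc.
have E n : (gconv s w g (transl (0 + u n) v x) - gconv s w g (transl 0 v x)) / u n =
    gint (fun z => (g (transl (u n) v (transl (s * z) w x)) - g (transl (s * z) w x)) / u n).
  rewrite add0r transl0 mulrC -gintB; try exact: expb_transl.
  rewrite -gintZ; last by apply: expbB; exact: expb_transl.
  congr gint; apply/funext => z; rewrite mulrC; congr ((g _ - _) / _).
  by apply/funext => i; rewrite /transl addrAC.
rewrite (_ : (fun n => _) = (fun n => gint (fun z => (g (transl (u n) v (transl (s * z) w x)) - g (transl (s * z) w x)) / u n))); last first.
  by apply/funext => n; rewrite -E.
have [S S0 uS] := seq_bounded uc.
have [K K0 dK] := tameE tdg.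
apply: (gint_cvg (K := K * (1 + norm1 x + S * norm1 v + `|s| * norm1 w))).
- move=> n; apply: measurable_funM => //; apply: measurable_funB.
    apply: (tg.1 0%N _ RB (fun z => transl (u n) v (transl (s * z) w x))) => i.
    by apply: measurable_funD => //; apply: measurable_funD => //; apply: measurable_funM => //; exact: measurable_funM.
  by case: (expb_transl s w x tg).
- move=> n z; have [th th1 ->] := dder_mvt (transl (s * z) w x) (u n) dgg.
  rewrite mulfK ?u0// (le_trans (dK 0%N _))// ler_expR -mulrA ler_wpM2l//.
  have h1 := norm1_transl th v (transl (s * z) w x); have h2 := norm1_transl (s * z) w x.
  rewrite normrM in h2.
  have : `|th| * norm1 v <= S * norm1 v.
    by rewrite ler_wpM2r ?norm1_ge0// (le_trans th1).
  have := norm1_ge0 v; have := norm1_ge0 w; have := norm1_ge0 x; have := normr_ge0 s; have := normr_ge0 z.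
  move=> p1 p2 p3 p4 p5 p6.
  have q1 : 0 <= S * norm1 v by rewrite mulr_ge0.
  have q2 : 0 <= `|s| * norm1 w by rewrite mulr_ge0.
  nra.
- move=> z; have := is_derive_seq (dgg (transl (s * z) w x)) u0 uc.
  by rewrite transl0; under eq_cvg do rewrite add0r.
Qed.

Lemma dder_powlike h k rho v g dg : powlike h k rho -> (forall x, 0 < g x) -> dder v g dg ->
  dder v (fun x => h (g x)) (fun x => k * g x `^ (rho - 1) * dg x).
Proof.
move=> hp g0 dgg x.
have h2 : is_derive (g (transl 0 v x)) 1 h (k * g x `^ (rho - 1)) by rewrite transl0; exact: hp.2.
exact: (@is_derive1_comp _ h (fun c => g (transl c v x)) _ _ _ h2 (dgg x)).
Qed.

Lemma dder_sum (J : Type) (s : seq J) v (g dg : J -> V -> R) :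
  (forall j, dder v (g j) (dg j)) ->
  dder v (fun x => \sum_(j <- s) g j x) (fun x => \sum_(j <- s) dg j x).
Proof.
move=> h x; elim: s => [|j s IH].
  have -> : (fun c => \sum_(j <- [::]) g j (transl c v x)) = cst 0.
    by apply/funext => c; rewrite big_nil.
  by rewrite big_nil; exact: is_derive_cst.
have -> : (fun c => \sum_(j <- j :: s) g j (transl c v x)) =
  (fun c => g j (transl c v x)) + (fun c => \sum_(j <- s) g j (transl c v x)).
  by apply/funext => c; rewrite big_cons.
by rewrite big_cons; apply: is_deriveD; exact: h.
Qed.

Lemma dder_ext v g g' dg dg' : (forall x, g x = g' x) -> (forall x, dg x = dg' x) ->
  dder v g dg -> dder v g' dg'.
Proof.
by move=> gg dd; rewrite (_ : g = g') 1?(_ : dg = dg')//; apply/funext.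
Qed.

End calculus.

(** * The Jensen gap *)

Section remainder.
Context {R : realType}.
Variables (h : R -> R) (k rho : R).
Hypothesis hp : powlike h k rho.
Variables (e : nat -> R).
Hypotheses (e0 : forall n, e n != 0) (ec : e n @[n --> \oo] --> (0 : R)).

Definition taylor_rem (y y' : R) := h y' - h y - k * y `^ (rho - 1) * (y' - y).

Lemma taylor_rem_bound (y y' s : R) : 0 < y -> 0 < y' -> s != 0 ->
  `|taylor_rem y y' / s ^+ 2| <=
  `|k * (rho - 1) / 2| * (y `^ (rho - 2) + y' `^ (rho - 2)) * ((y' - y) / s) ^+ 2.
Proof.
move=> y0 y'0 s0; have [c [c0 _ cp E]] := powlike_taylor hp y0 y'0.
rewrite /taylor_rem E -mulrA -expr_div_n normrM normrM (ger0_norm (powR_ge0 _ _)).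
by rewrite [X in _ * X](ger0_norm (sqr_ge0 _)) ler_wpM2r ?sqr_ge0// ler_wpM2l.
Qed.

Lemma quot_bound (y y' s : R) : 0 < y -> 0 < y' ->
  `|(h y' - h y) / s| <=
  `|k| * (y `^ (rho - 1) + y' `^ (rho - 1)) * `|(y' - y) / s|.
Proof.
move=> y0 y'0; have [c [c0 _ cp E]] := powlike_mvt hp y0 y'0.
rewrite E -mulrA normrM normrM (ger0_norm (powR_ge0 _ _)).
by rewrite ler_wpM2r// ler_wpM2l.
Qed.

Section lim.
Variables (y y' : nat -> R) (yl D : R).
Hypotheses (y0 : forall n, 0 < y n) (y'0 : forall n, 0 < y' n) (yl0 : 0 < yl).
Hypotheses (yc : y n @[n --> \oo] --> yl) (Dc : (y' n - y n) / e n @[n --> \oo] --> D).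

Let dif0 : y' n - y n @[n --> \oo] --> 0.
Proof.
rewrite (_ : (fun n => _) = (fun n => (y' n - y n) / e n * e n)).
  by rewrite -[X in _ --> X](mulr0 D); exact: cvgM.
by apply/funext => n; rewrite divfK.
Qed.

Let mid_cvg (c : nat -> R) : (forall n, `|c n - y n| <= `|y' n - y n|) ->
  c n @[n --> \oo] --> yl.
Proof.
move=> cy; have h0 : c n - y n @[n --> \oo] --> 0.
  apply: norm_cvg0; apply: (squeeze_cvgr (f := cst 0) (h := fun n => `|y' n - y n|)).
  - by apply: nearW => n; rewrite normr_ge0 cy.
  - exact: cvg_cst.
  - by rewrite -[X in _ --> X](normr0 R); exact: cvg_norm.
rewrite (_ : (fun n => _) = (fun n => (c n - y n) + y n)).
  by rewrite -[X in _ --> X]add0r; exact: cvgD.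
by apply/funext => n; rewrite subrK.
Qed.

Lemma taylor_rem_cvg : taylor_rem (y n) (y' n) / e n ^+ 2 @[n --> \oo] -->
  k * (rho - 1) / 2 * yl `^ (rho - 2) * D ^+ 2.
Proof.
have H n := cid (powlike_taylor hp (y0 n) (y'0 n)).
pose c n := sval (H n).
have cP n : [/\ 0 < c n, `|c n - y n| <= `|y' n - y n|,
    (forall a, c n `^ a <= y n `^ a + y' n `^ a) &
    taylor_rem (y n) (y' n) = k * (rho - 1) / 2 * c n `^ (rho - 2) * (y' n - y n) ^+ 2].
  by rewrite /c; case: (H n).
rewrite (_ : (fun n => _) = (fun n => k * (rho - 1) / 2 * c n `^ (rho - 2) *
   (((y' n - y n) / e n) * ((y' n - y n) / e n)))); last first.
  by apply/funext => n; case: (cP n) => _ _ _ ->; rewrite -mulrA -expr2 expr_div_n.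
rewrite expr2; apply: cvgM; last exact: cvgM.
apply: cvgM; first exact: cvg_cst.
by apply: powR_cvg => //; apply: mid_cvg => n; case: (cP n).
Qed.

Lemma quot_cvg : (h (y' n) - h (y n)) / e n @[n --> \oo] -->
  k * yl `^ (rho - 1) * D.
Proof.
have H n := cid (powlike_mvt hp (y0 n) (y'0 n)).
pose c n := sval (H n).
have cP n : [/\ 0 < c n, `|c n - y n| <= `|y' n - y n|,
    (forall a, c n `^ a <= y n `^ a + y' n `^ a) &
    h (y' n) - h (y n) = k * c n `^ (rho - 1) * (y' n - y n)].
  by rewrite /c; case: (H n).
rewrite (_ : (fun n => _) = (fun n => k * c n `^ (rho - 1) *
   ((y' n - y n) / e n))); last first.
  by apply/funext => n; case: (cP n) => _ _ _ ->; rewrite -mulrA.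
apply: cvgM => //; apply: cvgM; first exact: cvg_cst.
by apply: powR_cvg => //; apply: mid_cvg => n; case: (cP n).
Qed.
End lim.

End remainder.

Section tame2.
Context {R : realType} {I : finType}.
Local Notation V := (I -> R).
Implicit Types (F G : nat -> V -> R) (f g : V -> R) (v w x : V).

(** Integrands that depend on the Gaussian variable z; they need a bound in x and
    z together. *)
Definition tame2 (Q : nat -> V -> R -> R) := (forall n, jmeas2 (Q n)) /\
  exists A K, forall n x z, `|Q n x z| <= A * expR (K * (1 + norm1 x + `|z|)).

Lemma tame2_le Q P : (forall n, jmeas2 (Q n)) -> tame2 P ->
  (forall n x z, `|Q n x z| <= P n x z) -> tame2 Q.
Proof.
move=> mQ [_ [A [K PK]]] QP; split => //; exists A, K => n x z.
by rewrite (le_trans (QP _ _ _))// (le_trans (ler_norm _)).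
Qed.

Lemma tame2E Q : tame2 Q -> exists A K, [/\ 0 <= A, 0 <= K &
  forall n x z, `|Q n x z| <= A * expR (K * (1 + norm1 x + `|z|))].
Proof.
move=> [_ [A [K QK]]]; exists `|A|, `|K|; split => // n x z.
rewrite (le_trans (QK _ _ _))//.
apply: (@le_trans _ _ (`|A| * expR (K * (1 + norm1 x + `|z|)))).
  by rewrite ler_wpM2r ?expR_ge0// ler_norm.
by rewrite ler_wpM2l// ler_expR ler_wpM2r ?ler_norm// !addr_ge0// norm1_ge0.
Qed.

Lemma tame2D Q P : tame2 Q -> tame2 P -> tame2 (fun n x z => Q n x z + P n x z).
Proof.
move=> tQ tP; have [A [K [A0 K0 QK]]] := tame2E tQ; have [B [L [B0 L0 PL]]] := tame2E tP.
split => [n d T f g mf mg|].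
  by apply: measurable_funD; [exact: tQ.1|exact: tP.1].
exists (A + B), (K + L) => n x z; rewrite (le_trans (ler_normD _ _))//.
have r0 : 0 <= 1 + norm1 x + `|z| by rewrite !addr_ge0// norm1_ge0.
rewrite [leRHS]mulrDl lerD//.
- by rewrite (le_trans (QK _ _ _))// ler_wpM2l// ler_expR ler_wpM2r// lerDl.
- by rewrite (le_trans (PL _ _ _))// ler_wpM2l// ler_expR ler_wpM2r// lerDr.
Qed.

Lemma tame2M Q P : tame2 Q -> tame2 P -> tame2 (fun n x z => Q n x z * P n x z).
Proof.
move=> tQ tP; have [A [K [A0 K0 QK]]] := tame2E tQ; have [B [L [B0 L0 PL]]] := tame2E tP.
split => [n d T f g mf mg|].
  by apply: measurable_funM; [exact: tQ.1|exact: tP.1].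
exists (A * B), (K + L) => n x z; rewrite normrM mulrDl expRD mulrACA.
by rewrite ler_pM.
Qed.

Lemma tame2_tame F : tame F -> tame2 (fun n x _ => F n x).
Proof.
move=> tF; have [K K0 FK] := tameE tF; split => [n d T f g mf mg|].
  exact: tF.1.
exists 1, K => n x z; rewrite mul1r (le_trans (FK n x))// ler_expR ler_wpM2l//.
by rewrite lerDl.
Qed.

Lemma tame2_id : tame2 (fun _ _ z => z).
Proof.
split => [n d T f g mf mg //|]; exists 1, 1 => n x z.
by rewrite !mul1r (le_trans (le_expR_id _))// ler_expR lerDr addr_ge0// norm1_ge0.
Qed.

Lemma tame2_transl F (s : nat -> R) (S : R) v : tame F -> (forall n, `|s n| <= S) ->
  tame2 (fun n x z => F n (transl (s n * z) v x)).
Proof.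
move=> tF sS; split; last exact: tame_transl_bound tF sS.
by move=> n; apply: jmeas2_transl; case: tF.
Qed.

Lemma ccvg_gint2 Q (q : V -> R -> R) : tame2 Q ->
  (forall u x, ptcvg u x -> forall z, Q n (u n) z @[n --> \oo] --> q x z) ->
  ccvg (fun n x => gint (Q n x)) (fun x => gint (q x)).
Proof. by move=> [mQ QK]; exact: ccvg_gint. Qed.

Lemma tame2_expb Q n x : tame2 Q -> expb (Q n x).
Proof. by move=> [mQ QK]; have [h _] := gint_tame mQ QK; exact: h. Qed.

End tame2.

Section gap.
Context {R : realType} {I : finType}.
Local Notation V := (I -> R).
Implicit Types (F G : nat -> V -> R) (f : V -> R) (v w x : V).

Variables (h : R -> R) (k rho : R).
Hypothesis hp : powlike h k rho.

(** Expand h at g(x) inside the average.  The linear term is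
    h'(g) (E g(x + e z v) - g(x)), which also is the linear term of
    h(E g(x + e z v)) - h(g(x)): they cancel exactly, so no second derivative
    of g appears.  The quadratic remainder of the first expansion gives the
    limit as E z^2 = 1, and that of the second is negligible as E z = 0. *)
Lemma jensen_gap (g dg : nat -> V -> R) (gl dgl : V -> R) v (e : nat -> R) :
  pccvg g gl -> (forall n, dder v (g n) (dg n)) -> ccvg dg dgl ->
  (forall n, e n != 0) -> e n @[n --> \oo] --> (0 : R) ->
  ccvg (fun n x => (gconv (e n) v (fun x => h (g n x)) x - h (gconv (e n) v (g n) x)) / (e n) ^+ 2)
    (fun x => k * (rho - 1) / 2 * gl x `^ (rho - 2) * dgl x ^+ 2).
Proof.
move=> pg dgE cdg e0 ec.
have [S S0 eS] := seq_bounded ec.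
have [cg cgV g0 gl0] := pg.
have tg2 := tame2_transl v cg.1 eS.
have tpow2 : tame2 (fun n x z => g n (transl (e n * z) v x) `^ (rho - 2)).
  exact: (tame2_transl v (ccvg_powR (rho - 2) pg).1 eS).
have tpow1 := tame2_tame (ccvg_powR (rho - 2) pg).1.
(* Difference quotient of g along v; it tends to z D_v g, whose mean is 0. *)
pose Dq n x z := (g n (transl (e n * z) v x) - g n x) / e n.
have mDq n : jmeas2 (Dq n).
  move=> d T f u mf mu; apply: measurable_funM => //; apply: measurable_funB.
    exact: tg2.1.
  exact: cg.1.1.
have DqE n x z : exists2 th, `|th| <= `|e n * z| & Dq n x z = dg n (transl th v x) * z.
  have [th th1 E] := dder_mvt x (e n * z) (dgE n); exists th => //.
  by rewrite /Dq E; field; exact: e0.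
have Dqc u x z : ptcvg u x -> Dq n (u n) z @[n --> \oo] --> dgl x * z.
  move=> ux; have H n := cid2 (DqE n (u n) z); pose th n := s2val (H n).
  have thP n : `|th n| <= `|e n * z| /\ Dq n (u n) z = dg n (transl (th n) v (u n)) * z.
    by rewrite /th; case: (H n).
  rewrite (_ : (fun n => _) = (fun n => dg n (transl (th n) v (u n)) * z)); last first.
    by apply/funext => n; case: (thP n).
  apply: cvgM; last exact: cvg_cst.
  apply: (cdg.2 (fun n => transl (th n) v (u n))).
  rewrite -[x](transl0 v); apply: ptcvg_transl => //.
  apply: norm_cvg0; apply: (squeeze_cvgr (f := cst 0) (h := fun n => `|e n * z|)).
  - by apply: nearW => n; rewrite normr_ge0; case: (thP n).
  - exact: cvg_cst.
  - rewrite -[X in _ --> X](normr0 R); apply: cvg_norm.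
    by rewrite -[X in _ --> X](mul0r z); apply: cvgM => //; exact: cvg_cst.
have tDq : tame2 Dq.
  have [K K0 dK] := tameE cdg.1.
  have tb : tame2 (fun (_ : nat) (x : V) z => expR (K * (1 + S * norm1 v) * (1 + norm1 x + `|z|))).
    split=> [n d T f u mf mu|].
      apply: measurableT_comp => //; apply: measurable_funM => //.
      apply: measurable_funD; last exact: measurableT_comp.
      apply: measurable_funD => //; apply: measurable_sum => i.
      exact: measurableT_comp.
    exists 1, (K * (1 + S * norm1 v)) => n x z.
    by rewrite mul1r ger0_norm ?expR_ge0.
  have tz : tame2 (fun (_ : nat) (x : V) z => `|z|).
    have [mz [A [L zL]]] := tame2_id (R := R) (I := I).
    split=> [n d T f u mf mu|]; first exact: measurableT_comp.
    by exists A, L => n x z; rewrite normr_id; exact: zL n x z.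
  apply: tame2_le mDq (tame2M tb tz) _ => n x z.
  have [th th1 ->] := DqE n x z; rewrite normrM ler_wpM2r//.
  rewrite (le_trans (dK n _))// ler_expR -mulrA ler_wpM2l//.
  have h1 := norm1_transl th v x.
  have h2 : `|th| <= S * `|z|.
    by rewrite (le_trans th1)// normrM ler_wpM2r.
  have h3 : `|th| * norm1 v <= S * `|z| * norm1 v by rewrite ler_wpM2r// norm1_ge0.
  have := norm1_ge0 v; have := norm1_ge0 x; have := normr_ge0 z => p1 p2 p3.
  have q1 : 0 <= S * norm1 v by rewrite mulr_ge0.
  nra.
have cED : ccvg (fun n x => gint (Dq n x)) (fun=> 0).
  apply: ccvg_ext (ccvg_gint2 tDq (fun u x ux z => Dqc u x z ux)) => // x.
  rewrite gintZ ?gint_id ?mulr0//.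
  exact: (tame2_expb 0 x (tame2_id (R := R) (I := I))).
have EDE n x : gint (Dq n x) = (gconv (e n) v (g n) x - g n x) / e n.
  rewrite /Dq; under [X in gint X]eq_fun do rewrite mulrC.
  rewrite gintZ; last first.
    apply: expbB; first exact: (tame2_expb n x tg2).
    exact: (tame2_expb n x (tame2_tame cg.1)).
  rewrite gintB ?gint_cst; first by rewrite mulrC.
    exact: (tame2_expb n x tg2).
  exact: (tame2_expb n x (tame2_tame cg.1)).
(* The quadratic remainder under the average. *)
pose Q n x z := taylor_rem h k rho (g n x) (g n (transl (e n * z) v x)) / e n ^+ 2.
have mh := hp.1.
have mQ n : jmeas2 (Q n).
  move=> d T f u mf mu; apply: measurable_funM => //.
  have m1 : measurable_fun setT (fun t => g n (f t)) by exact: cg.1.1.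
  have m2 : measurable_fun setT (fun t => g n (transl (e n * u t) v (f t))).
    exact: tg2.1.
  apply: measurable_funB.
    by apply: measurable_funB; exact: (measurableT_comp mh).
  apply: measurable_funM; last exact: measurable_funB.
  apply: measurable_funM => //.
  exact: (jmeas_powR (rho - 1) (cg.1.1 n)).
have tQ : tame2 Q.
  have tc := tame2_tame (tame_cst (I := I) `|k * (rho - 1) / 2|).
  apply: tame2_le mQ (tame2M (tame2M tc (tame2D tpow1 tpow2)) (tame2M tDq tDq)) _ => n x z.
  by rewrite -expr2; exact: taylor_rem_bound.
have cT1 : ccvg (fun n x => gint (Q n x))
    (fun x => k * (rho - 1) / 2 * gl x `^ (rho - 2) * dgl x ^+ 2).
  have Qc u x z : ptcvg u x -> Q n (u n) z @[n --> \oo] -->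
      k * (rho - 1) / 2 * gl x `^ (rho - 2) * (dgl x * z) ^+ 2.
    move=> ux; apply: (taylor_rem_cvg hp e0 ec) => //; first exact: cg.2.
    exact: Dqc.
  apply: ccvg_ext (ccvg_gint2 tQ (fun u x ux z => Qc u x z ux)) => // x.
  have ez2 : expb (fun z : R => z ^+ 2).
    have := tame2_expb 0 x (tame2M (tame2_id (R := R) (I := I)) (tame2_id (R := R) (I := I))).
    by under eq_fun do rewrite -expr2.
  rewrite -[RHS]mulr1 -gint_sqr -gintZ//; congr gint; apply/funext => z.
  by rewrite exprMn mulrA.
have pconv := pccvg_gconv v pg ec.
have cT2 : ccvg (fun n x => taylor_rem h k rho (g n x) (gconv (e n) v (g n) x) / e n ^+ 2) (fun=> 0).
  have cpow3 := ccvg_powR (rho - 2) pconv.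
  have tc := tame_cst (I := I) `|k * (rho - 1) / 2|.
  split.
    apply: tame_le (tameM (tameM tc (tameD (ccvg_powR (rho - 2) pg).1 cpow3.1)) (tameM cED.1 cED.1)) _ => [n|n x].
      have m1 : jmeas (g n) by exact: cg.1.1.
      have m2 : jmeas (gconv (e n) v (g n)) by exact: (pccvg_ccvg pconv).1.1.
      apply: jmeasM; last exact: jmeas_cst.
      apply: jmeasB; first by apply: jmeasB; exact: jmeas_comp.
      apply: jmeasM; last exact: jmeasB.
      by apply: jmeasM; [exact: jmeas_cst|exact: jmeas_powR].
    rewrite -expr2 EDE; apply: taylor_rem_bound => //; exact: (pccvg_gt0 pconv).
  move=> u x ux.
  rewrite (_ : 0 = k * (rho - 1) / 2 * gl x `^ (rho - 2) * 0 ^+ 2); last first.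
    by rewrite expr0n mulr0.
  apply: (taylor_rem_cvg hp e0 ec) => // [n||].
  - exact: (pccvg_gt0 pconv).
  - exact: cg.2.
  - by have := cED.2 _ _ ux; under eq_cvg do rewrite EDE.
have tgn n : tame1 (g n).
  by case: cg.1 => mF [K FK]; split => [_|]; [exact: mF|exists K].
have eh n x : expb (fun z => h (g n (transl (e n * z) v x))).
  exact: (tame2_expb n x (tame2_transl v (ccvg_powlike hp pg).1 eS)).
have ecst (c : R) : expb (fun=> c).
  exact: (tame2_expb 0 v (tame2_tame (tame_cst (I := I) c))).
apply: ccvg_ext (ccvgB cT1 cT2) => [n x|x]; last by rewrite subr0.
set c := k * g n x `^ (rho - 1).
have eg : expb (fun z => g n (transl (e n * z) v x)) by exact: (tame2_expb n x tg2).
have -> : gint (Q n x) = (gconv (e n) v (fun x => h (g n x)) x - h (g n x)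
    - c * (gconv (e n) v (g n) x - g n x)) / e n ^+ 2.
  have -> : Q n x = (fun z => (e n)^-2 * ((h (g n (transl (e n * z) v x)) - h (g n x))
      - c * (g n (transl (e n * z) v x) - g n x))).
    by apply/funext => z; rewrite /Q /taylor_rem mulrC.
  have e1 := expbB (eh n x) (ecst (h (g n x))).
  have e2 := expbB eg (ecst (g n x)).
  have e3 : expb (fun z => c * (g n (transl (e n * z) v x) - g n x)).
    exact: (tame2_expb 0%N x (tame2M (tame2_tame (tame_cst (I := I) c))
      (tame2D (tame2_transl v (F := fun=> g n) (s := fun=> e n) (S := S) (tgn n) (fun=> eS n))
              (tame2_tame (tame_cst (I := I) (- g n x)))))).
  rewrite (gintZ _ (expbB e1 e3)) (gintB e1 e3) (gintB (eh n x) (ecst _)).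
  by rewrite (gintZ _ e2) (gintB eg (ecst _)) !gint_cst mulrC.
rewrite -mulrBl; congr (_ / _); rewrite /taylor_rem -/c; ring.
Qed.

End gap.

(** * Convolution along several directions *)

Section gconvs.
Context {R : realType} {I : finType}.
Local Notation V := (I -> R).
Implicit Types (F G : nat -> V -> R) (f g : V -> R) (v w x : V).

Lemma tame_gconv f s v : tame1 f -> tame1 (gconv s v f).
Proof.
move=> tf.
have := @gint_tame _ _ (fun _ x z => f (transl (s * z) v x)) (fun=> jmeas2_transl _ _ (tf.1 0%N)).
by move=> /(_ (@tame_transl_bound _ _ (fun=> f) (fun=> s) `|s| v tf (fun=> lexx _)))[].
Qed.

Lemma gconvD f g s v x : tame1 f -> tame1 g ->
  gconv s v (fun x => f x + g x) x = gconv s v f x + gconv s v g x.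
Proof. by move=> tf tg; apply: gintD; exact: expb_transl. Qed.

Lemma gconvZ c f s v x : tame1 f ->
  gconv s v (fun x => c * f x) x = c * gconv s v f x.
Proof. by move=> tf; apply: gintZ; exact: expb_transl. Qed.

Lemma gconv_cst c s v x : gconv s v (fun=> c) x = c.
Proof. exact: gint_cst. Qed.

Lemma gconv0 v f x : gconv 0 v f x = f x.
Proof. by rewrite /gconv -[RHS]gint_cst; congr gint; apply/funext => z; rewrite mul0r transl0. Qed.

Context {E : Type} (dir : E -> V).

Definition gconvs (sg : E -> R) (s : seq E) (f : V -> R) : V -> R :=
  foldr (fun e g => gconv (sg e) (dir e) g) f s.

Lemma gconvs_cat sg s1 s2 f : gconvs sg (s1 ++ s2) f = gconvs sg s1 (gconvs sg s2 f).
Proof. by rewrite /gconvs foldr_cat. Qed.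

Lemma tame_gconvs f sg s : tame1 f -> tame1 (gconvs sg s f).
Proof. by move=> tf; elim: s => //= e s IH; exact: tame_gconv. Qed.

Lemma ccvg_gconvs F f (sg : nat -> E -> R) (sgl : E -> R) s : ccvg F f ->
  (forall e, sg n e @[n --> \oo] --> sgl e) ->
  ccvg (fun n => gconvs (sg n) s (F n)) (gconvs sgl s f).
Proof. by move=> cF sc; elim: s => //= e s IH; exact: ccvg_gconv. Qed.

Lemma pccvg_gconvs F f (sg : nat -> E -> R) (sgl : E -> R) s : pccvg F f ->
  (forall e, sg n e @[n --> \oo] --> sgl e) ->
  pccvg (fun n => gconvs (sg n) s (F n)) (gconvs sgl s f).
Proof. by move=> cF sc; elim: s => //= e s IH; exact: pccvg_gconv. Qed.

Lemma gconvsD f g sg s : tame1 f -> tame1 g ->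
  gconvs sg s (fun x => f x + g x) = (fun x => gconvs sg s f x + gconvs sg s g x).
Proof.
move=> tf tg; elim: s => //= e s ->; apply/funext => x.
by rewrite gconvD//; exact: tame_gconvs.
Qed.

Lemma gconvsZ c f sg s : tame1 f ->
  gconvs sg s (fun x => c * f x) = (fun x => c * gconvs sg s f x).
Proof.
move=> tf; elim: s => //= e s ->; apply/funext => x.
by rewrite gconvZ//; exact: tame_gconvs.
Qed.

Lemma gconvs_cst c sg s : gconvs sg s (fun=> c) = (fun=> c).
Proof. by elim: s => //= e s ->; apply/funext => x; rewrite gconv_cst. Qed.

Lemma gconvsB f g sg s : tame1 f -> tame1 g ->
  gconvs sg s (fun x => f x - g x) = (fun x => gconvs sg s f x - gconvs sg s g x).
Proof.
move=> tf tg; have tN : tame1 (fun x => -1 * g x) by exact: (tameM (tame_cst (-1)) tg).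
rewrite (_ : (fun x => f x - g x) = (fun x => f x + -1 * g x)); last first.
  by apply/funext => x; rewrite mulN1r.
by rewrite gconvsD// gconvsZ//; apply/funext => x; rewrite mulN1r.
Qed.

Lemma gconvs_quot f g sg s a x : tame1 f -> tame1 g ->
  gconvs sg s (fun y => (f y - g y) / a) x = (gconvs sg s f x - gconvs sg s g x) / a.
Proof.
move=> tf tg; rewrite (_ : (fun y => _) = (fun y => a^-1 * (f y - g y))); last first.
  by apply/funext => y; rewrite mulrC.
by rewrite (gconvsZ a^-1 sg s (tameB tf tg)) (gconvsB sg s tf tg) mulrC.
Qed.

Lemma tame_sum (J : Type) (r : seq J) (f : J -> V -> R) : (forall j, tame1 (f j)) ->
  tame1 (fun x => \sum_(j <- r) f j x).
Proof.
move=> tf; elim: r => [|j r IH].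
  by rewrite (_ : (fun x => _) = (fun=> 0)); [exact: tame_cst|apply/funext => x; rewrite big_nil].
rewrite (_ : (fun x => _) = (fun x => f j x + \sum_(j <- r) f j x)); first exact: (tameD (tf j) IH).
by apply/funext => x; rewrite big_cons.
Qed.

Lemma gconvs_sum (J : Type) (r : seq J) (f : J -> V -> R) sg s : (forall j, tame1 (f j)) ->
  gconvs sg s (fun x => \sum_(j <- r) f j x) = (fun x => \sum_(j <- r) gconvs sg s (f j) x).
Proof.
move=> tf; elim: r => [|j r IH].
  rewrite (_ : (fun x => _) = (fun=> 0)); last by apply/funext => x; rewrite big_nil.
  by rewrite gconvs_cst; apply/funext => x; rewrite big_nil.
rewrite (_ : (fun x => _) = (fun x => f j x + \sum_(j <- r) f j x)); last first.
  by apply/funext => x; rewrite big_cons.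
by rewrite gconvsD// ?IH; [apply/funext => x; rewrite big_cons|exact: tame_sum].
Qed.

Lemma gconvs_swap f a v sg s : tame1 f ->
  gconv a v (gconvs sg s f) = gconvs sg s (gconv a v f).
Proof.
move=> tf; elim: s => //= e s <-; apply/funext => x.
by rewrite gconv_swap//; exact: tame_gconvs.
Qed.

(** Convolutions commute, so any direction may be treated as the outermost one. *)
Lemma gconvs_mid f sg s1 e s2 : tame1 f ->
  gconvs sg (s1 ++ e :: s2) f = gconv (sg e) (dir e) (gconvs sg (s1 ++ s2) f).
Proof.
by move=> tf; rewrite !gconvs_cat /= -gconvs_swap//; exact: tame_gconvs.
Qed.

Lemma dder_gconvs f df v sg s : tame1 f -> tame1 df -> dder v f df ->
  dder v (gconvs sg s f) (gconvs sg s df).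
Proof.
move=> tf tdf dd; elim: s => //= e s IH.
by apply: dder_gconv => //; exact: tame_gconvs.
Qed.

End gconvs.

(** * Transfer of variance between two layers *)

Section tangent.
Context {R : realType} {I : finType}.
Local Notation V := (I -> R).
Implicit Types (F G : nat -> V -> R) (f g : V -> R) (v w x : V).

Lemma jmeas_powlike h k rho f : @powlike R h k rho -> jmeas f -> jmeas (fun x : V => h (f x)).
Proof. by move=> hp; apply: jmeas_comp; exact: hp.1. Qed.

(** The chain rule for difference quotients: the two families need not be values
    of one function at two points. *)
Lemma ccvg_tangent h k rho F F' f df (e : nat -> R) : powlike h k rho ->
  (forall n, e n != 0) -> e n @[n --> \oo] --> (0 : R) ->
  pccvg F f -> pccvg F' f -> ccvg (fun n x => (F n x - F' n x) / e n) df ->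
  ccvg (fun n x => (h (F n x) - h (F' n x)) / e n) (fun x => k * f x `^ (rho - 1) * df x).
Proof.
move=> hp e0 ec pF pF' cd.
have [t1 t2] := ((ccvg_powR (rho - 1) pF).1, (ccvg_powR (rho - 1) pF').1).
split; last first.
  move=> u x ux; apply: (quot_cvg hp e0 ec) => [n|n|||].
  - exact: (pccvg_gt0 pF').
  - exact: (pccvg_gt0 pF).
  - exact: (pccvg_lim pF).
  - exact: (pccvg_ccvg pF').2.
  - exact: cd.2.
have tabs : tame (fun n x => `|(F n x - F' n x) / e n|).
  have [md [K dK]] := cd.1; split => [n d T u mu|].
    by apply: measurableT_comp => //; exact: md.
  by exists K => n x; rewrite normr_id.
apply: tame_le (tameM (tameM (tame_cst `|k|) (tameD t2 t1)) tabs) _ => [n|n x].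
  apply: jmeasM; last exact: jmeas_cst.
  apply: jmeasB; apply: (jmeas_powlike hp).
    exact: (pccvg_ccvg pF).1.1.
  exact: (pccvg_ccvg pF').1.1.
by apply: quot_bound => //; [exact: (pccvg_gt0 pF')|exact: (pccvg_gt0 pF)].
Qed.

Section multi.
Variables (h : R -> R) (k rho p : R).
Hypothesis hp : powlike h k rho.
Variables (J : finType) (j0 : J).

(** The gap splits in two: that of h with the average taken outside the sum,
    and that of each power g_j^p, multiplied by the derivative of h. *)
Lemma multi_gap (g dg : J -> nat -> V -> R) (gl dgl : J -> V -> R) v (e : nat -> R) :
  (forall j, pccvg (g j) (gl j)) -> (forall j n, dder v (g j n) (dg j n)) ->
  (forall j, ccvg (dg j) (dgl j)) ->
  (forall n, e n != 0) -> e n @[n --> \oo] --> (0 : R) ->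
  ccvg (fun n x => (gconv (e n) v (fun x => h (\sum_j g j n x `^ p)) x
                - h (\sum_j gconv (e n) v (g j n) x `^ p)) / (e n) ^+ 2)
    (fun x => k * (rho - 1) / 2 * (\sum_j gl j x `^ p) `^ (rho - 2) *
                (\sum_j p * gl j x `^ (p - 1) * dgl j x) ^+ 2
            + k * (\sum_j gl j x `^ p) `^ (rho - 1) *
                \sum_j (p * (p - 1) / 2 * gl j x `^ (p - 2) * dgl j x ^+ 2)).
Proof.
move=> pg dg_ cdg e0 ec.
have pgp j := pccvg_powR p (pg j).
have pS := pccvg_sum j0 pgp.
have dS n : dder v (fun x => \sum_j g j n x `^ p) (fun x => \sum_j p * g j n x `^ (p - 1) * dg j n x).
  by apply: dder_sum => j; apply: dder_powlike (powlike_powR p) _ (dg_ j n) => x; exact: (pccvg_gt0 (pg j)).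
have cdS : ccvg (fun n x => \sum_j p * g j n x `^ (p - 1) * dg j n x)
    (fun x => \sum_j p * gl j x `^ (p - 1) * dgl j x).
  apply: ccvg_sum => j; apply: ccvgM => //; apply: ccvgZ; exact: ccvg_powR.
have G1 := jensen_gap hp pS dS cdS e0 ec.
have G2 j := jensen_gap (powlike_powR p) (pg j) (dg_ j) (cdg j) e0 ec.
have e20 n : e n ^+ 2 != 0 by rewrite expf_neq0.
have e2c : e n ^+ 2 @[n --> \oo] --> (0 : R).
  rewrite -[X in _ --> X](mulr0 0).
  rewrite (_ : (fun n => _) = (fun n => e n * e n)); last by apply/funext => n; rewrite expr2.
  exact: cvgM.
have pF := pccvg_gconv v pS ec.
have pF' : pccvg (fun n x => \sum_j gconv (e n) v (g j n) x `^ p)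
    (gconv 0 v (fun x => \sum_j gl j x `^ p)).
  apply: pccvg_ext (pccvg_sum j0 (fun j => pccvg_powR p (pccvg_gconv v (pg j) ec))) => // x.
  by rewrite gconv0; apply: eq_bigr => j _; rewrite gconv0.
have cd : ccvg (fun n x => (gconv (e n) v (fun x => \sum_j g j n x `^ p) x -
     \sum_j gconv (e n) v (g j n) x `^ p) / e n ^+ 2)
   (fun x => \sum_j (p * (p - 1) / 2 * gl j x `^ (p - 2) * dgl j x ^+ 2)).
  apply: ccvg_ext (ccvg_sum (index_enum J) G2) => [n x|x]//.
  rewrite -mulr_suml sumrB; congr ((_ - _) / _).
  have := @gconvs_sum _ _ unit (fun=> v) J (index_enum J) (fun j x => g j n x `^ p) (fun=> e n) [:: tt].
  rewrite /= => -> // j; exact: tame_at (pccvg_ccvg (pgp j)).1.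
have G3 := ccvg_tangent hp e20 e2c pF pF' cd.
apply: ccvg_ext (ccvgD G1 G3) => [n x|x]; last by rewrite gconv0.
by rewrite -mulrDl addrA subrK.
Qed.

End multi.
End tangent.

Section variance_transfer.
Context {R : realType} {I : finType}.
Local Notation V := (I -> R).
Implicit Types (v w x : V).
Context {E : Type} (dir : E -> V).
Local Notation gconvs := (gconvs dir).

Variables (h : R -> R) (k rho p : R).
Hypothesis hp : powlike h k rho.
Variables (J : finType) (j0 : J).

Definition psum (g : J -> V -> R) (x : V) : R := h (\sum_j g j x `^ p).

(** The limit in multi_gap: half the second derivative of h(sum_j g_j^p) along a
    direction, without the terms that contain second derivatives of the g_j. *)
Definition gap_lim (g dg : J -> V -> R) (x : V) : R :=
  k * (rho - 1) / 2 * (\sum_j g j x `^ p) `^ (rho - 2) *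
    (\sum_j p * g j x `^ (p - 1) * dg j x) ^+ 2
  + k * (\sum_j g j x `^ p) `^ (rho - 1) *
    \sum_j (p * (p - 1) / 2 * g j x `^ (p - 2) * dg j x ^+ 2).

Lemma ccvg_psum (g : J -> nat -> V -> R) (gl : J -> V -> R) :
  (forall j, pccvg (g j) (gl j)) -> ccvg (fun n => psum (g ^~ n)) (psum gl).
Proof.
by move=> pg; apply: (ccvg_powlike hp); apply: pccvg_sum => // j; exact: pccvg_powR.
Qed.

Lemma ccvg_gap_lim (g dg : J -> V -> R) :
  (forall j, pcont (g j)) -> (forall j, ccont (dg j)) ->
  ccont (gap_lim g dg).
Proof.
move=> pg cdg; have pS := pccvg_sum j0 (fun j => pccvg_powR p (pg j)).
have cd : ccvg (fun (_ : nat) x => \sum_j p * g j x `^ (p - 1) * dg j x)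
   (fun x => \sum_j p * g j x `^ (p - 1) * dg j x).
  apply: (@ccvg_sum _ _ J _ (fun j _ x => p * g j x `^ (p - 1) * dg j x)) => j.
  by apply: ccvgM => //; apply: ccvgZ; exact: ccvg_powR.
have cd2 : ccvg (fun (_ : nat) x => \sum_j (p * (p - 1) / 2 * g j x `^ (p - 2) * dg j x ^+ 2))
   (fun x => \sum_j (p * (p - 1) / 2 * g j x `^ (p - 2) * dg j x ^+ 2)).
  apply: (@ccvg_sum _ _ J _ (fun j _ x => p * (p - 1) / 2 * g j x `^ (p - 2) * dg j x ^+ 2)) => j.
  by apply: ccvgM; [apply: ccvgZ; exact: ccvg_powR|exact: ccvgM].
apply: ccvgD; apply: ccvgM => //; try by apply: ccvgZ; exact: ccvg_powR.
exact: ccvgM.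
Qed.

Variables (d : E -> R) (delta : nat -> R).
Hypotheses (d0 : forall e, 0 <= d e) (delta0 : forall n, 0 < delta n).
Hypothesis deltac : delta n @[n --> \oo] --> (0 : R).
Variables (sg sg' ta ta' : nat -> E -> R) (sgl tal : E -> R).
Hypotheses (sg0 : forall n e, 0 <= sg n e) (sg'0 : forall n e, 0 <= sg' n e).
Hypotheses (ta0 : forall n e, 0 <= ta n e) (ta'0 : forall n e, 0 <= ta' n e).
Hypothesis sgE : forall n e, sg' n e ^+ 2 = sg n e ^+ 2 + d e * delta n.
Hypothesis taE : forall n e, ta n e ^+ 2 = ta' n e ^+ 2 + d e * delta n.
Hypotheses (sgc : forall e, sg n e @[n --> \oo] --> sgl e)
  (sg'c : forall e, sg' n e @[n --> \oo] --> sgl e)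
  (tac : forall e, ta n e @[n --> \oo] --> tal e)
  (ta'c : forall e, ta' n e @[n --> \oo] --> tal e).
Variables (f : J -> V -> R) (df : E -> J -> V -> R).
Hypotheses (pf : forall j, pcont (f j))
  (cdf : forall e j, ccont (df e j))
  (fdf : forall e j, dder (dir e) (f j) (df e j)).

(* In the directions s1 the variance has been transferred to the outer layer;
   in the directions s2 it still belongs to the inner one.  The transfer is the
   sum of its effects in one direction at a time. *)
Let base n (s1 s2 : seq E) j := gconvs (sg n) s1 (gconvs (sg' n) s2 (f j)).
Let outer n (s1 s2 : seq E) (G : V -> R) := gconvs (ta n) s1 (gconvs (ta' n) s2 G).
Let K n s1 s2 := outer n s1 s2 (psum (base n s1 s2)).

Let gl s j := gconvs sgl s (f j).
Let dgl s e j := gconvs sgl s (df e j).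

Let tf j : tame1 (f j). Proof. exact: (pccvg_ccvg (pf j)).1. Qed.
Let tdf e j : tame1 (df e j). Proof. by case: (cdf e j). Qed.

Let pbase s1 s2 j : pccvg (fun n => base n s1 s2 j) (gl (s1 ++ s2) j).
Proof. by rewrite /gl gconvs_cat; apply: pccvg_gconvs => //; exact: pccvg_gconvs. Qed.

Let outer_swap n s1 s2 a v G : tame1 G ->
  gconv a v (outer n s1 s2 G) = outer n s1 s2 (gconv a v G).
Proof. by move=> tG; rewrite /outer !gconvs_swap//; exact: tame_gconvs. Qed.

(* Both configurations are written over the same inner functions g and under the
   same outer convolutions; they differ by the order of h and of one convolution
   of variance d_e delta. *)
Let gap_step n e (s1 s2 : seq E) (eps := Num.sqrt (d e * delta n))
   (g := fun j => gconv (sg n e) (dir e) (base n s1 s2 j)) :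
  K n (rcons s1 e) s2 = gconv (ta' n e) (dir e) (outer n s1 s2
     (gconv eps (dir e) (psum g))) /\
  K n s1 (e :: s2) = gconv (ta' n e) (dir e) (outer n s1 s2
     (psum (fun j => gconv eps (dir e) (g j)))).
Proof.
have eps0 : 0 <= eps by exact: sqrtr_ge0.
have eps2 : eps ^+ 2 = d e * delta n by rewrite sqr_sqrtr// mulr_ge0// ltW.
have pb j : pccvg (fun n => base n s1 s2 j) (gl (s1 ++ s2) j) by exact: pbase.
have pg j : pcont (g j).
  apply: pccvg_gconv => //; last exact: cvg_cst.
  apply: pccvg_gconvs => [|e']; last exact: cvg_cst.
  by apply: pccvg_gconvs => // e'; exact: cvg_cst.
have pb' j : pcont (base n s1 s2 j).
  apply: pccvg_gconvs => [|e']; last exact: cvg_cst.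
  by apply: pccvg_gconvs => // e'; exact: cvg_cst.
have tb j : tame1 (base n s1 s2 j) := (pccvg_ccvg (pb' j)).1.
have chg : ccont (psum g) by apply: (ccvg_psum (g := fun j _ => g j)).
have pge j : pcont (gconv eps (dir e) (g j)).
  by apply: pccvg_gconv => //; exact: cvg_cst.
have chge : ccont (psum (fun j => gconv eps (dir e) (g j))).
  by apply: (ccvg_psum (g := fun j _ => gconv eps (dir e) (g j))).
have tsg' j : tame1 (gconvs (sg' n) s2 (f j)) by exact: tame_gconvs.
split.
- have -> : K n (rcons s1 e) s2 = outer n (rcons s1 e) s2 (psum g).
    rewrite /K; congr (outer _ _ _ (psum _)); apply/funext => j.
    rewrite /base -cats1 gconvs_cat /= /g /base [RHS]gconvs_swap//.
  rewrite [RHS](outer_swap n s1 s2 (ta' n e) (dir e) (tame_gconv eps (dir e) chg.1)).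
  rewrite /outer -cats1 gconvs_cat /= gconvs_swap; last exact: chg.1.
  congr (gconvs _ _ (gconvs _ _ _)); apply/funext => x.
  rewrite (@gconv_semigroup _ _ _ eps (ta' n e) (ta n e))//.
  by rewrite eps2 addrC taE.
- have -> : K n s1 (e :: s2) = outer n s1 (e :: s2) (psum (fun j => gconv eps (dir e) (g j))).
    rewrite /K; congr (outer _ _ _ (psum _)); apply/funext => j.
    rewrite /base /= -gconvs_swap; last exact: tsg'.
    apply/funext => x; rewrite -(@gconv_semigroup _ _ _ (sg n e) eps (sg' n e))//.
      exact: (pccvg_ccvg (pb' j)).
    by rewrite eps2 sgE.
  by rewrite /outer /= [RHS]gconvs_swap//; exact: tame_gconvs chge.1.
Qed.

Lemma gap_step_ccvg s1 e s2 :
  ccvg (fun n x => (K n (rcons s1 e) s2 x - K n s1 (e :: s2) x) / delta n)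
     (gconvs tal (s1 ++ e :: s2)
        (fun x => d e * gap_lim (gl (s1 ++ e :: s2)) (dgl (s1 ++ e :: s2) e) x)).
Proof.
pose g n j := gconv (sg n e) (dir e) (base n s1 s2 j).
pose dg n j := gconv (sg n e) (dir e) (gconvs (sg n) s1 (gconvs (sg' n) s2 (df e j))).
pose eps n := Num.sqrt (d e * delta n).
have pg j : pccvg (fun n => g n j) (gl (s1 ++ e :: s2) j).
  by rewrite /gl gconvs_mid//; apply: pccvg_gconv => //; exact: pbase.
have cdg j : ccvg (fun n => dg n j) (dgl (s1 ++ e :: s2) e j).
  rewrite /dgl gconvs_mid// gconvs_cat; apply: ccvg_gconv => //.
  by apply: ccvg_gconvs => //; exact: ccvg_gconvs.
have dg_ j n : dder (dir e) (g n j) (dg n j).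
  apply: dder_gconv; try by do 2 apply: tame_gconvs.
  by do 2 (apply: dder_gconvs; try by do ?apply: tame_gconvs).
have ceps : eps n @[n --> \oo] --> (0 : R).
  rewrite -[X in _ --> X](@sqrtr0 R); apply: continuous_cvg; first exact: sqrt_continuous.
  by rewrite -[X in _ --> X](mulr0 (d e)); apply: cvgM => //; exact: cvg_cst.
have inner : ccvg (fun n x => (gconv (eps n) (dir e) (psum (g n)) x
      - psum (fun j => gconv (eps n) (dir e) (g n j)) x) / delta n)
    (fun x => d e * gap_lim (gl (s1 ++ e :: s2)) (dgl (s1 ++ e :: s2) e) x).
  (* multi_gap divides by eps^2 = d_e delta; if d_e = 0, nothing moves. *)
  have [de0|de0] := eqVneq (d e) 0.
    apply: ccvg_ext (ccvg_cst 0) => [n x|x]; last by rewrite de0 mul0r.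
    rewrite /eps de0 mul0r sqrtr0 gconv0 /psum.
    by under [in X in _ - X]eq_bigr do rewrite gconv0; rewrite subrr mul0r.
  have dd n : 0 < d e * delta n by rewrite mulr_gt0// lt_def de0 d0.
  have en0 n : eps n != 0 by rewrite gt_eqF// sqrtr_gt0.
  apply: ccvg_ext (ccvgZ (d e) (multi_gap p hp j0 pg dg_ cdg en0 ceps)) => [n x|x]//.
  rewrite /eps sqr_sqrtr ?ltW// /psum; field.
  by rewrite de0 gt_eqF.
have pge j : pccvg (fun n => gconv (eps n) (dir e) (g n j)) (gconv 0 (dir e) (gl (s1 ++ e :: s2) j)).
  exact: pccvg_gconv.
have c1 : ccvg (fun n => gconv (eps n) (dir e) (psum (g n))) (gconv 0 (dir e) (psum (gl (s1 ++ e :: s2)))).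
  by apply: ccvg_gconv => //; exact: (ccvg_psum (g := fun j n => g n j)).
have c2 : ccvg (fun n => psum (fun j => gconv (eps n) (dir e) (g n j)))
   (psum (fun j => gconv 0 (dir e) (gl (s1 ++ e :: s2) j))).
  exact: (ccvg_psum (g := fun j n => gconv (eps n) (dir e) (g n j))).
rewrite gconvs_mid; last exact: ccvg_lim_tame inner.
rewrite gconvs_cat.
have := ccvg_gconv (dir e) (ccvg_gconvs dir s1 (ccvg_gconvs dir s2 inner ta'c) tac) (@ta'c e).
apply: ccvg_ext => // n x.
have [-> ->] := gap_step n e s1 s2; rewrite -/(g n) -/(eps n).
have t1 := tame_at n c1.1; have t2 := tame_at n c2.1.
have tB : tame1 (fun x => gconv (eps n) (dir e) (psum (g n)) x - psum (fun j => gconv (eps n) (dir e) (g n j)) x).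
  exact: tame_at n (ccvgB c1 c2).1.
rewrite (_ : (fun x => _ / delta n) = (fun x => (delta n)^-1 * (gconv (eps n) (dir e) (psum (g n)) x
      - psum (fun j => gconv (eps n) (dir e) (g n j)) x))); last first.
  by apply/funext => y; rewrite mulrC.
rewrite !gconvsZ//; last exact: tame_gconvs.
rewrite gconvZ; last by do 2 apply: tame_gconvs.
rewrite mulrC; congr (_ / _); rewrite /outer.
rewrite !gconvsB//; try exact: tame_gconvs.
by rewrite -gintB//; apply: expb_transl; do 2 apply: tame_gconvs.
Qed.

Lemma variance_transfer_aux s2 : forall s1,
  ccvg (fun n x => (K n (s1 ++ s2) [::] x - K n s1 s2 x) / delta n)
     (gconvs tal (s1 ++ s2) (fun x => \sum_(e <- s2) d e * gap_lim (gl (s1 ++ s2)) (dgl (s1 ++ s2) e) x)).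
Proof.
elim: s2 => [|e s2 IH] s1.
  rewrite cats0; apply: ccvg_ext (ccvg_cst 0) => [n x|x]; first by rewrite subrr mul0r.
  rewrite (_ : (fun x => _) = (fun=> 0)) ?gconvs_cst//.
  by apply/funext => y; rewrite big_nil.
have := ccvgD (IH (rcons s1 e)) (gap_step_ccvg s1 e s2).
rewrite cat_rcons; apply: ccvg_ext => [n x|x].
  by rewrite -mulrDl addrA subrK.
have tG e' : tame1 (fun x => d e' * gap_lim (gl (s1 ++ e :: s2)) (dgl (s1 ++ e :: s2) e') x).
  apply: tameM; first exact: tame_cst.
  have cs (j : J) : pcont (gl (s1 ++ e :: s2) j).
    by apply: pccvg_gconvs => // e2; exact: cvg_cst.
  have cds (j : J) : ccont (dgl (s1 ++ e :: s2) e' j).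
    by apply: ccvg_gconvs => // e2; exact: cvg_cst.
  by case: (ccvg_gap_lim cs cds).
have tS := @tame_sum _ _ E s2 (fun e' x => d e' * gap_lim (gl (s1 ++ e :: s2)) (dgl (s1 ++ e :: s2) e') x) tG.
have eD := @gconvsD _ _ _ dir _ _ tal (s1 ++ e :: s2) (tG e) tS.
have eF : (fun x => \sum_(e' <- e :: s2) d e' * gap_lim (gl (s1 ++ e :: s2)) (dgl (s1 ++ e :: s2) e') x) =
   (fun x => d e * gap_lim (gl (s1 ++ e :: s2)) (dgl (s1 ++ e :: s2) e) x +
      \sum_(e' <- s2) d e' * gap_lim (gl (s1 ++ e :: s2)) (dgl (s1 ++ e :: s2) e') x).
  by apply/funext => y; rewrite big_cons.
by rewrite eF eD addrC.
Qed.

(** The two terms compared are the configurations in which all, respectively none,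
    of the variance d_e delta has moved from the inner layer (sg' to sg) to the
    outer one (ta' to ta). *)
Lemma variance_transfer s :
  ccvg (fun n x => (gconvs (ta n) s (psum (fun j => gconvs (sg n) s (f j))) x
              - gconvs (ta' n) s (psum (fun j => gconvs (sg' n) s (f j))) x) / delta n)
     (gconvs tal s (fun x => \sum_(e <- s) d e * gap_lim (gl s) (dgl s e) x)).
Proof.
have := variance_transfer_aux s [::]; rewrite /=; apply: ccvg_ext => // n x.
Qed.

End variance_transfer.

(** * The nested averages as functionals of the field *)

Section nested.
Context {R : realType} {I J : finType} (j0 : J) {E : Type}.
Local Notation V := (I -> R).
Implicit Types (v w x : V).
Variables (dir : E -> V) (s : seq E).
Variables (Z : J -> V -> R) (ga : J -> I -> V -> R) (c p : R) (m : nat -> R).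

(** From here on, the suffix V marks the counterparts, on the space of fields,
    of the quantities of the model; k layers have been integrated out of zetaV k,
    and Z and ga stand for the partition functions and their Gibbs weights. *)
Definition ezV (sg : nat -> E -> R) (j : J) : V -> R :=
  gconvs dir (sg 1%N) s (fun x => Z j x `^ m 1%N).

Fixpoint zetaV (sg : nat -> E -> R) (k : nat) : V -> R :=
  match k with
  | 0%N => fun=> 0
  | 1%N => fun x => \sum_j ezV sg j x `^ p
  | k'.+1 => gconvs dir (sg k) s (fun x => zetaV sg k' x `^ (m k / m k'))
  end.

Definition phi1V sg j (F : V -> R) (x : V) : R :=
  gconvs dir (sg 1%N) s (fun y => Z j y `^ m 1%N * F y) x / ezV sg j x.

Definition phiV sg k (F : V -> R) (x : V) : R :=
  gconvs dir (sg k) s (fun y => zetaV sg k.-1 y `^ (m k / m k.-1) * F y) x / zetaV sg k x.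

Definition phisV sg b a (F : V -> R) : V -> R :=
  foldl (fun H k => phiV sg k H) F (index_iota a b.+1).

Definition g00V sg j x := ezV sg j x `^ p / \sum_j ezV sg j x `^ p.
Definition g1V sg j i x := g00V sg j x * phi1V sg j (ga j i) x.

Lemma zetaVS sg k : (0 < k)%N ->
  zetaV sg k.+1 = gconvs dir (sg k.+1) s (fun x => zetaV sg k x `^ (m k.+1 / m k)).
Proof. by case: k. Qed.

Lemma phisV_nil sg b a F : (b < a)%N -> phisV sg b a F = F.
Proof. by move=> ba; rewrite /phisV /index_iota (eqP (_ : b.+1 - a == 0)%N). Qed.

Lemma phisVS sg b a F : (a <= b.+1)%N -> phisV sg b.+1 a F = phiV sg b.+1 (phisV sg b a F).
Proof.
move=> ab; rewrite /phisV /index_iota subSn// -addn1 iotaD foldl_cat /=.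
by rewrite subnKC.
Qed.

Lemma zetaV_ext (sg sg' : nat -> E -> R) k :
  (forall j, (0 < j <= k)%N -> sg j = sg' j) -> zetaV sg k = zetaV sg' k.
Proof.
case: k => // k; elim: k => [|k IH] H.
  by rewrite /= /ezV (H 1%N).
have e : zetaV sg k.+1 = zetaV sg' k.+1.
  by apply: IH => j /andP[j1 jk]; apply: H; rewrite j1 ltnW.
have sk : sg k.+2 = sg' k.+2 by apply: H; rewrite ltnSn.
rewrite -/(zetaV sg k.+2).
change (gconvs dir (sg k.+2) s (fun x => zetaV sg k.+1 x `^ (m k.+2 / m k.+1)) =
  gconvs dir (sg' k.+2) s (fun x => zetaV sg' k.+1 x `^ (m k.+2 / m k.+1))).
by rewrite e sk.
Qed.

Lemma phiVS sg k F x : phiV sg k.+1 F x =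
  gconvs dir (sg k.+1) s (fun y => zetaV sg k y `^ (m k.+1 / m k) * F y) x / zetaV sg k.+1 x.
Proof. by []. Qed.

Lemma phi1VE sg j F x : phi1V sg j F x =
  gconvs dir (sg 1%N) s (fun y => Z j y `^ m 1%N * F y) x / ezV sg j x.
Proof. by []. Qed.

Lemma g00VE sg j x : g00V sg j x = ezV sg j x `^ p / zetaV sg 1 x.
Proof. by []. Qed.

Hypothesis pZ : forall j, pcont (Z j).
Hypothesis cga : forall j i, ccont (ga j i).
Hypothesis dZ : forall v j,
  dder v (Z j) (fun x => c * Z j x * \sum_i ga j i x * v i).

Section seqs.
Variables (sg : nat -> nat -> E -> R) (sgl : nat -> E -> R).
Hypothesis sgc : forall k e, sg n k e @[n --> \oo] --> sgl k e.

Lemma pccvg_ezV j : pccvg (fun n => ezV (sg n) j) (ezV sgl j).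
Proof. by apply: pccvg_gconvs => //; exact: pccvg_powR (pZ j). Qed.

Lemma pccvg_zetaV k : (0 < k)%N -> pccvg (fun n => zetaV (sg n) k) (zetaV sgl k).
Proof.
case: k => // k _; elim: k => [|k IH].
  by apply: pccvg_sum => // j; apply: pccvg_powR; exact: pccvg_ezV.
by rewrite zetaVS//; under eq_fun do rewrite zetaVS//; apply: pccvg_gconvs => //; exact: pccvg_powR.
Qed.
End seqs.

Section fixed.
Variable sg : nat -> E -> R.

Lemma pccvg_ezV_cst j : pcont (ezV sg j).
Proof. by apply: (pccvg_ezV (sg := fun=> sg)) => k e; exact: cvg_cst. Qed.

Lemma pccvg_zetaV_cst k : (0 < k)%N -> pcont (zetaV sg k).
Proof. by apply: (pccvg_zetaV (sg := fun=> sg)) => k' e; exact: cvg_cst. Qed.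

Lemma ccvg_convs_cst k F : ccont F -> ccont (gconvs dir (sg k) s F).
Proof. by move=> cF; apply: ccvg_gconvs => // e; exact: cvg_cst. Qed.

Lemma ccvg_phi1V j F : ccont F -> ccont (phi1V sg j F).
Proof.
move=> cF; apply: (ccvgM (F := fun=> _) (G := fun=> fun x => (ezV sg j x)^-1)).
  apply: ccvg_convs_cst; apply: (ccvgM (F := fun=> _) (G := fun=> _)) => //.
  exact: ccvg_powR (pZ j).
exact: pccvg_inv (pccvg_ezV_cst j).
Qed.

Lemma ccvg_phiV k F : (1 < k)%N -> ccont F -> ccont (phiV sg k F).
Proof.
case: k => [//|[//|k]] _ cF.
apply: (ccvgM (F := fun=> _) (G := fun=> fun x => (zetaV sg k.+2 x)^-1)).
  apply: ccvg_convs_cst; apply: (ccvgM (F := fun=> _) (G := fun=> _)) => //.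
  exact: (ccvg_powR _ (pccvg_zetaV_cst (k := k.+1) isT)).
exact: (pccvg_inv (pccvg_zetaV_cst (k := k.+2) isT)).
Qed.

Lemma ccvg_phisV b a F : (1 < a)%N -> ccont F -> ccont (phisV sg b a F).
Proof.
move=> a1 cF; elim: b => [|b IH]; first by rewrite phisV_nil// ltnW.
have [ab|ab] := leqP a b.+1; last by rewrite phisV_nil.
by rewrite phisVS//; apply: ccvg_phiV => //; apply: leq_trans ab.
Qed.

Lemma ccvg_g00V j : ccont (g00V sg j).
Proof.
apply: (ccvgM (F := fun=> fun x => ezV sg j x `^ p) (G := fun=> fun x => (zetaV sg 1 x)^-1)).
  exact: ccvg_powR (pccvg_ezV_cst j).
exact: (pccvg_inv (pccvg_zetaV_cst (k := 1) isT)).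
Qed.

Lemma ccvg_g1V j i : ccont (g1V sg j i).
Proof.
apply: (ccvgM (F := fun=> _) (G := fun=> _)); first exact: ccvg_g00V.
exact: ccvg_phi1V.
Qed.

Lemma phiVZ k a F : (1 < k)%N -> ccont F ->
  phiV sg k (fun x => a * F x) = (fun x => a * phiV sg k F x).
Proof.
case: k => [//|[//|k]] _ cF; apply/funext => x; rewrite /phiV /= mulrA.
congr (_ / _).
have tF : tame1 (fun y => zetaV sg k.+1 y `^ (m k.+2 / m k.+1) * F y).
  by apply: (tameM (F := fun=> _) (G := fun=> _)); [exact: (ccvg_powR _ (pccvg_zetaV_cst (k := k.+1) isT)).1|case: cF].
have := congr1 (@^~ x) (gconvsZ dir a (sg k.+2) s tF); rewrite /= => <-.
by congr (gconvs _ _ _ _ _); apply/funext => y; rewrite mulrCA.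
Qed.

Lemma phiV_sum (K : Type) (r : seq K) k (F : K -> V -> R) : (1 < k)%N ->
  (forall j, ccont (F j)) ->
  phiV sg k (fun x => \sum_(j <- r) F j x) = (fun x => \sum_(j <- r) phiV sg k (F j) x).
Proof.
case: k => [//|[//|k]] _ cF; apply/funext => x; rewrite /phiV /= -mulr_suml.
congr (_ / _).
have tF j : tame1 (fun y => zetaV sg k.+1 y `^ (m k.+2 / m k.+1) * F j y).
  by apply: (tameM (F := fun=> _) (G := fun=> _)); [exact: (ccvg_powR _ (pccvg_zetaV_cst (k := k.+1) isT)).1|case: (cF j)].
have := congr1 (@^~ x) (gconvs_sum dir r (sg k.+2) s tF); rewrite /= => <-.
by congr (gconvs _ _ _ _ _); apply/funext => y; rewrite mulr_sumr.
Qed.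

Lemma phisVZ b a d F : (1 < a)%N -> ccont F ->
  phisV sg b a (fun x => d * F x) = (fun x => d * phisV sg b a F x).
Proof.
move=> a1 cF; elim: b => [|b IH].
  by rewrite (phisV_nil sg _ (ltnW a1)) (phisV_nil sg F (ltnW a1)).
have [ab|ab] := leqP a b.+1; last by rewrite (phisV_nil sg _ ab) (phisV_nil sg F ab).
rewrite (phisVS sg _ ab) (phisVS sg F ab) IH phiVZ//; first exact: leq_trans ab.
exact: ccvg_phisV.
Qed.

Lemma phisV_sum (K : Type) (r : seq K) b a (F : K -> V -> R) : (1 < a)%N ->
  (forall j, ccont (F j)) ->
  phisV sg b a (fun x => \sum_(j <- r) F j x) = (fun x => \sum_(j <- r) phisV sg b a (F j) x).
Proof.
move=> a1 cF; elim: b => [|b IH].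
  rewrite (phisV_nil sg _ (ltnW a1)); apply/funext => x; apply: eq_bigr => j _.
  by rewrite (phisV_nil sg _ (ltnW a1)).
have [ab|ab] := leqP a b.+1; last first.
  rewrite (phisV_nil sg _ ab); apply/funext => x; apply: eq_bigr => j _.
  by rewrite (phisV_nil sg _ ab).
rewrite (phisVS sg _ ab) IH phiV_sum; last by move=> j; exact: ccvg_phisV.
  by apply/funext => x; apply: eq_bigr => j _; rewrite (phisVS sg _ ab).
exact: leq_trans ab.
Qed.

(** The marginal weight of the pair i at level k, the third index being summed. *)
Definition wV k i : V -> R := phisV sg k 2 (fun x => \sum_j g1V sg j i x).

Lemma wV1 i x : wV 1 i x = \sum_j g1V sg j i x.
Proof. by rewrite /wV phisV_nil. Qed.

Lemma ccvg_wV k i : ccont (wV k i).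
Proof.
apply: ccvg_phisV => //; apply: (@ccvg_sum _ _ J _ (fun j _ => g1V sg j i)) => j.
exact: ccvg_g1V.
Qed.

Lemma wVS k i : (0 < k)%N -> wV k.+1 i = phiV sg k.+1 (wV k i).
Proof. by move=> k0; rewrite /wV phisVS. Qed.

(** Moves the average past the finite pairing of weights with a direction. *)
Lemma gconvs_weight k (W : V -> R) (G : I -> V -> R) (a : R) v :
  pcont W -> (forall i, ccont (G i)) ->
  gconvs dir (sg k) s (fun x => a * (W x * \sum_i G i x * v i)) =
  (fun x => a * \sum_i gconvs dir (sg k) s (fun y => W y * G i y) x * v i).
Proof.
move=> pW cG.
have tWG i : tame1 (fun y => W y * G i y).
  by apply: (tameM (F := fun=> _) (G := fun=> _)); [exact: (pccvg_ccvg pW).1|case: (cG i)].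
have tv i : tame1 (fun y => v i * (W y * G i y)).
  by apply: (tameM (F := fun=> _) (G := fun=> _)); [exact: tame_cst|].
have tS := @tame_sum _ _ I (index_enum I) (fun i y => v i * (W y * G i y)) tv.
have e1 : (fun x => a * (W x * \sum_i G i x * v i)) = (fun x => a * \sum_i v i * (W x * G i x)).
  apply/funext => x; rewrite mulr_sumr; congr (_ * _); apply: eq_bigr => i _.
  by rewrite mulrA mulrC.
rewrite e1 (gconvsZ dir a (sg k) s tS) (gconvs_sum dir (index_enum I) (sg k) s tv).
apply/funext => x; congr (_ * _); apply: eq_bigr => i _.
by rewrite (gconvsZ dir (v i) (sg k) s (tWG i)) mulrC.
Qed.

Lemma dder_Zm v j :
  dder v (fun x => Z j x `^ m 1%N)
    (fun x => m 1%N * c * (Z j x `^ m 1%N * \sum_i ga j i x * v i)).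
Proof.
have Z0 := pccvg_lim (pZ j).
apply: dder_ext (dder_powlike (powlike_powR (m 1%N)) Z0 (dZ v j)) => // x.
have -> : Z j x `^ m 1%N = Z j x `^ (m 1%N - 1) * Z j x.
  by rewrite powR_pred.
ring.
Qed.

Let cZ j : ccont (fun x => Z j x `^ m 1%N) := ccvg_powR _ (pZ j).

Lemma ccvg_pairing (F : I -> V -> R) v : (forall i, ccont (F i)) ->
  ccont (fun x => \sum_i F i x * v i).
Proof.
move=> cF; apply: (@ccvg_sum _ _ I _ (fun i _ x => F i x * v i)) => i.
by apply: (ccvgM (F := fun=> _) (G := fun=> fun=> _)) => //; exact: ccvg_cst.
Qed.

Lemma ccvg_dZm v j : ccont (fun x => m 1%N * c * (Z j x `^ m 1%N * \sum_i ga j i x * v i)).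
Proof.
apply: (@ccvgZ _ _ _ (fun=> _)); apply: (ccvgM (F := fun=> _) (G := fun=> _)); first exact: cZ.
exact: ccvg_pairing.
Qed.

Lemma gconvs_dZm v j : gconvs dir (sg 1%N) s (fun x => m 1%N * c * (Z j x `^ m 1%N * \sum_i ga j i x * v i)) =
  (fun x => m 1%N * c * (ezV sg j x * \sum_i phi1V sg j (ga j i) x * v i)).
Proof.
rewrite gconvs_weight//; last exact: pccvg_powR.
apply/funext => x; congr (_ * _); rewrite mulr_sumr; apply: eq_bigr => i _.
rewrite /phi1V mulrA; congr (_ * _); rewrite mulrCA divff ?mulr1//.
by rewrite gt_eqF// (pccvg_lim (pccvg_ezV_cst j)).
Qed.

Lemma dder_ezV v j : dder v (ezV sg j)
  (fun x => m 1%N * c * (ezV sg j x * \sum_i phi1V sg j (ga j i) x * v i)).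
Proof.
rewrite -gconvs_dZm; apply: dder_gconvs; last exact: dder_Zm.
  by case: (cZ j).
by case: (ccvg_dZm v j).
Qed.

(** Differentiating zeta_k = E zeta_(k-1)^(m_k / m_(k-1)) multiplies the constant
    m_(k-1) by m_k / m_(k-1), and replaces the weights by their tilted average
    Phi_k.  The constants telescope to m_k. *)
Lemma dder_zetaV v k : (0 < k)%N -> (forall j, (0 < j < k)%N -> m j != 0) ->
  dder v (zetaV sg k) (fun x => m k * p * c * (zetaV sg k x * \sum_i wV k i x * v i)).
Proof.
case: k => // k _; elim: k => [_|k IH m0].
  have ez0 j x := pccvg_lim (pccvg_ezV_cst j) x.
  have := dder_sum (index_enum J) (fun j => dder_powlike (powlike_powR p) (ez0 j) (dder_ezV v j)).
  apply: dder_ext => // x.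
  have z0 : zetaV sg 1 x != 0 by rewrite gt_eqF// (pccvg_lim (pccvg_zetaV_cst (k := 1) _)).
  transitivity (\sum_j \sum_i m 1%N * p * c * (zetaV sg 1 x * (g1V sg j i x * v i))).
    apply: eq_bigr => j _; rewrite !mulr_sumr; apply: eq_bigr => i _.
    rewrite /g1V /g00V -/(zetaV sg 1 x) -(powR_pred p (ez0 j x)) /=.
    by rewrite -/(zetaV sg 1 x); field.
  rewrite exchange_big /= !mulr_sumr; apply: eq_bigr => i _.
  rewrite /wV phisV_nil// -!mulr_sumr; congr (_ * (_ * _)).
  by rewrite mulr_suml.
have zk0 x := pccvg_lim (pccvg_zetaV_cst (k := k.+1) isT) x.
set rho := m k.+2 / m k.+1.
have rE : rho * m k.+1 = m k.+2 by rewrite /rho divfK// m0 /=.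
have {}IH : dder v (zetaV sg k.+1)
    (fun x => m k.+1 * p * c * (zetaV sg k.+1 x * \sum_i wV k.+1 i x * v i)).
  by apply: IH => j /andP[j1 j2]; apply: m0; rewrite j1 ltnW.
have d1 : dder v (fun x => zetaV sg k.+1 x `^ rho)
    (fun x => m k.+2 * p * c * (zetaV sg k.+1 x `^ rho * \sum_i wV k.+1 i x * v i)).
  apply: dder_ext (dder_powlike (powlike_powR rho) zk0 IH) => // x.
  by rewrite -(powR_pred rho (zk0 x)) -rE; ring.
have pW := pccvg_powR rho (pccvg_zetaV_cst (k := k.+1) isT).
have cw := ccvg_wV k.+1.
have cdW := ccvg_pairing v cw.
have t2 : tame1 (fun x => m k.+2 * p * c * (zetaV sg k.+1 x `^ rho * \sum_i wV k.+1 i x * v i)).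
  exact: (ccvgZ (m k.+2 * p * c) (ccvgM (pccvg_ccvg pW) cdW)).1.
have := dder_gconvs dir (sg k.+2) s (pccvg_ccvg pW).1 t2 d1.
rewrite (gconvs_weight _ _ _ pW cw).
apply: dder_ext => // x; congr (_ * _); rewrite mulr_sumr.
apply: eq_bigr => i _; rewrite (wVS (k := k.+1) i isT) /phiV mulrA; congr (_ * _).
by rewrite mulrCA divff ?mulr1// gt_eqF// (pccvg_lim (pccvg_zetaV_cst (k := k.+2) _)).
Qed.

End fixed.
End nested.

(** * The derivative through all the layers *)

Section recursion.
Context {R : realType} {I J : finType} (j0 : J) {E : Type}.
Local Notation V := (I -> R).
Variables (dir : E -> V) (s : seq E).
Variables (Z : J -> V -> R) (ga : J -> I -> V -> R) (c p : R) (m : nat -> R).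
Hypothesis pZ : forall j, pcont (Z j).
Hypothesis cga : forall j i, ccont (ga j i).
Hypothesis dZ : forall v j,
  dder v (Z j) (fun x => c * Z j x * \sum_i ga j i x * v i).
(* sA and sB are two schedules of standard deviations that share the limit sl and
   differ by a transfer of variance d_e delta from layer k1 to layer k1+1. *)
Variables (k1 : nat) (d : E -> R) (delta : nat -> R).
Hypothesis k10 : (0 < k1)%N.
Hypotheses (d0 : forall e, 0 <= d e) (delta0 : forall n, 0 < delta n).
Hypothesis deltac : delta n @[n --> \oo] --> (0 : R).
Variables (sA sB : nat -> nat -> E -> R) (sl : nat -> E -> R).
Hypotheses (sA0 : forall n k e, 0 <= sA n k e) (sB0 : forall n k e, 0 <= sB n k e).
Hypotheses (sAc : forall k e, sA n k e @[n --> \oo] --> sl k e)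
  (sBc : forall k e, sB n k e @[n --> \oo] --> sl k e).
Hypothesis sE1 : forall n e, sB n k1 e ^+ 2 = sA n k1 e ^+ 2 + d e * delta n.
Hypothesis sE2 : forall n e, sA n k1.+1 e ^+ 2 = sB n k1.+1 e ^+ 2 + d e * delta n.
Hypothesis sA_eq : forall n k, k != k1 -> k != k1.+1 -> sA n k = sl k.
Hypothesis sB_eq : forall n k, k != k1 -> k != k1.+1 -> sB n k = sl k.

Local Notation ezV := (ezV dir s Z m).
Local Notation zetaV := (zetaV dir s Z p m).
Local Notation phi1V := (phi1V dir s Z m).
Local Notation phiV := (phiV dir s Z p m).
Local Notation phisV := (phisV dir s Z p m).
Local Notation g00V := (g00V dir s Z p m).
Local Notation wV := (wV dir s Z ga p m).

(** Covariance, per unit of delta, of the part of the field that changes layer. *)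
Definition Cov i i' : R := \sum_(e <- s) d e * (dir e i * dir e i').

Definition quadS (x : V) : R := \sum_i \sum_i' Cov i i' * (wV sl k1 i x * wV sl k1 i' x).
Definition quad22 (x : V) : R := \sum_j g00V sl j x *
  \sum_i \sum_i' Cov i i' * (phi1V sl j (ga j i) x * phi1V sl j (ga j i') x).

(** What is averaged over layer k1+1 in the rate of change of E h(zeta_k1), up to
    the factor k zeta_k1^rho, where h' = k y^(rho-1).  The second term comes from
    the power p that separates the first layer from the second. *)
Definition rateV (rho : R) (x : V) : R :=
  (rho - 1) / 2 * (m k1 * p * c) ^+ 2 * quadS x +
  (if k1 == 1%N then p * (p - 1) / 2 * (m 1%N * c) ^+ 2 * quad22 x else 0).

Lemma sum_sqr_Cov (a : I -> R) :
  \sum_(e <- s) d e * (\sum_i a i * dir e i) ^+ 2 =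
  \sum_i \sum_i' Cov i i' * (a i * a i').
Proof.
transitivity (\sum_(e <- s) \sum_i \sum_i' d e * (dir e i * dir e i') * (a i * a i')).
  apply: eq_bigr => e _; rewrite expr2 mulr_suml mulr_sumr; apply: eq_bigr => i _.
  rewrite !mulr_sumr; apply: eq_bigr => i' _; ring.
rewrite exchange_big /=; apply: eq_bigr => i _.
rewrite exchange_big /=; apply: eq_bigr => i' _.
by rewrite /Cov mulr_suml.
Qed.

(** The base case, in which h acts on zeta_k1 and is averaged over layer k1+1.
    For k1 >= 2 there is one inner function, namely a power of zeta_(k1-1); for
    k1 = 1 there is one for each third index. *)
Lemma level_quot (h : R -> R) (ka rho : R) : powlike h ka rho ->
  (forall j, (0 < j < k1)%N -> m j != 0) ->
  ccvg (fun n x => (gconvs dir (sA n k1.+1) s (fun y => h (zetaV (sA n) k1 y)) x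
                - gconvs dir (sB n k1.+1) s (fun y => h (zetaV (sB n) k1 y)) x) / delta n)
     (gconvs dir (sl k1.+1) s (fun x => ka * zetaV sl k1 x `^ rho * rateV rho x)).
Proof.
move=> hp m0.
have cl e : cst (sl k1 e) n @[n --> \oo] --> sl k1 e by exact: cvg_cst.
case: (ltngtP k1 1) => [|k1gt|k1eq]; first by rewrite ltnNge k10.
- have [k kE] : exists k, k1 = k.+2 by case: (k1) k1gt => [//|[//|k]] _; exists k.
  have k'0 : (0 < k.+1)%N by [].
  set rh := m k1 / m k.+1.
  pose f (_ : unit) x := zetaV sl k.+1 x `^ rh.
  have m0' j : (0 < j < k.+1)%N -> m j != 0.
    by case/andP=> j1 j2; apply: m0; rewrite j1 kE ltnW.
  have mk : m k.+1 != 0 by apply: m0; rewrite kE /=.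
  pose df (e : E) (_ : unit) x := m k1 * p * c * (zetaV sl k.+1 x `^ rh * \sum_i wV sl k.+1 i x * dir e i).
  have pzk := pccvg_zetaV_cst j0 dir s p m pZ sl k'0.
  have pf j : pcont (f j) by exact: pccvg_powR.
  have cw := ccvg_wV j0 dir s p m pZ cga sl k.+1.
  have cdf e j : ccont (df e j).
    exact: (ccvgZ (m k1 * p * c) (ccvgM (ccvg_powR rh pzk) (ccvg_pairing (dir e) cw))).
  have fdf e j : dder (dir e) (f j) (df e j).
    have := dder_powlike (powlike_powR rh) (pccvg_lim pzk) (dder_zetaV j0 dir s p pZ cga dZ sl (dir e) k'0 m0').
    apply: dder_ext => // x; rewrite /df -(powR_pred rh (pccvg_lim pzk x)).
    have -> : m k1 = rh * m k.+1 by rewrite /rh divfK.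
    ring.
  have := @variance_transfer _ _ _ dir h ka rho 1 hp unit tt d delta d0 delta0 deltac
    (fun n => sA n k1) (fun n => sB n k1) (fun n => sA n k1.+1) (fun n => sB n k1.+1)
    (sl k1) (sl k1.+1) (fun n => sA0 n k1) (fun n => sB0 n k1) (fun n => sA0 n k1.+1)
    (fun n => sB0 n k1.+1) sE1 sE2 (@sAc k1) (@sBc k1) (@sAc k1.+1) (@sBc k1.+1) f df pf cdf fdf s.
  have zS (sg : nat -> E -> R) : zetaV sg k1 = gconvs dir (sg k1) s (fun x => zetaV sg k.+1 x `^ rh).
    by rewrite /rh kE.
  have zl : zetaV sl k1 = gconvs dir (sl k1) s (f tt) by exact: zS.
  have zA n : zetaV (sA n) k1 = gconvs dir (sA n k1) s (f tt).
    rewrite zS (zetaV_ext dir s Z p m (sg := sA n) (sg' := sl))// => j /andP[j1 j2].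
    by apply: sA_eq; rewrite kE; apply/eqP => jE; move: j2; rewrite jE ltnNge ?leqnn// ltnW.
  have zB n : zetaV (sB n) k1 = gconvs dir (sB n k1) s (f tt).
    rewrite zS (zetaV_ext dir s Z p m (sg := sB n) (sg' := sl))// => j /andP[j1 j2].
    by apply: sB_eq; rewrite kE; apply/eqP => jE; move: j2; rewrite jE ltnNge ?leqnn// ltnW.
  have sum1 (F : unit -> R) : \sum_j F j = F tt.
    by rewrite (bigD1 tt)//= big1 ?addr0// => -[].
  have z0 x : 0 < zetaV sl k1 x := pccvg_lim (pccvg_zetaV_cst j0 dir s p m pZ sl k10) x.
  have psumE (sg : E -> R) : psum h 1 (fun j => gconvs dir sg s (f j)) = (fun y => h (gconvs dir sg s (f tt) y)).
    apply/funext => y; rewrite /psum sum1 powRr1//.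
    have pff : pcont (f tt) by [].
    have hh : pcont (gconvs dir sg s (f tt)).
      by apply: pccvg_gconvs => // e; exact: cvg_cst.
    by apply: ltW; exact: (pccvg_lim hh y).
  have dgE e : gconvs dir (sl k1) s (df e tt) = (fun x => m k1 * p * c * (zetaV sl k1 x * \sum_i wV sl k1 i x * dir e i)).
    rewrite /df (gconvs_weight dir s sl k1 (m k1 * p * c) (dir e) (pccvg_powR rh pzk) cw).
    apply/funext => x; congr (_ * _); rewrite mulr_sumr; apply: eq_bigr => i _.
    have -> : wV sl k1 i = phiV sl k1 (wV sl k.+1 i) by rewrite kE; exact: wVS.
    have phiE F y : phiV sl k1 F y =
        gconvs dir (sl k1) s (fun z => zetaV sl k.+1 z `^ rh * F z) y / zetaV sl k1 y.
      by rewrite /rh kE.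
    rewrite phiE mulrA; congr (_ * _).
    by rewrite mulrCA divff ?mulr1 ?gt_eqF.
  apply: ccvg_ext => [n x|x]; first by rewrite !psumE zA zB.
  congr (gconvs _ _ _ _ _); apply/funext => y.
  rewrite /rateV (_ : (k1 == 1%N) = false); last by rewrite kE.
  transitivity (\sum_(e <- s) ka * zetaV sl k1 y `^ rho * ((rho - 1) / 2 * (m k1 * p * c) ^+ 2) *
     (d e * (\sum_i wV sl k1 i y * dir e i) ^+ 2)).
    apply: eq_bigr => e _; rewrite /gap_lim !sum1 dgE -zl subrr powRr0 powRr1; last exact: ltW.
    by rewrite -(powR_pred2 rho (z0 y)); ring.
  by rewrite -mulr_sumr sum_sqr_Cov /quadS addr0; ring.
- have cZ j : ccont (fun x => Z j x `^ m 1%N) := ccvg_powR _ (pZ j).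
  pose f j x := Z j x `^ m 1%N.
  have pf j : pcont (f j) by exact: pccvg_powR.
  pose df (e : E) j x := m 1%N * c * (Z j x `^ m 1%N * \sum_i ga j i x * dir e i).
  have cdf e j : ccont (df e j) by exact: ccvg_dZm.
  have fdf e j : dder (dir e) (f j) (df e j) by exact: dder_Zm.
  have := @variance_transfer _ _ _ dir h ka rho p hp J j0 d delta d0 delta0 deltac
    (fun n => sA n k1) (fun n => sB n k1) (fun n => sA n k1.+1) (fun n => sB n k1.+1)
    (sl k1) (sl k1.+1) (fun n => sA0 n k1) (fun n => sB0 n k1) (fun n => sA0 n k1.+1)
    (fun n => sB0 n k1.+1) sE1 sE2 (@sAc k1) (@sBc k1) (@sAc k1.+1) (@sBc k1.+1) f df pf cdf fdf s.
  have z0 x : 0 < zetaV sl 1 x := pccvg_lim (pccvg_zetaV_cst j0 dir s p m pZ sl (k := 1) isT) x.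
  have ez0 j x : 0 < ezV sl j x := pccvg_lim (pccvg_ezV_cst dir s m pZ sl j) x.
  rewrite k1eq; apply: ccvg_ext => [n x|x] //.
  congr (gconvs _ _ _ _ _); apply/funext => y.
  have zE : \sum_j ezV sl j y `^ p = zetaV sl 1 y by [].
  have gE j : gconvs dir (sl 1%N) s (f j) = ezV sl j by [].
  have dgE e j : gconvs dir (sl 1%N) s (df e j) = (fun x => m 1%N * c * (ezV sl j x * \sum_i phi1V sl j (ga j i) x * dir e i)).
    exact: gconvs_dZm.
  rewrite /rateV k1eq eqxx.
  have S1 e : \sum_j p * ezV sl j y `^ (p - 1) * gconvs dir (sl 1%N) s (df e j) y =
     m 1%N * p * c * (zetaV sl 1 y * \sum_i wV sl 1 i y * dir e i).
    transitivity (\sum_j \sum_i m 1%N * p * c * (zetaV sl 1 y * (g1V dir s Z ga p m sl j i y * dir e i))).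
      apply: eq_bigr => j _; rewrite dgE !mulr_sumr; apply: eq_bigr => i _.
      rewrite /g1V g00VE -(powR_pred p (ez0 j y)).
      by field; rewrite gt_eqF.
    rewrite exchange_big /= !mulr_sumr; apply: eq_bigr => i _.
    rewrite wV1 -!mulr_sumr; congr (_ * (_ * _)).
    by rewrite mulr_suml.
  have S2 e : \sum_j (p * (p - 1) / 2 * ezV sl j y `^ (p - 2) * gconvs dir (sl 1%N) s (df e j) y ^+ 2) =
     p * (p - 1) / 2 * (m 1%N * c) ^+ 2 * (zetaV sl 1 y *
       \sum_j g00V sl j y * (\sum_i phi1V sl j (ga j i) y * dir e i) ^+ 2).
    rewrite !mulr_sumr; apply: eq_bigr => j _; rewrite dgE.
    rewrite g00VE -(powR_pred2 p (ez0 j y)).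
    by field; rewrite gt_eqF.
  transitivity (\sum_(e <- s) (ka * zetaV sl 1 y `^ rho * ((rho - 1) / 2 * (m 1%N * p * c) ^+ 2) *
     (d e * (\sum_i wV sl 1 i y * dir e i) ^+ 2) +
     ka * zetaV sl 1 y `^ rho * (p * (p - 1) / 2 * (m 1%N * c) ^+ 2) *
       \sum_j g00V sl j y * (d e * (\sum_i phi1V sl j (ga j i) y * dir e i) ^+ 2))).
    apply: eq_bigr => e _; rewrite /gap_lim zE S1 S2.
    have -> : \sum_j g00V sl j y * (d e * (\sum_i phi1V sl j (ga j i) y * dir e i) ^+ 2) =
      d e * \sum_j g00V sl j y * (\sum_i phi1V sl j (ga j i) y * dir e i) ^+ 2.
      by rewrite mulr_sumr; apply: eq_bigr => j _; ring.
    have := powR_pred2 rho (z0 y); have := powR_pred rho (z0 y).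
    set y1 := _ `^ (rho - 1); set y2 := _ `^ (rho - 2); set y3 := _ `^ rho => e1 e2.
    transitivity (ka * (rho - 1) / 2 * (m 1%N * p * c) ^+ 2 * (y2 * zetaV sl 1 y ^+ 2) *
        (d e * (\sum_i wV sl 1 i y * dir e i) ^+ 2) +
      ka * (y1 * zetaV sl 1 y) * (p * (p - 1) / 2 * (m 1%N * c) ^+ 2) *
      (d e * \sum_j g00V sl j y * (\sum_i phi1V sl j (ga j i) y * dir e i) ^+ 2)); first by ring.
    by rewrite e1 e2; ring.
  have e2 : \sum_(e <- s) \sum_j g00V sl j y * (d e * (\sum_i phi1V sl j (ga j i) y * dir e i) ^+ 2) = quad22 y.
    by rewrite exchange_big; apply: eq_bigr => j _; rewrite -mulr_sumr sum_sqr_Cov.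
  rewrite big_split /= -[X in _ + X = _]mulr_sumr e2 -mulr_sumr sum_sqr_Cov.
  by rewrite /quadS k1eq; ring.
Qed.

Lemma ccvg_ww i i' : ccont (fun x => wV sl k1 i x * wV sl k1 i' x).
Proof. by apply: (ccvgM (F := fun=> _) (G := fun=> _)); exact: ccvg_wV. Qed.

Lemma ccvg_gpp j i i' : ccont (fun x => g00V sl j x * (phi1V sl j (ga j i) x * phi1V sl j (ga j i') x)).
Proof.
apply: (ccvgM (F := fun=> _) (G := fun=> _)); first exact: ccvg_g00V.
by apply: (ccvgM (F := fun=> _) (G := fun=> _)); exact: ccvg_phi1V.
Qed.

Lemma ccvg_sum_cst (K : finType) (F : K -> V -> R) : (forall j, ccont (F j)) ->
  ccont (fun x => \sum_j F j x).
Proof. by move=> cF; exact: (@ccvg_sum _ _ K _ (fun j _ => F j)). Qed.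

Lemma ccvgZ_cst a (F : V -> R) : ccont F -> ccont (fun x => a * F x).
Proof. exact: (@ccvgZ _ _ a (fun=> F)). Qed.

Lemma ccvgD_cst (F G : V -> R) : ccont F -> ccont G ->
  ccont (fun x => F x + G x).
Proof. exact: (@ccvgD _ _ (fun=> F) (fun=> G)). Qed.

Lemma ccvg_quadS : ccvg (fun=> quadS) quadS.
Proof. by do 2 (apply: ccvg_sum_cst => ?); apply: ccvgZ_cst; exact: ccvg_ww. Qed.

Lemma quad22E : quad22 = fun x => \sum_i \sum_i' Cov i i' *
  (\sum_j g00V sl j x * (phi1V sl j (ga j i) x * phi1V sl j (ga j i') x)).
Proof.
apply/funext => x; rewrite /quad22; under eq_bigr do rewrite mulr_sumr.
rewrite exchange_big /=; apply: eq_bigr => i _.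
under eq_bigr do rewrite mulr_sumr.
rewrite exchange_big /=; apply: eq_bigr => i' _.
by rewrite mulr_sumr; apply: eq_bigr => j _; rewrite mulrCA.
Qed.

Lemma ccvg_quad22 : ccvg (fun=> quad22) quad22.
Proof.
rewrite quad22E.
do 2 (apply: ccvg_sum_cst => ?); apply: ccvgZ_cst; apply: ccvg_sum_cst => j; exact: ccvg_gpp.
Qed.

Lemma ccvg_rateV rho : ccont (rateV rho).
Proof.
apply: ccvgD_cst; first by apply: ccvgZ_cst; exact: ccvg_quadS.
by case: (k1 == 1%N); [apply: ccvgZ_cst; exact: ccvg_quad22|exact: ccvg_cst].
Qed.

Variable r : nat.
Hypothesis k1r : (k1 <= r)%N.
Hypothesis mr : m r.+1 = 0.
Hypothesis mn0 : forall k, (0 < k <= r)%N -> m k != 0.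

Let m0 : forall j, (0 < j < k1)%N -> m j != 0.
Proof. by move=> j /andP[j1 j2]; apply: mn0; rewrite j1 (leq_trans (ltnW j2)). Qed.

Let rho := m k1.+1 / m k1.
Let T := rateV rho.
Let mk1 : m k1 != 0. Proof. by apply: mn0; rewrite k10. Qed.

Let zeta_phi k (F : V -> R) a : (0 < k)%N -> ccont F ->
  gconvs dir (sl k.+1) s (fun x => a * (zetaV sl k x `^ (m k.+1 / m k) * F x)) =
  (fun x => zetaV sl k.+1 x * (a * phiV sl k.+1 F x)).
Proof.
move=> k0 cF.
have tF : tame1 (fun x => zetaV sl k x `^ (m k.+1 / m k) * F x).
  have pz := pccvg_zetaV_cst j0 dir s p m pZ sl k0.
  by apply: (tameM (F := fun=> _) (G := fun=> _)); [exact: (ccvg_powR _ pz).1|case: cF].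
rewrite (gconvsZ dir a (sl k.+1) s tF); apply/funext => x.
rewrite phiVS /= mulrCA; congr (_ * _).
by rewrite mulrCA divff ?mulr1// gt_eqF// (pccvg_lim (pccvg_zetaV_cst j0 dir s p m pZ sl (k := k.+1) isT)).
Qed.

(** Each further layer raises to the power m_k / m_(k-1) and averages.  The chain
    rule multiplies by this exponent, so that the product telescopes to
    m_k / m_k1, and the average of the weighted quotient is Phi_k. *)
Lemma zeta_quot k : (k1 < k <= r)%N ->
  ccvg (fun n x => (zetaV (sA n) k x - zetaV (sB n) k x) / delta n)
     (fun x => zetaV sl k x * (m k / m k1 * phisV sl k k1.+1 T x)).
Proof.
elim: k => [//|k IH]; rewrite ltnS => /andP[k1k kr].
have k0 : (0 < k)%N by exact: leq_trans k1k.
have [k1E|k1n] := eqVneq k1 k.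
  have := level_quot (powlike_powR rho) m0.
  apply: ccvg_ext => [n x|x]; first by rewrite -k1E !zetaVS.
  rewrite -k1E (phisVS dir s Z p m sl T (leqnn _)) phisV_nil//.
  have := congr1 (@^~ x) (zeta_phi rho k10 (ccvg_rateV rho)); rewrite /= -/rho => <-.
  by congr (gconvs _ _ _ _ _); apply/funext => y; rewrite mulrA.
have k1k' : (k1 < k)%N by rewrite ltn_neqAle k1n.
have {}IH := IH (introT andP (conj k1k' (ltnW kr))).
have neq : k.+1 != k1 /\ k.+1 != k1.+1.
  by rewrite eqSS [k == _]eq_sym k1n; split=> //; rewrite gtn_eqF// ltnS.
have en0 n : delta n != 0 by rewrite gt_eqF.
have pA := pccvg_zetaV j0 dir s p m pZ sAc k0.
have pB := pccvg_zetaV j0 dir s p m pZ sBc k0.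
have tang := ccvg_tangent (powlike_powR (m k.+1 / m k)) en0 deltac pA pB IH.
have cl e : (fun=> sl k.+1 e) n @[n --> \oo] --> sl k.+1 e by exact: cvg_cst.
have := @ccvg_gconvs _ _ _ dir _ _ (fun=> sl k.+1) (sl k.+1) s tang cl.
apply: ccvg_ext => [n x|x].
  rewrite !zetaVS//= sA_eq ?neq.1 ?neq.2// sB_eq ?neq.1 ?neq.2//.
  have tA := tame_at n (ccvg_powR (m k.+1 / m k) pA).1.
  have tB := tame_at n (ccvg_powR (m k.+1 / m k) pB).1.
  exact: gconvs_quot.
have cP : ccont (phisV sl k k1.+1 T).
  by apply: ccvg_phisV => //; exact: ccvg_rateV.
rewrite phisVS//.
have := congr1 (@^~ x) (zeta_phi (m k.+1 / m k1) k0 cP); rewrite /= => <-.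
congr (gconvs _ _ _ _ _); apply/funext => y.
have zy := pccvg_lim (pccvg_zetaV_cst j0 dir s p m pZ sl k0) y.
rewrite -(powR_pred (m k.+1 / m k) zy).
by field; rewrite mk1 mn0// k0 ltnW.
Qed.

(** For k1 = r this is the base case with h = ln, whose exponent rho = 0 is
    m_(r+1) / m_r. *)
Lemma ln_zeta_quot :
  ccvg (fun n x => (gconvs dir (sA n r.+1) s (fun y => ln (zetaV (sA n) r y)) x
                - gconvs dir (sB n r.+1) s (fun y => ln (zetaV (sB n) r y)) x) / delta n)
     (gconvs dir (sl r.+1) s (fun x => m r / m k1 * phisV sl r k1.+1 T x)).
Proof.
have r0 : (0 < r)%N by exact: leq_trans k1r.
have [k1E|k1n] := eqVneq k1 r.
  have := level_quot powlike_ln m0; rewrite k1E; apply: ccvg_ext => // x.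
  rewrite phisV_nil//; congr (gconvs _ _ _ _ _); apply/funext => y.
  by rewrite powRr0 /T /rho k1E mr mul0r divff ?mul1r// -k1E.
have k1r' : (k1 < r)%N by rewrite ltn_neqAle k1n.
have neq : r.+1 != k1 /\ r.+1 != k1.+1.
  by rewrite eqSS [r == _]eq_sym k1n; split=> //; rewrite gtn_eqF// ltnS.
have en0 n : delta n != 0 by rewrite gt_eqF.
have pA := pccvg_zetaV j0 dir s p m pZ sAc r0.
have pB := pccvg_zetaV j0 dir s p m pZ sBc r0.
have IH := zeta_quot (introT andP (conj k1r' (leqnn r))).
have tang := ccvg_tangent powlike_ln en0 deltac pA pB IH.
have cl e : (fun=> sl r.+1 e) n @[n --> \oo] --> sl r.+1 e by exact: cvg_cst.
have := @ccvg_gconvs _ _ _ dir _ _ (fun=> sl r.+1) (sl r.+1) s tang cl.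
apply: ccvg_ext => [n x|x].
  rewrite sA_eq ?neq.1 ?neq.2// sB_eq ?neq.1 ?neq.2//.
  have tA := tame_at n (ccvg_powlike powlike_ln pA).1.
  have tB := tame_at n (ccvg_powlike powlike_ln pB).1.
  exact: gconvs_quot.
congr (gconvs _ _ _ _ _); apply/funext => y.
have zy := pccvg_lim (pccvg_zetaV_cst j0 dir s p m pZ sl r0) y.
rewrite sub0r mul1r (_ : zetaV sl r y `^ (-1) = (zetaV sl r y)^-1); last by rewrite powR_inv1// ltW.
by rewrite mulrA mulVf ?mul1r// gt_eqF.
Qed.

(** The averages over gamma_(k1+1) and over gamma_22, before the expectation over G
    and the last layer, as linear functions of the kernel h.  For k1 = 1 the first
    one is the average over gamma_21. *)
Definition avgS (h : I -> I -> R) (x : V) : R :=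
  \sum_i \sum_i' h i i' * phisV sl r k1.+1 (fun y => wV sl k1 i y * wV sl k1 i' y) x.
Definition avg22 (h : I -> I -> R) (x : V) : R :=
  \sum_i \sum_i' h i i' * \sum_j phisV sl r 2
    (fun y => g00V sl j y * (phi1V sl j (ga j i) y * phi1V sl j (ga j i') y)) x.

Lemma avgSE h x : avgS h x =
  \sum_i \sum_i' h i i' * phisV sl r k1.+1 (fun y => wV sl k1 i y * wV sl k1 i' y) x.
Proof. by []. Qed.

Lemma avg22E h x : avg22 h x =
  \sum_i \sum_i' h i i' * \sum_j phisV sl r 2
    (fun y => g00V sl j y * (phi1V sl j (ga j i) y * phi1V sl j (ga j i') y)) x.
Proof. by []. Qed.

Lemma phisV_rate x : phisV sl r k1.+1 T x =
  (rho - 1) / 2 * (m k1 * p * c) ^+ 2 * avgS Cov x +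
  (if k1 == 1%N then p * (p - 1) / 2 * (m 1%N * c) ^+ 2 * avg22 Cov x else 0).
Proof.
have k11 : (1 < k1.+1)%N by [].
have phisVD F G : ccont F -> ccont G ->
    phisV sl r k1.+1 (fun x => F x + G x) x = phisV sl r k1.+1 F x + phisV sl r k1.+1 G x.
  move=> cF cG; pose H (b : bool) := if b then F else G.
  have cH b : ccont (H b) by case: b.
  have := congr1 (@^~ x) (phisV_sum j0 dir s p m pZ sl (index_enum bool) r k11 cH).
  rewrite /= [RHS]big_bool /= => <-; congr (phisV _ _ _ _ _); apply/funext => y.
  by rewrite big_bool.
have kern (K : I -> I -> V -> R) (h : I -> I -> R) : (forall i i', ccont (K i i')) ->
  phisV sl r k1.+1 (fun x => \sum_i \sum_i' h i i' * K i i' x) x =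
  \sum_i \sum_i' h i i' * phisV sl r k1.+1 (K i i') x.
  move=> cK.
  have c1 i i' : ccont (fun x => h i i' * K i i' x) by exact: ccvgZ_cst.
  have c2 i : ccont (fun x => \sum_i' h i i' * K i i' x) by exact: ccvg_sum_cst.
  have := congr1 (@^~ x) (phisV_sum j0 dir s p m pZ sl (index_enum I) r k11 c2); rewrite /= => ->.
  apply: eq_bigr => i _.
  have := congr1 (@^~ x) (phisV_sum j0 dir s p m pZ sl (index_enum I) r k11 (c1 i)); rewrite /= => ->.
  apply: eq_bigr => i' _.
  by have := congr1 (@^~ x) (phisVZ j0 dir s p m pZ sl r (h i i') k11 (cK i i')).
rewrite /T /rateV phisVD; last 2 first.
- by apply: ccvgZ_cst; exact: ccvg_quadS.
- by case: (k1 == 1%N); [apply: ccvgZ_cst; exact: ccvg_quad22|exact: ccvg_cst].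
congr (_ + _).
  have := congr1 (@^~ x) (phisVZ j0 dir s p m pZ sl r ((rho - 1) / 2 * (m k1 * p * c) ^+ 2) k11 ccvg_quadS).
  by rewrite /= => ->; congr (_ * _); apply: kern => i i'; exact: ccvg_ww.
case: (eqVneq k1 1%N) => [e|_]; last first.
  have := congr1 (@^~ x) (phisVZ j0 dir s p m pZ sl r 0 k11 (ccvg_cst (I := I) (0 : R))).
  by rewrite /= !mul0r.
have := congr1 (@^~ x) (phisVZ j0 dir s p m pZ sl r (p * (p - 1) / 2 * (m 1%N * c) ^+ 2) k11 ccvg_quad22).
rewrite /= => ->; congr (_ * _).
rewrite quad22E.
rewrite kern; last by move=> i i'; apply: ccvg_sum_cst => j; exact: ccvg_gpp.
rewrite /avg22 e; apply: eq_bigr => i _; apply: eq_bigr => i' _; congr (_ * _).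
have cg j := ccvg_gpp j i i'.
by have := congr1 (@^~ x) (phisV_sum j0 dir s p m pZ sl (index_enum J) r (isT : (1 < 2)%N) cg).
Qed.

End recursion.

(** * From random fields to convolutions *)

Section noise.
Context {R : realType} {I : finType}.
Local Notation V := (I -> R).
Local Notation RB := (measurableTypeR R).
Local Notation N := (@std_normal R).
Local Notation op := ((V -> R) -> (V -> R)).
Implicit Types (F : V -> R) (x v : V).

Definition padd (x y : V) : V := fun i => x i + y i.

(** The random field L, under the law P, acts by translation as the averaging
    operator o.  Integrability is part of the notion because Fubini's theorem
    needs it for the products. *)
Record gnoise d (T : measurableType d) (P : probability T R) (L : T -> V) (o : op) : Prop := GNoise {
  gnoise_meas : forall i, measurable_fun setT (fun a => L a i);
  gnoise_tame : forall F, tame1 F -> tame1 (o F);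
  gnoise_int : forall F x, tame1 F -> P.-integrable setT (fun a => (F (padd x (L a)))%:E);
  gnoise_eq : forall F x, tame1 F -> (\int[P]_a (F (padd x (L a)))%:E)%E = (o F x)%:E }.

Lemma gnoise_Rint d (T : measurableType d) (P : probability T R) L o F x :
  gnoise P L o -> tame1 F -> \int[P]_a F (padd x (L a)) = o F x.
Proof. by move=> g tF; rewrite /Rintegral (gnoise_eq g). Qed.

Lemma gnoise_ext d (T : measurableType d) (P : probability T R) L L' o o' :
  (forall a i, L a i = L' a i) -> (forall F x, tame1 F -> o F x = o' F x) ->
  gnoise P L o -> gnoise P L' o'.
Proof.
move=> LL oo; have -> : L = L' by apply/funext => a; apply/funext.
have {}oo F : tame1 F -> o F = o' F by move=> tF; apply/funext => x; exact: oo.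
move=> [mL to iL eL]; split => //.
- by move=> F tF; rewrite -(oo F tF); exact: to.
- by move=> F x tF; rewrite -(oo F tF); exact: eL.
Qed.

Lemma gnoise_normal s v : gnoise N (fun z i => s * z * v i) (gconv s v).
Proof.
split.
- by move=> i; apply: measurable_funM => //; exact: measurable_funM.
- by move=> F; exact: tame_gconv.
- by move=> F x tF; exact: expb_integrable (expb_transl s v x tF).
- by move=> F x tF; rewrite -(gint_EFin (expb_transl s v x tF)).
Qed.

(** Independent noises compose; applying the operators to |F| yields the
    integrability over the product. *)
Lemma gnoise_prod d1 (T1 : measurableType d1) (P1 : probability T1 R) L1 o1
  d2 (T2 : measurableType d2) (P2 : probability T2 R) L2 o2 :
  gnoise P1 L1 o1 -> gnoise P2 L2 o2 ->
  gnoise (P1 \x P2)%E (fun a => padd (L1 a.1) (L2 a.2)) (fun F => o1 (o2 F)).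
Proof.
move=> g1 g2.
have mL i : measurable_fun setT (fun a : T1 * T2 => padd (L1 a.1) (L2 a.2) i).
  apply: measurable_funD.
    exact: (measurableT_comp (gnoise_meas g1 i)).
  exact: (measurableT_comp (gnoise_meas g2 i)).
have trA x a b : padd x (padd (L1 a) (L2 b)) = padd (padd x (L1 a)) (L2 b).
  by apply/funext => i; rewrite /padd addrA.
have mF F x : tame1 F -> measurable_fun setT (fun a : T1 * T2 => (F (padd x (padd (L1 a.1) (L2 a.2))))%:E).
  move=> tF; apply/measurable_EFinP.
  apply: (tF.1 0%N _ _ (fun a : T1 * T2 => padd x (padd (L1 a.1) (L2 a.2)))) => i.
  by apply: measurable_funD => //; exact: mL.
have iF F x : tame1 F -> (P1 \x P2)%E.-integrable setT (fun a => (F (padd x (padd (L1 a.1) (L2 a.2))))%:E).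
  move=> tF; apply/integrable12ltyP; first exact: mF.
  have tA : tame1 (fun x => `|F x|).
    split=> [_ d T u mu|]; first by apply: measurableT_comp => //; exact: (tF.1 0%N _ _ u mu).
    by have [K K0 FK] := tameE tF; exists K => n y; rewrite normr_id; exact: FK 0%N y.
  rewrite [X in (X < _)%E](_ : _ = (o1 (o2 (fun x => `|F x|)) x)%:E) ?ltry//.
  rewrite -(gnoise_eq g1); last exact: gnoise_tame g2 _ tA.
  apply: eq_integral => a _; rewrite -(gnoise_eq g2)//.
  by apply: eq_integral => b _; rewrite /= trA.
split => //.
- by move=> F tF; apply: (gnoise_tame g1); exact: (gnoise_tame g2).
- move=> F x tF; rewrite -(integral12_prod_meas1 (iF F x tF)) -(gnoise_eq g1); last exact: gnoise_tame g2 _ tF.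
  apply: eq_integral => a _; rewrite -(gnoise_eq g2)//.
  by apply: eq_integral => b _; rewrite /= trA.
Qed.

Lemma gnoise_iid d (T : measurableType d) (P : probability T R) k (L : 'I_k -> T -> V) (o : 'I_k -> op) :
  (forall j, gnoise P (L j) (o j)) ->
  gnoise (iid P k) (fun z i => \sum_j L j (tnth z j) i) (fun F => foldr o F (enum 'I_k)).
Proof.
elim: k L o => [|k IH] L o g.
  have L0 (z : 0.-tuple T) x : padd x (fun i => \sum_j L j (tnth z j) i) = x.
    by apply/funext => i; rewrite /padd big_ord0 addr0.
  split.
  - by move=> i; under eq_fun do rewrite big_ord0; exact: measurable_cst.
  - by move=> F tF; rewrite (size0nil (size_enum_ord 0)).
  - move=> F x tF; rewrite (_ : (fun _ => _) = cst (F x)%:E); last by apply/funext => z; rewrite L0.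
    exact: finite_measure_integrable_cst.
  - move=> F x tF; rewrite (size0nil (size_enum_ord 0)) /=.
    transitivity (\int[iid P 0]_a (F x)%:E)%E; first by apply: eq_integral => z _; rewrite L0.
    by rewrite integral_cst// [X in (_ * X)%E]probability_setT mule1.
have g' j : gnoise P (L (lift ord0 j)) (o (lift ord0 j)) by [].
have gp := gnoise_prod (g ord0) (IH _ _ g').
have E (a : T * k.-tuple T) i : \sum_j L j (tnth (tcons a) j) i =
   padd (L ord0 a.1) (fun i => \sum_j L (lift ord0 j) (tnth a.2 j) i) i.
  rewrite big_ord_recl /padd; congr (_ + _).
  by apply: eq_bigr => j _; rewrite !(tnth_nth a.1).
have mL i : measurable_fun setT (fun z : k.+1.-tuple T => \sum_j L j (tnth z j) i).
  apply: measurable_sum => j; apply: (measurableT_comp (gnoise_meas (g j) i)).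
  exact: measurable_tnth.
have mF F x : tame1 F -> measurable_fun setT
    (fun z : k.+1.-tuple T => (F (padd x (fun i => \sum_j L j (tnth z j) i)))%:E).
  move=> tF; apply/measurable_EFinP.
  apply: (tF.1 0%N _ _ (fun z : k.+1.-tuple T => padd x (fun i => \sum_j L j (tnth z j) i))) => i.
  by apply: measurable_funD => //; exact: mL.
have Ex F x (a : T * k.-tuple T) : F (padd x (fun i => \sum_j L j (tnth (tcons a) j) i)) =
    F (padd x (padd (L ord0 a.1) (fun i => \sum_j L (lift ord0 j) (tnth a.2 j) i))).
  by congr F; apply/funext => i; rewrite {1}/padd E.
have iF F x : tame1 F -> (iid P k.+1).-integrable setT
    (fun z : k.+1.-tuple T => (F (padd x (fun i => \sum_j L j (tnth z j) i)))%:E).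
  move=> tF; apply/integrableP; split; first exact: mF.
  rewrite ge0_integral_distribution//; last first.
    apply: measurableT_comp => //; exact: mF.
  have /integrableP[_] := gnoise_int gp x tF.
  apply: le_lt_trans; rewrite le_eqVlt; apply/orP; left; apply/eqP.
  by apply: eq_integral => a _ /=; rewrite Ex.
split => //.
- move=> F tF; rewrite enum_ordSl /= foldr_map; exact: gnoise_tame gp F tF.
- move=> F x tF; rewrite /= integral_distribution; last 2 first.
    exact: mF.
    have := gnoise_int gp x tF.
    by apply: eq_integrable => // a _; rewrite /= Ex.
  transitivity (o ord0 (foldr (fun j => o (lift ord0 j)) F (enum 'I_k)) x)%:E; last first.
    by rewrite enum_ordSl /= foldr_map.
  rewrite -(gnoise_eq gp)//.
  by apply: eq_integral => a _ /=; rewrite Ex.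
Qed.

End noise.

(** * The model in field coordinates *)

Lemma dot_sum (R : realType) k (u v : 'cV[R]_k) : dot u v = \sum_i u i 0 * v i 0.
Proof. by rewrite /dot mxE; apply: eq_bigr => i _; rewrite mxE. Qed.

Section bridge.
Context {R : realType} {m n l : nat} (i0 : 'I_l) (D : model R m n l) (r : nat) (t : R).
Local Notation I := ('I_l * 'I_l)%type.
Local Notation V := (I -> R).
Local Notation E := (option ('I_m + 'I_n)).
Local Notation layer := (@layer R m n).
Local Notation gmx := (@gmx R m n).
Local Notation env := (@env R m n).

Definition dirL (e : E) (i : I) : R :=
  match e with
  | None => Num.sqrt t * norm2 (xs D i.1) * norm2 (ys D i.2)
  | Some (inl a) => Num.sqrt (1 - t) * norm2 (xs D i.1) * ys D i.2 a 0
  | Some (inr b) => Num.sqrt (1 - t) * norm2 (ys D i.2) * xs D i.1 b 0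
  end.

Definition dirG (e : 'I_m * 'I_n) (i : I) : R :=
  Num.sqrt t * (ys D i.2 e.1 0 * xs D i.1 e.2 0).

(** A layer has the scalar entries u4, the u2_a and the h_b, in this order, which
    is that of the factors of its law. *)
Definition coordsL : seq E := None :: map (Some \o inl) (enum 'I_m) ++ map (Some \o inr) (enum 'I_n).
Definition coordsG : seq ('I_m * 'I_n) := [seq (a, b) | a <- enum 'I_m, b <- enum 'I_n].

Definition sdL (pv qv : nat -> R) (k : nat) (e : E) : R :=
  match e with
  | None => ak pv qv k
  | Some (inl _) => bk pv k
  | Some (inr _) => ck qv k
  end.

Definition entryL (a : layer) (e : E) : R :=
  match e with
  | None => a.1
  | Some (inl j) => tnth a.2.1 j
  | Some (inr j) => tnth a.2.2 j
  end.

Definition fieldL (sg : E -> R) (a : layer) : V := fun i => \sum_(e <- coordsL) sg e * entryL a e * dirL e i.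
Definition fieldG (g : gmx) : V := fun i => \sum_a \sum_b 1 * tnth (tnth g a) b * dirG (a, b) i.

Lemma sum_coordsL (F : E -> R) : \sum_(e <- coordsL) F e =
  F None + (\sum_a F (Some (inl a)) + \sum_b F (Some (inr b))).
Proof.
by rewrite /coordsL big_cons big_cat /= big_map big_map !big_enum.
Qed.

Lemma gnoise_layer sg : gnoise layer_law (fieldL sg) (gconvs dirL sg coordsL).
Proof.
have g1 := gnoise_normal (sg None) (dirL None).
have g2 := @gnoise_iid _ _ _ (measurableTypeR R) (@std_normal R) m _ _ (fun a => gnoise_normal (sg (Some (inl a))) (dirL (Some (inl a)))).
have g3 := @gnoise_iid _ _ _ (measurableTypeR R) (@std_normal R) n _ _ (fun a => gnoise_normal (sg (Some (inr a))) (dirL (Some (inr a)))).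
apply: gnoise_ext (gnoise_prod g1 (gnoise_prod g2 g3)) => [a i|F x tF].
  by rewrite /fieldL sum_coordsL /padd.
by rewrite /coordsL /gconvs /= foldr_cat !foldr_map.
Qed.

Lemma gnoise_G : gnoise gmx_law fieldG (gconvs dirG (fun=> 1) coordsG).
Proof.
have g a := @gnoise_iid _ _ _ (measurableTypeR R) (@std_normal R) n _ _ (fun b => gnoise_normal 1 (dirG (a, b))).
apply: gnoise_ext (gnoise_iid g) => // F x _; rewrite /coordsG /allpairs_dep.
have -> // : forall s1, foldr (fun j F0 => foldr (fun b => gconv 1 (dirG (j, b))) F0 (enum 'I_n)) F s1 =
  gconvs dirG (fun=> 1) (flatten [seq [seq (a, b) | b <- enum 'I_n] | a <- s1]) F.
elim=> //= a s1 ->; rewrite gconvs_cat /gconvs foldr_map //.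
Qed.

Definition Ah (i1 i2 i3 : 'I_l) (x : V) : R := expR (beta D * (x (i1, i2) + fn D (xbars D i3) (xs D i1))).
Definition Ch (i1 i3 : 'I_l) (x : V) : R := \sum_i2 Ah i1 i2 i3 x.
Definition Zh (i3 : 'I_l) (x : V) : R := \sum_i1 Ch i1 i3 x `^ expo_s D.
Definition g0h (i3 : 'I_l) (i : I) (x : V) : R :=
  Ch i.1 i3 x `^ expo_s D / Zh i3 x * (Ah i.1 i.2 i3 x / Ch i.1 i3 x).

Lemma pccvg_expR_lin (b f : R) (i : I) :
  pccvg (fun=> (fun x : V => expR (b * (x i + f)))) (fun x => expR (b * (x i + f))).
Proof.
suff cc1 (b' : R) : ccvg (fun=> (fun x : V => expR (b' * (x i + f)))) (fun x => expR (b' * (x i + f))).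
  split; [exact: cc1| | |].
  - have := cc1 (- b); apply: ccvg_ext => [_ x|x]; by rewrite mulNr expRN.
  - by move=> *; exact: expR_gt0.
  - by move=> *; exact: expR_gt0.
split; last first.
    move=> u x ux; apply: continuous_cvg; first exact: continuous_expR.
    apply: cvgM; first exact: cvg_cst.
    by apply: cvgD; [exact: ux|exact: cvg_cst].
  split=> [_ d T u mu|].
    by apply: measurableT_comp => //; apply: measurable_funM => //; apply: measurable_funD.
  exists (`|b'| * (1 + `|f|)) => _ x; rewrite ger0_norm ?expR_ge0// ler_expR.
  rewrite (le_trans (ler_norm _))// normrM -mulrA ler_wpM2l//.
  have h1 := ler_normD (x i) f.
  have h2 : `|x i| <= norm1 x.
    by rewrite /norm1 (bigD1 i)//= lerDl; apply: sumr_ge0.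
  have := normr_ge0 f; have := norm1_ge0 x; nra.
Qed.

Lemma pccvg_Ah i1 i2 i3 : pcont (Ah i1 i2 i3).
Proof. exact: pccvg_expR_lin. Qed.

Lemma pccvg_Ch i1 i3 : pcont (Ch i1 i3).
Proof. exact: (pccvg_sum i0 (F := fun i2 _ => Ah i1 i2 i3) (fun i2 => pccvg_Ah i1 i2 i3)). Qed.

Lemma pccvg_Zh i3 : pcont (Zh i3).
Proof.
apply: (pccvg_sum i0 (F := fun i1 _ x => Ch i1 i3 x `^ expo_s D)) => i1.
exact: pccvg_powR (pccvg_Ch i1 i3).
Qed.

Lemma ccvg_g0h i3 i : ccont (g0h i3 i).
Proof.
exact: (ccvgM (ccvgM (ccvg_powR _ (pccvg_Ch _ _)) (pccvg_inv (pccvg_Zh i3)))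
  (ccvgM (pccvg_ccvg (pccvg_Ah _ _ _)) (pccvg_inv (pccvg_Ch _ _)))).
Qed.

Lemma dder_Ah v i1 i2 i3 : dder v (Ah i1 i2 i3) (fun x => beta D * v (i1, i2) * Ah i1 i2 i3 x).
Proof.
move=> x; rewrite /Ah.
pose g (c : R) := beta D * (transl c v x (i1, i2) + fn D (xbars D i3) (xs D i1)).
have dg : is_derive (0 : R) 1 g (beta D * v (i1, i2)).
  have -> : g = (beta D * v (i1, i2)) *: (id : R -> R) + cst (beta D * (x (i1, i2) + fn D (xbars D i3) (xs D i1))).
    apply/funext => c; rewrite /g /transl.
    transitivity (beta D * v (i1, i2) * c + beta D * (x (i1, i2) + fn D (xbars D i3) (xs D i1))) => //.
    ring.
  by apply: is_derive_eq; rewrite addr0 scaler1.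
have de : is_derive (g 0) 1 expR (expR (g 0)) by exact: is_derive_expR.
have := @is_derive1_comp _ expR g _ _ _ de dg.
by rewrite mulrC /g /transl mul0r addr0.
Qed.

Lemma dder_Zh v i3 :
  dder v (Zh i3) (fun x => (expo_s D * beta D) * Zh i3 x * \sum_i g0h i3 i x * v i).
Proof.
have C0 i1 x := pccvg_lim (pccvg_Ch i1 i3) x.
have dC i1 := dder_sum (index_enum 'I_l) (fun i2 => dder_Ah v i1 i2 i3).
have := dder_sum (index_enum 'I_l) (fun i1 => dder_powlike (powlike_powR (expo_s D)) (C0 i1) (dC i1)).
apply: dder_ext => // x.
have : Zh i3 x != 0 by rewrite gt_eqF// (pccvg_lim (pccvg_Zh i3)).
rewrite /g0h; move: (Zh i3 x) => z z0.
have -> : \sum_i Ch i.1 i3 x `^ expo_s D / z * (Ah i.1 i.2 i3 x / Ch i.1 i3 x) * v i =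
  \sum_i1 \sum_i2 Ch i1 i3 x `^ expo_s D / z * (Ah i1 i2 i3 x / Ch i1 i3 x) * v (i1, i2).
  by rewrite pair_bigA; apply: eq_bigr => -[].
rewrite !mulr_sumr; apply: eq_bigr => i1 _; rewrite !mulr_sumr; apply: eq_bigr => i2 _.
rewrite -(powR_pred (expo_s D) (C0 i1 x)).
by field; rewrite z0 gt_eqF.
Qed.

Section fieldS.
Variables (pv qv : nat -> R).
Local Notation sg := (sdL pv qv).

(** The part of the field that remains random once the layers 1, ..., k are
    averaged out. *)
Definition fieldV (k : nat) (w : env) : V := fun i =>
  fieldG w.1 i + \sum_(k.+1 <= j < r.+2) fieldL (sg j) (w.2 j) i.

Lemma fieldV_upd k w a : (0 < k <= r.+1)%N ->
  fieldV k.-1 (w.1, upd w.2 k a) = padd (fieldV k w) (fieldL (sg k) a).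
Proof.
case: k => // k; rewrite /= ltnS => kr; apply/funext => i; rewrite /fieldV /padd /= big_ltn ?ltnS//.
rewrite /upd eqxx [fieldL _ _ _ + _]addrC addrA; congr (_ + _ + _).
by apply: eq_big_nat => j /andP[kj _]; rewrite gtn_eqF.
Qed.

Lemma D0E i1 i2 i3 w : D0 D r t pv qv i1 i2 i3 w = fieldV 0 w (i1, i2) + fn D (xbars D i3) (xs D i1).
Proof.
rewrite /D0 /fieldV; congr (_ + _).
rewrite -!addrA; congr (_ + _).
  rewrite dot_sum mulr_sumr /fieldG; apply: eq_bigr => a _.
  rewrite !mxE !mulr_sumr; apply: eq_bigr => b _.
  by rewrite /Gmat mxE /dirG /=; ring.
have e j : fieldL (sg j) (w.2 j) (i1, i2) =
   Num.sqrt (1 - t) * norm2 (xs D i1) * dot (ys D i2) (bk pv j *: u2 w j)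
   + (Num.sqrt t * norm2 (xs D i1) * norm2 (ys D i2) * (ak pv qv j * u4 w j)
   + Num.sqrt (1 - t) * norm2 (ys D i2) * dot (ck qv j *: hv w j) (xs D i1)).
  rewrite /fieldL sum_coordsL !dot_sum !mulr_sumr addrCA; congr (_ + (_ + _)).
  - by apply: eq_bigr => a _; rewrite /sdL /entryL /dirL /u2 /cvec !mxE /=; ring.
  - by rewrite /sdL /entryL /dirL /u4 /=; ring.
  - by apply: eq_bigr => a _; rewrite /sdL /entryL /dirL /hv /cvec !mxE /=; ring.
under [RHS]eq_bigr do rewrite e.
rewrite !big_split /=; congr (_ + (_ + _)).
- rewrite dot_sum -mulr_sumr; congr (_ * _).
  under [RHS]eq_bigr do rewrite dot_sum.
  rewrite exchange_big /=; apply: eq_bigr => a _.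
  by rewrite summxE mulr_sumr.
- by rewrite -mulr_sumr.
- rewrite dot_sum -mulr_sumr; congr (_ * _).
  under [RHS]eq_bigr do rewrite dot_sum.
  rewrite exchange_big /=; apply: eq_bigr => a _.
  by rewrite summxE mulr_suml.
Qed.

(** A layer integral is a convolution, provided that the integrand depends on the
    layers only through the field that contains layer k and the later ones. *)
Lemma E_U_gconvs k (F : env -> R) (Fh : V -> R) w : (0 < k <= r.+1)%N -> tame1 Fh ->
  (forall a, F (w.1, upd w.2 k a) = Fh (fieldV k.-1 (w.1, upd w.2 k a))) ->
  E_U k F w = gconvs dirL (sg k) coordsL Fh (fieldV k w).
Proof.
move=> kr tF FF; have e := gnoise_Rint (fieldV k w) (gnoise_layer (sg k)) tF.
rewrite -[RHS]e /E_U.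
by apply: eq_Rintegral => a _; rewrite FF fieldV_upd.
Qed.

Variable (mv : nat -> R).
Local Notation p := (expo_p D).
Local Notation ezV := (ezV dirL coordsL Zh mv sg).
Local Notation zetaV := (zetaV dirL coordsL Zh p mv sg).
Local Notation phi1V := (phi1V dirL coordsL Zh mv sg).
Local Notation phiV := (phiV dirL coordsL Zh p mv sg).
Local Notation phisV := (phisV dirL coordsL Zh p mv sg).
Local Notation g00V := (g00V dirL coordsL Zh p mv sg).
Local Notation g1V := (g1V dirL coordsL Zh g0h p mv sg).
Local Notation wV := (wV dirL coordsL Zh g0h p mv sg).

Lemma AwE i1 i2 i3 w : Aw D r t pv qv i1 i2 i3 w = Ah i1 i2 i3 (fieldV 0 w).
Proof. by rewrite /Aw /Ah D0E. Qed.
Lemma CwE i1 i3 w : Cw D r t pv qv i1 i3 w = Ch i1 i3 (fieldV 0 w).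
Proof. by apply: eq_bigr => i2 _; rewrite AwE. Qed.
Lemma ZwE i3 w : Zw D r t pv qv i3 w = Zh i3 (fieldV 0 w).
Proof. by apply: eq_bigr => i1 _; rewrite CwE. Qed.
Lemma gamma0E i1 i2 i3 w : gamma0 D r t pv qv i1 i2 i3 w = g0h i3 (i1, i2) (fieldV 0 w).
Proof. by rewrite /gamma0 /g0h CwE ZwE AwE. Qed.

Lemma EZE i3 w : EZ D r t mv pv qv i3 w = ezV i3 (fieldV 1 w).
Proof.
have tF := (ccvg_powR (mv 1%N) (pccvg_Zh i3)).1.
rewrite /EZ (@E_U_gconvs 1%N _ (fun x => Zh i3 x `^ mv 1%N) w isT tF); first by [].
by move=> a; rewrite ZwE.
Qed.

Let ptz k : (0 < k)%N -> pcont (zetaV k).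
Proof. by move=> k0; exact: (pccvg_zetaV_cst i0 dirL coordsL p mv pccvg_Zh sg k0). Qed.

(** Averaging over layer k removes it from the field and is a convolution, layer
    by layer. *)
Lemma zetaE k w : (0 < k <= r.+1)%N -> zeta D r t mv pv qv k w = zetaV k (fieldV k w).
Proof.
case: k => // k; rewrite ltnS; elim: k w => [|k IH] w kr.
  by apply: eq_bigr => i3 _; rewrite EZE.
have S : zeta D r t mv pv qv k.+2 w =
  E_U k.+2 (fun w' => zeta D r t mv pv qv k.+1 w' `^ (mv k.+2 / mv k.+1)) w by [].
rewrite {}S.
have k0 : (0 < k.+1)%N by [].
have tF := (ccvg_powR (mv k.+2 / mv k.+1) (ptz k0)).1.
have kr' : (0 < k.+2 <= r.+1)%N by rewrite ltnS.
rewrite (@E_U_gconvs k.+2 _ (fun x => zetaV k.+1 x `^ (mv k.+2 / mv k.+1)) w kr' tF); first by [].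
by move=> a; rewrite (IH _ (ltnW kr)).
Qed.

Lemma Phi1E i3 F Fh w : ccont Fh -> (forall w, F w = Fh (fieldV 0 w)) ->
  Phi1 D r t mv pv qv i3 F w = phi1V i3 Fh (fieldV 1 w).
Proof.
move=> cF FF; rewrite /Phi1 phi1VE.
have tF : tame1 (fun y => Zh i3 y `^ mv 1%N * Fh y).
  exact: (ccvgM (ccvg_powR (mv 1%N) (pccvg_Zh i3)) cF).1.
have e := congr1 (@^~ (fieldV 1 w)) (gconvsZ dirL (ezV i3 (fieldV 1 w))^-1 (sg 1%N) coordsL tF).
rewrite [RHS]mulrC; rewrite /= in e; rewrite -e.
have tF' := (ccvgZ (ezV i3 (fieldV 1 w))^-1 (ccvgM (ccvg_powR (mv 1%N) (pccvg_Zh i3)) cF)).1.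
rewrite (@E_U_gconvs 1%N _ _ w isT tF'); first by [].
by move=> a; rewrite EZE ZwE FF mulrAC mulrC mulrA.
Qed.

Lemma PhiE k F Fh w : (1 < k <= r.+1)%N -> ccont Fh -> (forall w, F w = Fh (fieldV k.-1 w)) ->
  Phi D r t mv pv qv k F w = phiV k Fh (fieldV k w).
Proof.
case: k => [//|[//|k]] /andP[_ kr] cF FF; rewrite phiVS /Phi -![k.+2.-1]/(k.+1) in FF *.
have k0 : (0 < k.+1)%N by [].
have cz := ccvg_powR (mv k.+2 / mv k.+1) (ptz k0).
have tF : tame1 (fun y => zetaV k.+1 y `^ (mv k.+2 / mv k.+1) * Fh y) := (ccvgM cz cF).1.
have e := congr1 (@^~ (fieldV k.+2 w)) (gconvsZ dirL (zetaV k.+2 (fieldV k.+2 w))^-1 (sg k.+2) coordsL tF).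
rewrite [RHS]mulrC; rewrite /= in e; rewrite -e.
have tF' := (ccvgZ (zetaV k.+2 (fieldV k.+2 w))^-1 (ccvgM cz cF)).1.
have kr' : (0 < k.+2 <= r.+1)%N by [].
rewrite (@E_U_gconvs k.+2 _ _ w kr' tF'); first by [].
move=> a; rewrite (zetaE (k := k.+2))// (zetaE (k := k.+1)) ?(ltnW kr)// FF.
by rewrite mulrAC mulrC mulrA.
Qed.

Lemma PhisE b a F Fh w : (1 < a)%N -> (a.-1 <= b <= r.+1)%N -> ccont Fh ->
  (forall w, F w = Fh (fieldV a.-1 w)) ->
  Phis D r t mv pv qv b a F w = phisV b a Fh (fieldV b w).
Proof.
move=> a1 /andP[ab br] cF FF; elim: b ab br w => [|b IH].
  by rewrite leqn0 -subn1 subn_eq0 leqNgt a1.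
move=> ab br w; have [ab'|ab'] := leqP a b.+1; last first.
  have aE : a.-1 = b.+1 by apply/eqP; rewrite eqn_leq ab -ltnS prednK ?(ltnW a1).
  rewrite /Phis /index_iota (_ : b.+2 - a = 0)%N /=; last by apply/eqP; rewrite subn_eq0.
  by rewrite phisV_nil// FF aE.
have S G : Phis D r t mv pv qv b.+1 a G = Phi D r t mv pv qv b.+1 (Phis D r t mv pv qv b a G).
  by rewrite /Phis /index_iota subSn// -addn1 iotaD foldl_cat /= subnKC.
rewrite S phisVS//; apply: PhiE.
- by rewrite br (leq_trans a1).
- exact: (ccvg_phisV i0 dirL coordsL p mv pccvg_Zh sg).
- move=> w'; apply: IH; last exact: ltnW.
  by rewrite -ltnS (leq_trans _ ab') ?prednK// ltnW.
Qed.

Lemma gamma00E i3 w : gamma00 D r t mv pv qv i3 w = g00V i3 (fieldV 1 w).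
Proof. by rewrite /gamma00 g00VE EZE; congr (_ / _); apply: eq_bigr => j _; rewrite EZE. Qed.

Lemma g1_V i1 i2 i3 w : g1 D r t mv pv qv i1 i2 i3 w = g1V i3 (i1, i2) (fieldV 1 w).
Proof.
rewrite /g1 gamma00E; congr (_ * _); apply: Phi1E; first exact: ccvg_g0h.
by move=> w'; exact: gamma0E.
Qed.

Lemma E_GU_gconvs (F : env -> R) (Fh : V -> R) : tame1 Fh ->
  (forall w, F w = Fh (fieldV r w)) ->
  E_GU r F = gconvs dirG (fun=> 1) coordsG (gconvs dirL (sg r.+1) coordsL Fh) (fun=> 0).
Proof.
move=> tF FF; have g := gnoise_prod gnoise_G (gnoise_layer (sg r.+1)).
rewrite -(gnoise_Rint (fun=> 0) g tF) /E_GU.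
apply: eq_Rintegral => z _; rewrite FF; congr Fh; apply/funext => i.
rewrite /fieldV /padd add0r /= big_nat1; congr (_ + _).
by rewrite /upd eqxx.
Qed.

End fieldS.
End bridge.

(** * The expectation over G and the last layer *)

(** A failure of convergence yields points at distance less than 1/(n+1) whose
    images stay away from l, hence a sequence. *)
Lemma within_seqP (R : realType) (S : set R) (g : R -> R) (x l : R) :
  (forall u : nat -> R, (forall n, S (u n)) -> (forall n, u n != x) ->
     u n @[n --> \oo] --> x -> g (u n) @[n --> \oo] --> l) ->
  g u @[u --> within S x^'] --> l.
Proof.
move=> H; apply: contrapT => gl.
have [e He] : exists e : {posnum R}, forall d : {posnum R},
    exists u, [/\ S u, u != x, `|u - x| < d%:num & `|l - g u| >= e%:num].
  apply: contrapT; apply: contra_not gl => /forallNP h.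
  apply/cvgrPdist_lt => e e0; have /existsNP[d hd] := h (PosNum e0).
  have : \forall u \near x^', S u -> `|l - g u| < e.
    near=> u => Su; rewrite ltNge; apply/negP => hu; apply: hd; exists u; split => //.
      by near: u; exact: nbhs_dnbhs_neq.
    near: u; apply: nbhs_dnbhs.
    by exists d%:num => //= z /=; rewrite distrC.
  exact.
have invn n : 0 < n.+1%:R^-1 :> R by rewrite invr_gt0.
pose u n := sval (cid (He (PosNum (invn n)))).
have uP n : [/\ S (u n), u n != x, `|u n - x| < n.+1%:R^-1 & `|l - g (u n)| >= e%:num].
  by rewrite /u; case: cid.
have ux : u n @[n --> \oo] --> x.
  have h0 : u n - x @[n --> \oo] --> (0 : R).
    apply: norm_cvg0; apply: (squeeze_cvgr (f := cst 0) (h := fun n => n.+1%:R^-1)).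
    - by apply: nearW => n; rewrite normr_ge0 ltW//; case: (uP n).
    - exact: cvg_cst.
    - exact: cvg_harmonic.
  rewrite (_ : (fun n => _) = (fun n => (u n - x) + x)).
    by rewrite -[X in _ --> X]add0r; apply: cvgD => //; exact: cvg_cst.
  by apply/funext => n; rewrite subrK.
have := H u (fun n => let: And4 a _ _ _ := uP n in a) (fun n => let: And4 _ b _ _ := uP n in b) ux.
move=> /cvgrPdist_lt/(_ e%:num (ltac:(by [])))[n0 _ /(_ n0 (leqnn _))] /=.
by rewrite ltNge; case: (uP n0) => _ _ _ ->.
Unshelve. all: by end_near. Qed.

Section outer.
Context {R : realType} {m n l : nat} (i0 : 'I_l) (D : model R m n l) (r : nat) (t : R).
Local Notation I := ('I_l * 'I_l)%type.
Local Notation V := (I -> R).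
Local Notation E := (option ('I_m + 'I_n)).
Local Notation dirL := (dirL D t).
Local Notation dirG := (dirG D t).
Local Notation Zh := (Zh D).
Local Notation g0h := (g0h D).
Local Notation p := (expo_p D).
Variable mv : nat -> R.
Hypotheses (mvr : mv r.+1 = 0) (mv0 : forall k, (0 < k <= r)%N -> mv k != 0).
Variable k1 : nat.
Hypothesis k1b : (0 < k1 <= r)%N.

Let k10 : (0 < k1)%N. Proof. by case/andP: k1b. Qed.
Let k1r : (k1 <= r)%N. Proof. by case/andP: k1b. Qed.
Let pZ := pccvg_Zh i0 D.
Let cga := ccvg_g0h i0 D.

Definition pairk (h : 'I_l -> 'I_l -> 'I_l -> 'I_l -> R) (i i' : I) : R := h i.1 i.2 i'.1 i'.2.

Section avg.
Variables pv qv : nat -> R.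
Local Notation sg := (sdL pv qv).
Local Notation phisV := (phisV dirL coordsL Zh p mv sg).
Local Notation g1V := (g1V dirL coordsL Zh g0h p mv sg).
Local Notation wV := (wV dirL coordsL Zh g0h p mv sg).
Local Notation avgS := (avgS dirL coordsL Zh g0h p mv k1 sg r).
Local Notation avg22 := (avg22 dirL coordsL Zh g0h p mv sg r).

Let A j i := phisV k1 2 (g1V j i).
Let cA j i : ccont (A j i).
Proof. by apply: ccvg_phisV => //; exact: ccvg_g1V. Qed.

Lemma gammaSE i1 i2 i3 p1 p2 p3 w :
  gammaS D r t mv pv qv k1 i1 i2 i3 p1 p2 p3 w =
  phisV r k1.+1 (fun x => A i3 (i1, i2) x * A p3 (p1, p2) x) (fieldV D r t pv qv r w).
Proof.
have cg j i := ccvg_g1V i0 dirL coordsL p mv pZ cga sg j i.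
rewrite /gammaS; apply: (PhisE i0) => //.
- by rewrite /= k1r leqnSn.
- by apply: (ccvgM (F := fun=> _) (G := fun=> _)).
- move=> w'; congr (_ * _); apply: (PhisE i0) => //=; try by rewrite k10 (leq_trans k1r).
  + by move=> w2; exact: (g1_V i0).
  + by move=> w2; exact: (g1_V i0).
Qed.

Lemma avg6E h w : avg6 (gammaS D r t mv pv qv k1) h w = avgS (pairk h) (fieldV D r t pv qv r w).
Proof.
have k11 : (1 < k1.+1)%N by [].
have wE i : wV k1 i = (fun x => \sum_j A j i x).
  exact: (phisV_sum i0 dirL coordsL p mv pZ sg (index_enum 'I_l) k1 (isT : (1 < 2)%N) (fun j => ccvg_g1V i0 dirL coordsL p mv pZ cga sg j i)).
set x := fieldV D r t pv qv r w.
have phiE i i' : phisV r k1.+1 (fun y => wV k1 i y * wV k1 i' y) x =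
   \sum_j \sum_j' phisV r k1.+1 (fun y => A j i y * A j' i' y) x.
  have c1 j j' : ccont (fun y => A j i y * A j' i' y).
    exact: (ccvgM (F := fun=> A j i) (G := fun=> A j' i')).
  have c2 j : ccont (fun y => \sum_j' A j i y * A j' i' y).
    exact: (@ccvg_sum _ _ 'I_l _ (fun j' _ => (fun y => A j i y * A j' i' y)) _ (c1 j)).
  have e1 : (fun y => wV k1 i y * wV k1 i' y) = (fun y => \sum_j \sum_j' A j i y * A j' i' y).
    by apply/funext => y; rewrite !wE mulr_suml; apply: eq_bigr => j _; rewrite mulr_sumr.
  rewrite e1.
  have := congr1 (@^~ x) (phisV_sum i0 dirL coordsL p mv pZ sg (index_enum 'I_l) r k11 c2).
  rewrite /= => ->; apply: eq_bigr => j _.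
  by have := congr1 (@^~ x) (phisV_sum i0 dirL coordsL p mv pZ sg (index_enum 'I_l) r k11 (c1 j)).
rewrite /avg6 avgSE.
transitivity (\sum_i1 \sum_i2 \sum_p1 \sum_p2 h i1 i2 p1 p2 *
   phisV r k1.+1 (fun y => wV k1 (i1, i2) y * wV k1 (p1, p2) y) x).
  apply: eq_bigr => i1 _; apply: eq_bigr => i2 _.
  rewrite exchange_big /=; apply: eq_bigr => p1 _.
  rewrite exchange_big /=; apply: eq_bigr => p2 _.
  rewrite phiE mulr_sumr; apply: eq_bigr => i3 _.
  by rewrite mulr_sumr; apply: eq_bigr => p3 _; rewrite gammaSE.
rewrite pair_bigA; apply: eq_bigr => -[i1 i2] _ /=.
by rewrite pair_bigA; apply: eq_bigr => -[p1 p2] _.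
Qed.

Lemma avg5E h w : avg5 (gamma22 D r t mv pv qv) h w = avg22 (pairk h) (fieldV D r t pv qv r w).
Proof.
have r0 : (0 < r)%N := leq_trans k10 k1r.
rewrite /avg5 avg22E; set x := fieldV D r t pv qv r w.
have gE i1 i2 i3 p1 p2 : gamma22 D r t mv pv qv i1 i2 i3 p1 p2 w =
  phisV r 2 (fun y => g00V dirL coordsL Zh p mv sg i3 y *
    (phi1V dirL coordsL Zh mv sg i3 (g0h i3 (i1, i2)) y * phi1V dirL coordsL Zh mv sg i3 (g0h i3 (p1, p2)) y)) x.
  rewrite /gamma22; apply: (PhisE i0) => //.
  - by rewrite /= r0 leqnSn.
  - exact: (ccvg_gpp dirL coordsL p mv pZ cga sg i3 (i1, i2) (p1, p2)).
  - move=> w'; rewrite (gamma00E i0); congr (_ * (_ * _)); apply: (Phi1E i0) => //.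
      by move=> w2; exact: gamma0E.
    by move=> w2; exact: gamma0E.
transitivity (\sum_i1 \sum_i2 \sum_p1 \sum_p2 h i1 i2 p1 p2 *
   \sum_j phisV r 2 (fun y => g00V dirL coordsL Zh p mv sg j y *
    (phi1V dirL coordsL Zh mv sg j (g0h j (i1, i2)) y * phi1V dirL coordsL Zh mv sg j (g0h j (p1, p2)) y)) x).
  apply: eq_bigr => i1 _; apply: eq_bigr => i2 _.
  rewrite exchange_big /=; apply: eq_bigr => p1 _.
  rewrite exchange_big /=; apply: eq_bigr => p2 _.
  by rewrite mulr_sumr; apply: eq_bigr => j _; rewrite gE.
rewrite pair_bigA; apply: eq_bigr => -[i1 i2] _ /=.
by rewrite pair_bigA; apply: eq_bigr => -[p1 p2] _.
Qed.

(** The laws of G and of layer r+1 act by convolution, starting from the zero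
    field. *)
Definition outerE (F : V -> R) : R :=
  gconvs dirG (fun=> 1) coordsG (gconvs dirL (sg r.+1) coordsL F) (fun=> 0).

Lemma outerED F G : tame1 F -> tame1 G -> outerE (fun x => F x + G x) = outerE F + outerE G.
Proof.
move=> tF tG; rewrite /outerE (gconvsD dirL (sg r.+1) coordsL tF tG).
by rewrite (gconvsD dirG (fun=> 1) coordsG (tame_gconvs dirL (sg r.+1) coordsL tF) (tame_gconvs dirL (sg r.+1) coordsL tG)).
Qed.

Lemma outerEZ a F : tame1 F -> outerE (fun x => a * F x) = a * outerE F.
Proof.
move=> tF; rewrite /outerE (gconvsZ dirL a (sg r.+1) coordsL tF).
by rewrite (gconvsZ dirG a (fun=> 1) coordsG (tame_gconvs dirL (sg r.+1) coordsL tF)).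
Qed.

Lemma tame_avgS h : tame1 (avgS h).
Proof.
apply: (tame_sum (index_enum I)) => i; apply: (tame_sum (index_enum I)) => i'.
apply: (tameM (F := fun=> fun=> _) (G := fun=> _)); first exact: tame_cst.
have c1 : ccont (phisV r k1.+1 (fun y => wV k1 i y * wV k1 i' y)).
  apply: (ccvg_phisV i0) => //; apply: (ccvgM (F := fun=> _) (G := fun=> _)); exact: (ccvg_wV i0).
exact: c1.1.
Qed.

Lemma tame_avg22 h : tame1 (avg22 h).
Proof.
apply: (tame_sum (index_enum I)) => i; apply: (tame_sum (index_enum I)) => i'.
apply: (tameM (F := fun=> fun=> _) (G := fun=> _)); first exact: tame_cst.
apply: (tame_sum (index_enum 'I_l)) => j.
have c1 := ccvg_phisV i0 dirL coordsL p mv pZ sg r (isT : (1 < 2)%N) (ccvg_gpp dirL coordsL p mv pZ cga sg j i i').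
exact: c1.1.
Qed.

Lemma ES_outerE h : ES D r t mv pv qv k1 h = outerE (avgS (pairk h)).
Proof. by rewrite /ES (E_GU_gconvs (tame_avgS (pairk h)) (avg6E h)). Qed.

Lemma E22_outerE h : E22 D r t mv pv qv h = outerE (avg22 (pairk h)).
Proof. by rewrite /E22 (E_GU_gconvs (tame_avg22 (pairk h)) (avg5E h)). Qed.

Lemma outerE_avgS_lin a b (h1 h2 : I -> I -> R) :
  outerE (avgS (fun i i' => a * h1 i i' + b * h2 i i')) = a * outerE (avgS h1) + b * outerE (avgS h2).
Proof.
have ta : tame1 (fun x => a * avgS h1 x) by apply: (tameM (tame_cst a) (tame_avgS h1)).
have tb : tame1 (fun x => b * avgS h2 x) by apply: (tameM (tame_cst b) (tame_avgS h2)).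
rewrite -(outerEZ a (tame_avgS h1)) -(outerEZ b (tame_avgS h2)) -(outerED ta tb); congr outerE.
apply/funext => x; rewrite !avgSE !mulr_sumr -big_split; apply: eq_bigr => i _ /=.
rewrite !mulr_sumr -big_split; apply: eq_bigr => i' _ /=; ring.
Qed.

Lemma outerE_avg22_lin a b (h1 h2 : I -> I -> R) :
  outerE (avg22 (fun i i' => a * h1 i i' + b * h2 i i')) = a * outerE (avg22 h1) + b * outerE (avg22 h2).
Proof.
have ta : tame1 (fun x => a * avg22 h1 x) by apply: (tameM (tame_cst a) (tame_avg22 h1)).
have tb : tame1 (fun x => b * avg22 h2 x) by apply: (tameM (tame_cst b) (tame_avg22 h2)).
rewrite -(outerEZ a (tame_avg22 h1)) -(outerEZ b (tame_avg22 h2)) -(outerED ta tb); congr outerE.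
apply/funext => x; rewrite !avg22E !mulr_sumr -big_split; apply: eq_bigr => i _ /=.
rewrite !mulr_sumr -big_split; apply: eq_bigr => i' _ /=.
by rewrite mulrDl !mulrA.
Qed.

Lemma psiE : psi D r t mv pv qv =
  (p * `|expo_s D| * Num.sqrt n%:R * mv r)^-1 *
  outerE (fun y => ln (zetaV dirL coordsL Zh p mv sg r y)).
Proof.
have r0 : (0 < r)%N := leq_trans k10 k1r.
set k := (p * _ * _ * _)^-1.
have pz := pccvg_zetaV_cst i0 dirL coordsL p mv pZ sg r0.
have tl := (ccvg_powlike powlike_ln pz).1.
rewrite -(outerEZ k tl) /psi.
have tkl : tame1 (fun y => k * ln (zetaV dirL coordsL Zh p mv sg r y)) := tameM (tame_cst k) tl.
apply: (E_GU_gconvs tkl) => w.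
by rewrite (zetaE i0) ?r0 ?leqnSn// mulrC.
Qed.

End avg.

Local Notation c := (expo_s D * beta D).

Definition ln_zeta_outerE (sg : nat -> E -> R) : R :=
  gconvs dirG (fun=> 1) coordsG (gconvs dirL (sg r.+1) coordsL
    (fun y => ln (zetaV dirL coordsL Zh p mv sg r y))) (fun=> 0).

Section deriv.
Variables (pv qv : nat -> R) (sgu : R -> nat -> E -> R) (S : set R) (u0 kap : R) (dE : E -> R).
Hypotheses (Su0 : S u0) (sgu0 : sgu u0 = sdL pv qv).
Hypothesis sgu_ge0 : forall u k e, 0 <= sgu u k e.
Hypothesis dE0 : forall e, 0 <= dE e.
Hypothesis sgu_inner : forall u u' e, S u -> S u' -> u <= u' ->
  sgu u k1 e ^+ 2 = sgu u' k1 e ^+ 2 + dE e * (u' - u).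
Hypothesis sgu_outer : forall u u' e, S u -> S u' -> u <= u' ->
  sgu u' k1.+1 e ^+ 2 = sgu u k1.+1 e ^+ 2 + dE e * (u' - u).
Hypothesis sgu_far : forall u k, k != k1 -> k != k1.+1 -> sgu u k = sgu u0 k.
Hypothesis sgu_cvg : forall (u : nat -> R) k e, (forall n, S (u n)) -> u n @[n --> \oo] --> u0 ->
  sgu (u n) k e @[n --> \oo] --> sgu u0 k e.

Local Notation avgS := (avgS dirL coordsL Zh g0h p mv k1 (sdL pv qv) r).
Local Notation avg22 := (avg22 dirL coordsL Zh g0h p mv (sdL pv qv) r).
Local Notation CC := (Cov dirL coordsL dE).

(** The derivative along any one-parameter family of schedules that moves variance
    between the layers k1 and k1+1 at the rates dE.  Increasing u decreases the
    variance of the inner layer. *)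
Lemma outer_derivative :
  is_derive_within S (fun u => kap * ln_zeta_outerE (sgu u)) u0
    (kap * (mv r / mv k1 *
      ((mv k1.+1 / mv k1 - 1) / 2 * (mv k1 * p * c) ^+ 2 * outerE pv qv (avgS CC) +
       (if k1 == 1%N then p * (p - 1) / 2 * (mv 1%N * c) ^+ 2 * outerE pv qv (avg22 CC) else 0)))).
Proof.
apply: within_seqP => u Su un0 uc.
(* The transfer has a sign, so the two end points are put in increasing order;
   the difference quotient is symmetric in them. *)
pose hi j := Num.max (u j) u0; pose lo j := Num.min (u j) u0.
pose delta j := hi j - lo j.
have hilo j : lo j <= hi j by rewrite /lo /hi; case: (leP (u j) u0) => // /ltW.
have Shi j : S (hi j) by rewrite /hi; case: (leP (u j) u0).
have Slo j : S (lo j) by rewrite /lo; case: (leP (u j) u0).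
have d0 j : 0 < delta j.
  by rewrite /delta subr_gt0 /lo /hi; have := un0 j; case: (ltgtP (u j) u0).
have u0c : (fun=> u0) n @[j --> \oo] --> u0 by exact: cvg_cst.
have near_u0 (v : nat -> R) : (forall j, v j = u j \/ v j = u0) -> v j @[j --> \oo] --> u0.
  move=> vE; apply/cvgrPdist_lt => e e0.
  have /cvgrPdist_lt/(_ e e0) := uc; apply: filterS => j.
  by case: (vE j) => -> //; rewrite subrr normr0.
have hic : hi j @[j --> \oo] --> u0.
  by apply: near_u0 => j; rewrite /hi; case: (leP (u j) u0); [right|left].
have loc : lo j @[j --> \oo] --> u0.
  by apply: near_u0 => j; rewrite /lo; case: (leP (u j) u0); [left|right].
have dc : delta j @[j --> \oo] --> (0 : R).
  by rewrite -[X in _ --> X](subrr u0); exact: cvgB.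
have A0 j k e : 0 <= sgu (hi j) k e by [].
have B0 j k e : 0 <= sgu (lo j) k e by [].
have Ac k e : sgu (hi j) k e @[j --> \oo] --> sdL pv qv k e by rewrite -sgu0; exact: sgu_cvg.
have Bc k e : sgu (lo j) k e @[j --> \oo] --> sdL pv qv k e by rewrite -sgu0; exact: sgu_cvg.
have E1 j e : sgu (lo j) k1 e ^+ 2 = sgu (hi j) k1 e ^+ 2 + dE e * delta j by exact: sgu_inner.
have E2 j e : sgu (hi j) k1.+1 e ^+ 2 = sgu (lo j) k1.+1 e ^+ 2 + dE e * delta j by exact: sgu_outer.
have Aeq j k : k != k1 -> k != k1.+1 -> sgu (hi j) k = sdL pv qv k by rewrite -sgu0; exact: sgu_far.
have Beq j k : k != k1 -> k != k1.+1 -> sgu (lo j) k = sdL pv qv k by rewrite -sgu0; exact: sgu_far.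
have FL := ln_zeta_quot i0 dirL coordsL p pZ cga (dder_Zh i0 D) k10 dE0 d0 dc
  (sA := fun j => sgu (hi j)) (sB := fun j => sgu (lo j)) A0 B0 Ac Bc E1 E2 Aeq Beq k1r mvr mv0.
have cl (e : 'I_m * 'I_n) : (fun=> 1 : R) n @[j --> \oo] --> (1 : R) by exact: cvg_cst.
have GL := @ccvg_gconvs _ _ _ dirG _ _ (fun=> fun=> 1) (fun=> 1) coordsG FL cl.
have := GL.2 (fun=> fun=> 0) (fun=> 0) (@ptcvg_cst _ _ _).
set LIM := gconvs dirG _ _ _ _ => GLc.
have eLIM : LIM = mv r / mv k1 *
      ((mv k1.+1 / mv k1 - 1) / 2 * (mv k1 * p * c) ^+ 2 * outerE pv qv (avgS CC) +
       (if k1 == 1%N then p * (p - 1) / 2 * (mv 1%N * c) ^+ 2 * outerE pv qv (avg22 CC) else 0)).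
  have t1 := tame_avgS pv qv CC; have t2 := tame_avg22 pv qv CC.
  have ta : tame1 (fun x => (mv k1.+1 / mv k1 - 1) / 2 * (mv k1 * p * c) ^+ 2 * avgS CC x).
    exact: (tameM (tame_cst _) t1).
  pose F2 x := if k1 == 1%N then p * (p - 1) / 2 * (mv 1%N * c) ^+ 2 * avg22 CC x else 0.
  have tb : tame1 F2.
    by rewrite /F2; case: (k1 == 1%N); [exact: (tameM (tame_cst _) t2)|exact: tame_cst].
  have -> : LIM = outerE pv qv (fun x => mv r / mv k1 *
      ((mv k1.+1 / mv k1 - 1) / 2 * (mv k1 * p * c) ^+ 2 * avgS CC x + F2 x)).
    rewrite /LIM /outerE; congr (gconvs _ _ _ (gconvs _ _ _ _) _); apply/funext => x.
    by rewrite (phisV_rate i0 dirL coordsL c p mv pZ cga dE k10 (sdL pv qv) r x).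
  rewrite (outerEZ pv qv (mv r / mv k1) (tameD ta tb)) (outerED pv qv ta tb).
  rewrite (outerEZ pv qv ((mv k1.+1 / mv k1 - 1) / 2 * (mv k1 * p * c) ^+ 2) t1).
  congr (_ * (_ + _)); rewrite /F2; case: (k1 == 1%N); first by rewrite (outerEZ pv qv _ t2).
  rewrite -[RHS](mul0r (outerE pv qv (fun=> 0))) -(outerEZ pv qv 0 (tame_cst (I := I) (0 : R))).
  by congr (outerE pv qv _); apply/funext => x; rewrite mul0r.
rewrite -eLIM; have kc : (fun=> kap) n @[j --> \oo] --> kap by exact: cvg_cst.
have KG := cvgM kc GLc.
apply: cvg_trans; last exact: KG.
apply: near_eq_cvg; apply: nearW => k.
have zA := pccvg_zetaV_cst i0 dirL coordsL p mv pZ (sgu (hi k)) (leq_trans k10 k1r).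
have zB := pccvg_zetaV_cst i0 dirL coordsL p mv pZ (sgu (lo k)) (leq_trans k10 k1r).
have tA := tame_gconvs dirL (sgu (hi k) r.+1) coordsL (ccvg_powlike powlike_ln zA).1.
have tB := tame_gconvs dirL (sgu (lo k) r.+1) coordsL (ccvg_powlike powlike_ln zB).1.
transitivity (kap * ((ln_zeta_outerE (sgu (hi k)) - ln_zeta_outerE (sgu (lo k))) / delta k)).
  by congr (kap * _); exact: (gconvs_quot dirG (fun=> 1) coordsG (delta k) (fun=> 0) tA tB).
have Hq : (ln_zeta_outerE (sgu (hi k)) - ln_zeta_outerE (sgu (lo k))) / delta k =
    (ln_zeta_outerE (sgu (u k)) - ln_zeta_outerE (sgu u0)) / (u k - u0).
  rewrite /delta /hi /lo; case: (leP (u k) u0) => // _.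
  by rewrite -[in RHS]opprB -[in RHS](opprB u0) invrN mulrNN.
by rewrite Hq mulrA mulrBr.
Qed.

End deriv.
End outer.

(** * Variance schedules *)

Section schedule.
Context {R : realType}.
Implicit Types (a b : nat -> R) (u : R) (j k : nat).

Lemma ckE a j : ck a j = bk a j. Proof. by []. Qed.

Lemma akC a b : ak a b = ak b a.
Proof. by apply/funext => j; rewrite /ak ![a _ * _]mulrC. Qed.

Lemma upd_id a k : upd a k (a k) = a.
Proof. by apply/funext => j; rewrite /upd; case: eqP => [->|]. Qed.

Lemma upd_cvg a k j (u : nat -> R) u0 : u i @[i --> \oo] --> u0 ->
  upd a k (u i) j @[i --> \oo] --> upd a k u0 j.
Proof. by rewrite /upd; case: eqP => // _ _; exact: cvg_cst. Qed.

Lemma ak_cvg a b k j (u : nat -> R) u0 : u i @[i --> \oo] --> u0 ->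
  ak (upd a k (u i)) b j @[i --> \oo] --> ak (upd a k u0) b j.
Proof.
move=> uc; rewrite /ak.
have cb i : (fun=> b i) x @[x --> \oo] --> b i by exact: cvg_cst.
apply: (@continuous_cvg _ _ _ _ _ _ Num.sqrt); first exact: sqrt_continuous.
by apply: cvgB; apply: cvgM => //; exact: upd_cvg.
Qed.

Lemma bk_cvg a k j (u : nat -> R) u0 : u i @[i --> \oo] --> u0 ->
  bk (upd a k (u i)) j @[i --> \oo] --> bk (upd a k u0) j.
Proof.
move=> uc; rewrite /bk.
apply: (@continuous_cvg _ _ _ _ _ _ Num.sqrt); first exact: sqrt_continuous.
by apply: cvgB; exact: upd_cvg.
Qed.

Lemma upd_pred a k u j : (0 < k)%N -> j != k.+1 -> j.-1 != k.
Proof. by case: j k => [|j] [|k]. Qed.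

Lemma ak_far a b k u j : (0 < k)%N -> j != k -> j != k.+1 -> ak (upd a k u) b j = ak a b j.
Proof. by move=> k0 jk jk1; rewrite /ak /upd (negPf jk) (negPf (upd_pred a u k0 jk1)). Qed.

Lemma bk_far a k u j : (0 < k)%N -> j != k -> j != k.+1 -> bk (upd a k u) j = bk a j.
Proof. by move=> k0 jk jk1; rewrite /bk /upd (negPf jk) (negPf (upd_pred a u k0 jk1)). Qed.

(* a is the vector whose coordinate k moves and b is the other one; the roles of p
   and q are exchanged by akC. *)
Variables (a b : nat -> R) (k : nat) (u : R).
Hypotheses (k0 : (0 < k)%N) (uS : u \in `[a k.+1, a k.-1]).
Hypotheses (a0 : 0 <= a k.+1) (b2 : 0 <= b k.+1) (b1 : b k.+1 <= b k) (b0 : b k <= b k.-1).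

Let ul : a k.+1 <= u. Proof. by move: uS; rewrite in_itv /= => /andP[]. Qed.
Let ur : u <= a k.-1. Proof. by move: uS; rewrite in_itv /= => /andP[]. Qed.
Let k_pred : k.-1 == k = false. Proof. by case: k k0 => // j _; rewrite /= ltn_eqF. Qed.
Let k_succ : k.+1 == k = false. Proof. by rewrite gtn_eqF. Qed.

Lemma ak_inner : ak (upd a k u) b k ^+ 2 = a k.-1 * b k.-1 - u * b k.
Proof.
rewrite /ak /upd k_pred eqxx sqr_sqrtr// subr_ge0.
by apply: ler_pM => //; [exact: le_trans ul|exact: le_trans b1].
Qed.

Lemma ak_outer : ak (upd a k u) b k.+1 ^+ 2 = u * b k - a k.+1 * b k.+1.
Proof. by rewrite /ak /upd k_succ /= eqxx sqr_sqrtr// subr_ge0; exact: ler_pM. Qed.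

Lemma bk_inner : bk (upd a k u) k ^+ 2 = a k.-1 - u.
Proof. by rewrite /bk /upd k_pred eqxx sqr_sqrtr// subr_ge0. Qed.

Lemma bk_outer : bk (upd a k u) k.+1 ^+ 2 = u - a k.+1.
Proof. by rewrite /bk /upd k_succ /= eqxx sqr_sqrtr// subr_ge0. Qed.

End schedule.

(** * The closed formulas *)

Section formula.
Context {R : realType} {m n l : nat} (i0 : 'I_l) (D : model R m n l) (r : nat) (t : R).
Hypothesis t01 : 0 <= t <= 1.
Local Notation I := ('I_l * 'I_l)%type.
Local Notation E := (option ('I_m + 'I_n)).
Local Notation dirL := (dirL D t).
Local Notation p := (expo_p D).
Local Notation s := (expo_s D).

Let sqrt_t : Num.sqrt t * Num.sqrt t = t.
Proof. by rewrite -expr2 sqr_sqrtr//; case/andP: t01. Qed.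
Let sqrt_1t : Num.sqrt (1 - t) * Num.sqrt (1 - t) = 1 - t.
Proof. by rewrite -expr2 sqr_sqrtr// subr_ge0; case/andP: t01. Qed.

(** Rates at which a unit change of p_k1 (of q_k1) moves the variances of u4, u2
    and h; a is q_k1 (respectively p_k1). *)
Definition rate_p (a : R) (e : E) : R :=
  match e with None => a | Some (inl _) => 1 | Some (inr _) => 0 end.
Definition rate_q (a : R) (e : E) : R :=
  match e with None => a | Some (inl _) => 0 | Some (inr _) => 1 end.

Lemma Cov_p a : Cov dirL coordsL (rate_p a) =
  (fun i i' => (1 - t) * pairk (hV D) i i' + (t * a) * pairk (hN D) i i').
Proof.
apply/funext => i; apply/funext => i'; rewrite /Cov sum_coordsL /= /pairk /hV /hN.
rewrite [X in _ + (_ + X)]big1 => [|b _]; last by rewrite mul0r.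
rewrite dot_sum addr0 addrC; congr (_ + _).
  rewrite !mulr_sumr; apply: eq_bigr => b _; rewrite -[in RHS]sqrt_1t; ring.
by rewrite -[in RHS]sqrt_t; ring.
Qed.

Lemma Cov_q a : Cov dirL coordsL (rate_q a) =
  (fun i i' => (1 - t) * pairk (hW D) i i' + (t * a) * pairk (hN D) i i').
Proof.
apply/funext => i; apply/funext => i'; rewrite /Cov sum_coordsL /= /pairk /hW /hN.
rewrite [X in _ + (X + _)]big1 => [|b _]; last by rewrite mul0r.
rewrite dot_sum add0r addrC; congr (_ + _).
  rewrite !mulr_sumr; apply: eq_bigr => b _; rewrite -[in RHS]sqrt_1t; ring.
by rewrite -[in RHS]sqrt_t; ring.
Qed.

Hypotheses (p0 : 0 < p) (s0 : s != 0) (n0 : (0 < n)%N).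
Variables mv pv qv : nat -> R.
Hypotheses (mvr : mv r.+1 = 0) (mv0 : forall k, (0 < k <= r)%N -> mv k != 0).
Variable k1 : nat.
Hypothesis k1b : (0 < k1 <= r)%N.

Local Notation avgS := (avgS dirL coordsL (Zh D) (g0h D) p mv k1 (sdL pv qv) r).
Local Notation avg22 := (avg22 dirL coordsL (Zh D) (g0h D) p mv (sdL pv qv) r).
Local Notation kap := ((p * `|s| * Num.sqrt n%:R * mv r)^-1).
Local Notation E21 := (E21 D r t mv pv qv).
Local Notation E22 := (E22 D r t mv pv qv).
Local Notation ES := (ES D r t mv pv qv k1).

(** Since m_r cancels against the normalization of psi, the constants reduce to
    (m_(k1+1) - m_k1) p s^2 beta^2 / (2 |s| sqrt n), and similarly with
    m_1 (p-1) for the second average. *)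
Lemma rate_formula dE h (v : nat -> R) :
  Cov dirL coordsL dE = (fun i i' => (1 - t) * pairk h i i' + (t * v k1) * pairk (hN D) i i') ->
  kap * (mv r / mv k1 *
      ((mv k1.+1 / mv k1 - 1) / 2 * (mv k1 * p * (s * beta D)) ^+ 2 *
         outerE D r t pv qv (avgS (Cov dirL coordsL dE)) +
       (if k1 == 1%N then p * (p - 1) / 2 * (mv 1%N * (s * beta D)) ^+ 2 *
         outerE D r t pv qv (avg22 (Cov dirL coordsL dE)) else 0))) =
  Num.sg s * s * beta D ^+ 2 / (2 * Num.sqrt n%:R) *
    (if k1 == 1%N then
      - (1 - t) * (mv 1%N - mv 2%N) * p * E21 h
      - t * v 1%N * (mv 1%N - mv 2%N) * p * E21 (hN D)
      + (1 - t) * mv 1%N * (p - 1) * E22 h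
      + t * v 1%N * mv 1%N * (p - 1) * E22 (hN D)
    else
      - (1 - t) * (mv k1 - mv k1.+1) * p * ES h
      - t * v k1 * (mv k1 - mv k1.+1) * p * ES (hN D)).
Proof.
move=> ->; rewrite (outerE_avgS_lin i0 D t mv k1b pv qv) (outerE_avg22_lin i0 D r t mv pv qv).
rewrite -!(ES_outerE i0 D t mv k1b pv qv) -!(E22_outerE i0 D t mv k1b pv qv).
have r0 : (0 < r)%N by case/andP: k1b => k10; exact: leq_trans.
have mr0 : mv r != 0 by apply: mv0; rewrite r0 leqnn.
have mk0 : mv k1 != 0 by exact: mv0.
have sn0 : `|s| != 0 by rewrite normr_eq0.
have sq : Num.sqrt n%:R != 0 :> R by rewrite gt_eqF// sqrtr_gt0 ltr0n.
have pp : p != 0 by rewrite gt_eqF.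
rewrite -[Num.sg s * s]normrEsg !exprMn -(real_normK (num_real s)).
case: (k1 =P 1%N) mk0 => [->|_] mk0; last by field; rewrite mr0 mk0 sq sn0 pp.
rewrite -[Defs.ES D r t mv pv qv 1 h]/(E21 h) -[Defs.ES D r t mv pv qv 1 (hN D)]/(E21 (hN D)).
by field; rewrite mr0 mk0 sq sn0 pp.
Qed.

End formula.

Lemma decreasing_ge0 (R : realType) (r : nat) (v : nat -> R) :
  (forall k, (k <= r)%N -> v k.+1 <= v k) -> v r.+1 = 0 ->
  forall k, (k <= r.+1)%N -> 0 <= v k.
Proof.
move=> vd vr k kr; rewrite -(subKn kr).
elim: (r.+1 - k)%N (leq_subr k r.+1) => [|d IH] dr; first by rewrite subn0 vr.
by apply: (le_trans (IH (ltnW dr))); rewrite subSS subSn//; apply: vd; exact: leq_subr.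
Qed.

Theorem theorem1 (R : realType) (r m n l : nat)
    (r_gt0 : (0 < r)%N) (m_gt0 : (0 < m)%N) (n_gt0 : (0 < n)%N)
    (l_gt0 : (0 < l)%N)
    (D : model R m n l)
    (beta_gt0 : 0 < beta D) (p_gt0 : 0 < expo_p D) (s_neq0 : expo_s D != 0)
    (mv pv qv : nat -> R)
    (mv0 : mv 0%N = 1) (mvr : mv r.+1 = 0)
    (mv_neq0 : forall k, (1 <= k <= r)%N -> mv k != 0)
    (pv0 : pv 0%N <= 1) (pv_dec : forall k, (k <= r)%N -> pv k.+1 <= pv k)
    (pvr : pv r.+1 = 0)
    (qv0 : qv 0%N <= 1) (qv_dec : forall k, (k <= r)%N -> qv k.+1 <= qv k)
    (qvr : qv r.+1 = 0)
    (t : R) (t01 : 0 <= t <= 1)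
    (k1 : nat) (k1_bounds : (1 <= k1 <= r)%N) :
  let p := expo_p D in
  let s := expo_s D in
  let V := hV D in
  let W := hW D in
  let N := hN D in
  let E21 := E21 D r t mv pv qv in
  let E22 := E22 D r t mv pv qv in
  let ES := ES D r t mv pv qv k1 in
  let phip :=
    if k1 == 1%N then
      - (1 - t) * (mv 1%N - mv 2%N) * p * E21 V
      - t * qv 1%N * (mv 1%N - mv 2%N) * p * E21 N
      + (1 - t) * mv 1%N * (p - 1) * E22 V
      + t * qv 1%N * mv 1%N * (p - 1) * E22 N
    else
      - (1 - t) * (mv k1 - mv k1.+1) * p * ES V
      - t * qv k1 * (mv k1 - mv k1.+1) * p * ES N in
  let phiq :=
    if k1 == 1%N then
      - (1 - t) * (mv 1%N - mv 2%N) * p * E21 W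
      - t * pv 1%N * (mv 1%N - mv 2%N) * p * E21 N
      + (1 - t) * mv 1%N * (p - 1) * E22 W
      + t * pv 1%N * mv 1%N * (p - 1) * E22 N
    else
      - (1 - t) * (mv k1 - mv k1.+1) * p * ES W
      - t * pv k1 * (mv k1 - mv k1.+1) * p * ES N in
  (pv k1.+1 < pv k1.-1 ->
    is_derive_within `[pv k1.+1, pv k1.-1]
      (fun u => psi D r t mv (upd pv k1 u) qv) (pv k1)
      (Num.sg s * s * beta D ^+ 2 / (2 * Num.sqrt n%:R) * phip))
  /\
  (qv k1.+1 < qv k1.-1 ->
    is_derive_within `[qv k1.+1, qv k1.-1]
      (fun u => psi D r t mv pv (upd qv k1 u)) (qv k1)
      (Num.sg s * s * beta D ^+ 2 / (2 * Num.sqrt n%:R) * phiq)).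
Proof.
cbv zeta.
have k1b := k1_bounds; have /andP[k10 k1r] := k1b.
pose i0 := Ordinal l_gt0.
have pv_ge0 := decreasing_ge0 pv_dec pvr; have qv_ge0 := decreasing_ge0 qv_dec qvr.
have predK : k1.-1.+1 = k1 by rewrite prednK.
have pred_r : (k1.-1 <= r)%N by rewrite (leq_trans (leq_pred _)).
have k1S : (k1 <= r.+1)%N by rewrite leqW.
have p2 : 0 <= pv k1.+1 by exact: pv_ge0.
have p1 : pv k1.+1 <= pv k1 by exact: pv_dec.
have p0 : pv k1 <= pv k1.-1 by have := pv_dec _ pred_r; rewrite predK.
have q2 : 0 <= qv k1.+1 by exact: qv_ge0.
have q1 : qv k1.+1 <= qv k1 by exact: qv_dec.
have q0 : qv k1 <= qv k1.-1 by have := qv_dec _ pred_r; rewrite predK.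
pose kap := (expo_p D * `|expo_s D| * Num.sqrt n%:R * mv r)^-1.
split=> [plt|qlt].
  rewrite -(@rate_formula _ _ _ _ i0 _ _ _ p_gt0 s_neq0 n_gt0 _ pv qv mv_neq0 _ k1b _ _ qv (Cov_p D t01 _)).
  rewrite (_ : (fun u => _) = (fun u => kap * ln_zeta_outerE D r t mv (sdL (upd pv k1 u) qv))); last first.
    by apply/funext => u; exact: (psiE i0 D t mv k1b).
  apply: (outer_derivative i0 mvr mv_neq0 k1b) => //.
  - by rewrite /= in_itv /= p1.
  - by rewrite upd_id.
  - by move=> u k [[a|b]|]; exact: sqrtr_ge0.
  - by move=> [[a|b]|] //=; exact: le_trans q1.
  - move=> u u' [[a|b]|] uS u'S uu'; rewrite /=.
    + by rewrite !bk_inner//; ring.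
    + by ring.
    + by rewrite !ak_inner//; ring.
  - move=> u u' [[a|b]|] uS u'S uu'; rewrite /=.
    + by rewrite !bk_outer//; ring.
    + by ring.
    + by rewrite !ak_outer//; ring.
  - move=> u k kk1 kk1'; apply/funext => -[[a|b]|] //=.
      by rewrite !bk_far.
    by rewrite !ak_far.
  - move=> u k [[a|b]|] uS uc /=; [exact: bk_cvg|exact: cvg_cst|exact: ak_cvg].
rewrite -(@rate_formula _ _ _ _ i0 _ _ _ p_gt0 s_neq0 n_gt0 _ pv qv mv_neq0 _ k1b _ _ pv (Cov_q D t01 _)).
rewrite (_ : (fun u => _) = (fun u => kap * ln_zeta_outerE D r t mv (sdL pv (upd qv k1 u)))); last first.
  by apply/funext => u; exact: (psiE i0 D t mv k1b).
apply: (outer_derivative i0 mvr mv_neq0 k1b) => //.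
- by rewrite /= in_itv /= q1.
- by rewrite upd_id.
- by move=> u k [[a|b]|]; exact: sqrtr_ge0.
- by move=> [[a|b]|] //=; exact: le_trans p1.
- move=> u u' [[a|b]|] uS u'S uu'; rewrite /= ?(akC pv).
  + by ring.
  + by rewrite !ckE !bk_inner//; ring.
  + by rewrite !ak_inner//; ring.
- move=> u u' [[a|b]|] uS u'S uu'; rewrite /= ?(akC pv).
  + by ring.
  + by rewrite !ckE !bk_outer//; ring.
  + by rewrite !ak_outer//; ring.
- move=> u k kk1 kk1'; apply/funext => -[[a|b]|] //=.
    by rewrite !ckE !bk_far.
  by rewrite !(akC pv) !ak_far.
- move=> u k [[a|b]|] uS uc /=; [exact: cvg_cst|exact: bk_cvg|].
  rewrite (akC pv) (_ : (fun x => _) = (fun x => ak (upd qv k1 (u x)) pv k)); last first.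
    by apply/funext => x; rewrite akC.
  exact: ak_cvg.
Qed.
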